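(* Let $a>1/2$. There exists a constant $\tilde C_a$, depending only on $a$, such that for every $x\in(0,1)$, $$d_{\mathrm{TV}}(\tilde F_n(x),\beta_{a,a})\ \le\ \tilde C_a\,\bigl[d_{\mathrm{W}}(\tilde F_{n-1}(x),\beta_{a,a})\bigr]^{a/(a+1)}\qquad\text{for all } n\ge 1,$$ where $\beta_{a,a}$ denotes a random variable having the $\mathrm{Beta}(a,a)$ distribution.
   Context: Random logistic maps: for a fixed real $a>1/2$, let $B_1,B_2,\dots$ be i.i.d. random variables with the $\mathrm{Beta}(a+\frac12,a-\frac12)$ distribution (density $\frac{\Gamma(2a)}{\Gamma(a+1/2)\Gamma(a-1/2)}t^{a-1/2}(1-t)^{a-3/2}$ on $[0,1]$). Define the i.i.d. random maps $f_i:[0,1]\to[0,1]$, $f_i(x)=4B_i\,x(1-x)$. The forward iterates are $\tilde F_n(x)=f_n\circ f_{n-1}\circ\cdots\circ f_1(x)$ for $n\ge1$, with $\tilde F_0(x)=x$. For probability measures $\mu_1,\mu_2$ on $[0,1]$ (with the usual metric $|x-y|$): $d_{\mathrm{W}}(\mu_1,\mu_2)=\inf_M\int\int|x-y|\,M(dx,dy)$, the infimum being over all couplings $M$ of $\mu_1,\mu_2$; and $d_{\mathrm{TV}}(\mu_1,\mu_2)=\sup_A|\mu_1(A)-\mu_2(A)|$ over measurable sets $A$. The distance between two random variables means the distance between their distributions. *)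

(* Defs.v *)
From mathcomp Require Export all_boot all_order all_algebra finmap.
From mathcomp Require Export all_classical all_reals all_analysis measurable_realfun.

Set Implicit Arguments.
Unset Strict Implicit.
Unset Printing Implicit Defensive.

Import Order.TTheory GRing.Theory Num.Theory.
Import numFieldNormedType.Exports.

Local Open Scope classical_set_scope.
Local Open Scope ring_scope.

(* Euler's integral; meaningful for [0 < p]. *)
Definition Gamma (R : realType) (p : R) : R :=
  \int[@lebesgue_measure R]_(t in `]0, +oo[) (t `^ (p - 1) * expR (- t)).

(* The library's [beta_pdf] only covers natural-number parameters. *)
Definition Beta_density (R : realType) (p q t : R) : R :=
  if 0 <= t <= 1 then
    Gamma (p + q) / (Gamma p * Gamma q) * t `^ (p - 1) * (1 - t) `^ (q - 1)
  else 0.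

Definition has_Beta_distribution (d : measure_display) (T : measurableType d)
    (R : realType) (P : probability T R) (X : {RV P >-> R}) (p q : R) : Prop :=
  forall A : set R, measurable A ->
    distribution P X A =
    (\int[@lebesgue_measure R]_(t in A) (Beta_density p q t)%:E)%E.

Definition mutually_independent (d : measure_display) (T : measurableType d)
    (R : realType) (P : probability T R) (X : nat -> {RV P >-> R}) : Prop :=
  forall (J : {fset nat}) (A : nat -> set R), (forall j, measurable (A j)) ->
    P (\bigcap_(j in [set` J]) (X j @^-1` A j)) =
    (\prod_(j <- J) P (X j @^-1` A j))%E.

Definition logistic_map (R : realType) (b x : R) : R := 4 * b * x * (1 - x).

(* [B i] stands for $B_{i+1}$, so that the first map applied is the one
   driven by [B 0]. *)
Fixpoint forward_iterate (T : Type) (R : realType) (B : nat -> T -> R)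
    (x : R) (n : nat) (w : T) : R :=
  if n is m.+1 then logistic_map (B m w) (forward_iterate B x m w) else x.

Lemma measurable_forward_iterate (d : measure_display) (T : measurableType d)
    (R : realType) (P : probability T R) (B : nat -> {RV P >-> R})
    (x : R) (n : nat) :
  measurable_fun [set: T] (forward_iterate B x n).
Proof.
elim: n => [|n IHn] /=; first exact: measurable_cst.
apply: measurable_funM; last by apply: measurable_funB.
by apply: measurable_funM => //; apply: measurable_funM.
Qed.

(* [forward_iterate] as a random variable, so that it has a distribution. *)
Definition forward_RV (d : measure_display) (T : measurableType d)
    (R : realType) (P : probability T R) (B : nat -> {RV P >-> R})
    (x : R) (n : nat) : {RV P >-> R} :=
  mfun_Sub (mem_set (measurable_forward_iterate B x n)).

Definition d_TV (d : measure_display) (T : measurableType d) (R : realType)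
    (mu1 mu2 : probability T R) : \bar R :=
  ereal_sup [set `|mu1 A - mu2 A|%E | A in measurable].

Definition is_coupling (R : realType)
    (mu1 mu2 : probability R R)
    (M : probability (R * R)%type R) : Prop :=
  (forall A : set R, measurable A -> M (fst @^-1` A) = mu1 A) /\
  (forall A : set R, measurable A -> M (snd @^-1` A) = mu2 A).

(* Measures on $[0,1]$ are regarded as measures on [R] concentrated on
   $[0,1]$; all their couplings are then concentrated on $[0,1]^2$. *)
Definition d_W (R : realType)
    (mu1 mu2 : probability R R) : \bar R :=
  ereal_inf [set (\int[M]_z `|z.1 - z.2|%:E)%E | M in is_coupling mu1 mu2].

(* Main.v *)
From HB Require Import structures.
Require Import Defs.
From mathcomp Require Import ring lra.
Set Implicit Arguments.
Unset Strict Implicit.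
Unset Printing Implicit Defensive.

Import Order.TTheory GRing.Theory Num.Theory.
Import numFieldNormedType.Exports.

Local Open Scope classical_set_scope.
Local Open Scope ring_scope.

(* Fix a coupling of cost [S^(a+1)] and a continuous [phi] with
   values in [[0,1]]. Cut [phi] by a partition of unity on a grid whose mesh at [t]
   is comparable to [t(1-t)], and mollify each piece at a scale [eps * mesh], where
   [eps = (S/(8t(1-t)))^kappa] and [kappa = 1/(1-s)]. The mollified function is sent
   by the transition kernel to a [C/S]-Lipschitz function, so the coupling bounds the
   difference of its integrals by [C S^a]. What is removed is a sum of derivatives of
   small bumps; [local_smoothness] says that a law obtained by [j] steps of the chain
   integrates the derivative of a bump of relative height [eps] to at most [eps^r]
   times the mass of a ball, with [r = 1-(1-s)^j]. Summing over the grid gives [C S^a]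
   again as soon as [kappa r > a].

   For [a > 1] one step suffices. For [a <= 1] one takes [s = a-1/2], which needs [j]
   steps with [(j-1)s >= 1]; for the finitely many earlier times the law of the chain
   is so concentrated near the orbit of [x] under [4x(1-x)] that its Wasserstein
   distance to Beta(a,a) is bounded below, and the inequality is trivial.

   Beta(a,a) is invariant because the moments agree, and independence makes the
   successive laws images of product measures. *)

(** The exponent is a balance at a single scale. With S^(a+1) for the transport cost, a function of
    Lipschitz constant 1/S costs S^a, and S^a is also the order of the Beta(a,a) mass of t(1-t) <=
    S, where nothing is smoothed. The kernel density behaves like (1-b)^(a-3/2) at b = 1, unbounded
    for a < 3/2, so one step turns a function varying at relative scale eps near t into one of
    Lipschitz constant about eps^(s-1)/(t(1-t)); equating this with 1/S gives the power kappa. The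
    bumps removed at height tau = t(1-t) cost (S/tau)^(kappa r) tau^a, and a geometric range of tau
    >= S sums this to order S^a when kappa r > a. One step from an arbitrary law gives r = s, and
    s/(1-s) > a with s <= a-1/2 is possible only for a > 1: hence the iteration, and the early times
    it leaves over. Smoothness is measured against the law's own mass of a larger ball because the
    constants must not depend on the starting point. *)

(** * Bounded measurable functions and their expectations *)

Section bounded_measurable.
Context d (T : measurableType d) (R : realType).
Implicit Types f g : T -> R.

(** The bound holds everywhere and mentions no measure, so the class is integrable under every
    probability at once and all integrals below can be real-valued. *)
Definition bounded_measurable f :=
  measurable_fun [set: T] f /\ exists M : R, forall x, `|f x| <= M.

Lemma bm_cst (c : R) : bounded_measurable (fun=> c).
Proof. by split; [exact: measurable_cst|exists `|c|]. Qed.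

Lemma bmD f g : bounded_measurable f -> bounded_measurable g ->
  bounded_measurable (fun x => f x + g x).
Proof.
move=> [mf [M fM]] [mg [N gN]]; split; first exact: measurable_funD.
by exists (M + N) => x; rewrite (le_trans (ler_normD _ _))// lerD.
Qed.

Lemma bmN f : bounded_measurable f -> bounded_measurable (fun x => - f x).
Proof.
move=> [mf [M fM]]; split; first exact: measurable_funN.
by exists M => x; rewrite normrN.
Qed.

Lemma bmB f g : bounded_measurable f -> bounded_measurable g ->
  bounded_measurable (fun x => f x - g x).
Proof. by move=> bf bg; apply: bmD => //; exact: bmN. Qed.

Lemma bmM f g : bounded_measurable f -> bounded_measurable g ->
  bounded_measurable (fun x => f x * g x).
Proof.
move=> [mf [M fM]] [mg [N gN]]; split; first exact: measurable_funM.
by exists (M * N) => x; rewrite normrM ler_pM.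
Qed.

Lemma bm_norm f : bounded_measurable f -> bounded_measurable (fun x => `|f x|).
Proof.
move=> [mf [M fM]]; split; first exact: measurableT_comp.
by exists M => x; rewrite normr_id.
Qed.

Lemma bm_indic (A : set T) : measurable A ->
  bounded_measurable (\1_A : T -> R).
Proof.
move=> mA; split; first exact: measurable_indic.
by exists 1 => x; rewrite indicE; case: (_ \in _); rewrite ?normr1 ?normr0.
Qed.

Lemma bm_sum (I : Type) (r : seq I) (F : I -> T -> R) :
  (forall i, bounded_measurable (F i)) ->
  bounded_measurable (fun x => \sum_(i <- r) F i x).
Proof.
move=> bF; elim: r => [|i r IH].
  under eq_fun do rewrite big_nil; exact: bm_cst.
under eq_fun do rewrite big_cons; exact: bmD.
Qed.

End bounded_measurable.

Lemma bm_comp d d' (T : measurableType d) (T' : measurableType d')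
    (R : realType) (f : T' -> R) (g : T -> T') :
  bounded_measurable f -> measurable_fun setT g ->
  bounded_measurable (fun x => f (g x)).
Proof.
move=> [mf [M fM]] mg; split; first exact: measurableT_comp.
by exists M.
Qed.

Section expectation_bm.
Context d (T : measurableType d) (R : realType) (P : probability T R).
Implicit Types f g : T -> R.

Lemma bm_integrable (D : set T) f : measurable D -> bounded_measurable f ->
  P.-integrable D (EFin \o f).
Proof.
move=> mD [mf [M fM]]; apply: measurable_bounded_integrable => //.
- by rewrite (le_lt_trans (probability_le1 _ mD))// ltry.
- exact: measurable_funTS.
- exists M; split; first exact: num_real.
  by move=> N MN x _ /=; rewrite (le_trans (fM x))// ltW.
Qed.

Lemma bm_le f g : bounded_measurable f -> bounded_measurable g ->
  (forall x, f x <= g x) -> \int[P]_x f x <= \int[P]_x g x.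
Proof. by move=> bf bg fg; apply: le_Rintegral => //; exact: bm_integrable. Qed.

Lemma bm_intD f g : bounded_measurable f -> bounded_measurable g ->
  \int[P]_x (f x + g x) = \int[P]_x f x + \int[P]_x g x.
Proof. by move=> bf bg; apply: RintegralD => //; exact: bm_integrable. Qed.

Lemma bm_intB f g : bounded_measurable f -> bounded_measurable g ->
  \int[P]_x (f x - g x) = \int[P]_x f x - \int[P]_x g x.
Proof. by move=> bf bg; apply: RintegralB => //; exact: bm_integrable. Qed.

Lemma bm_intZ (c : R) f : bounded_measurable f ->
  \int[P]_x (c * f x) = c * \int[P]_x f x.
Proof. by move=> bf; apply: RintegralZl => //; exact: bm_integrable. Qed.

Lemma prob_intc (c : R) : \int[P]_x c = c.
Proof. rewrite Rintegral_cst// [X in fine X](_ : _ = 1%E) ?mulr1//; exact: probability_setT. Qed.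

Lemma bm_int_sum (I : Type) (r : seq I) (F : I -> T -> R) :
  (forall i, bounded_measurable (F i)) ->
  \int[P]_x (\sum_(i <- r) F i x) = \sum_(i <- r) \int[P]_x F i x.
Proof.
move=> bF; elim: r => [|i r IH].
  by under eq_Rintegral do rewrite big_nil; rewrite prob_intc big_nil.
under eq_Rintegral do rewrite big_cons; rewrite bm_intD ?IH ?big_cons//.
exact: bm_sum.
Qed.

Lemma bm_abs f : bounded_measurable f -> `|\int[P]_x f x| <= \int[P]_x `|f x|.
Proof. by move=> bf; apply: le_normr_Rintegral => //; exact: bm_integrable. Qed.

Lemma bm_abs_le f g : bounded_measurable f -> bounded_measurable g ->
  (forall x, `|f x| <= g x) -> `|\int[P]_x f x| <= \int[P]_x g x.
Proof.
move=> bf bg fg; rewrite (le_trans (bm_abs bf))// bm_le//; exact: bm_norm.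
Qed.

Lemma bm_int_bound f (M : R) : bounded_measurable f ->
  (forall x, `|f x| <= M) -> `|\int[P]_x f x| <= M.
Proof.
move=> bf fM; rewrite -[leRHS]prob_intc; apply: bm_abs_le => //; exact: bm_cst.
Qed.

Lemma prob_indic (A : set T) : measurable A ->
  \int[P]_x \1_A x = fine (P A).
Proof. by move=> mA; rewrite /Rintegral integral_indic// setIT. Qed.

Lemma bm_int_mkcond (D : set T) f :
  \int[P]_(x in D) f x = \int[P]_x (\1_D x * f x).
Proof.
rewrite Rintegral_mkcond; apply: eq_Rintegral => x _.
by rewrite patchE indicE; case: ifPn; rewrite ?mul1r ?mul0r.
Qed.

Lemma bm_indic_split f (D1 D2 : set T) : measurable D1 -> measurable D2 ->
  bounded_measurable f -> D1 `&` D2 = set0 ->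
  (forall x, ~ D1 x -> ~ D2 x -> f x = 0) ->
  \int[P]_x f x = \int[P]_(x in D1) f x + \int[P]_(x in D2) f x.
Proof.
move=> m1 m2 bf d12 f0.
have b1 := bmM (bm_indic R m1) bf; have b2 := bmM (bm_indic R m2) bf.
rewrite (bm_int_mkcond D1) (bm_int_mkcond D2) -bm_intD//; apply: eq_Rintegral => x _.
rewrite -mulrDl !indicE; have [/set_mem x1|x1] := boolP (x \in D1).
  have [/set_mem x2|x2] := boolP (x \in D2); last by rewrite addr0 mul1r.
  by exfalso; rewrite -[False]/(set0 x) -d12.
have [x2|x2] := boolP (x \in D2); first by rewrite add0r mul1r.
rewrite add0r mul0r f0//.
  by move=> /mem_set; apply/negP.
by move=> /mem_set; apply/negP.
Qed.

End expectation_bm.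

Section fubini_bm.
Context d1 d2 (T1 : measurableType d1) (T2 : measurableType d2) (R : realType).
Variables (P1 : probability T1 R) (P2 : probability T2 R).
Variable F : T1 * T2 -> R.
Hypothesis bF : bounded_measurable F.

Lemma bm_pair1 x : bounded_measurable (fun y => F (x, y)).
Proof.
by apply: (bm_comp (f := F) (g := fun y => (x, y)) bF); exact: pair1_measurable.
Qed.

Lemma bm_pair2 y : bounded_measurable (fun x => F (x, y)).
Proof.
by apply: (bm_comp (f := F) (g := fun x => (x, y)) bF); exact: pair2_measurable.
Qed.

Let iF : (P1 \x P2)%E.-integrable setT (EFin \o F).
Proof.
case: bF => mF [M FM].
apply: measurable_bounded_integrable => //.
  rewrite [X in (X < _)%E](_ : _ = 1%E) ?ltry//.
  have p1 : P1 setT = 1%E by exact: probability_setT.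
  have p2 : P2 setT = 1%E by exact: probability_setT.
  transitivity (P1 setT * P2 setT)%E; last by rewrite p1 p2 mule1.
  have := product_measure1E P1 P2 measurableT measurableT.
  by rewrite setXTT.
exists M; split; first exact: num_real.
by move=> N MN x _ /=; rewrite (le_trans (FM x))// ltW.
Qed.

Let FE x : (\int[P2]_y F (x, y))%:E = (\int[P2]_y (F (x, y))%:E)%E.
Proof.
rewrite /Rintegral fineK//; apply: integrable_fin_num => //.
exact: (bm_integrable P2 measurableT (bm_pair1 x)).
Qed.

Let GE y : (\int[P1]_x F (x, y))%:E = (\int[P1]_x (F (x, y))%:E)%E.
Proof.
rewrite /Rintegral fineK//; apply: integrable_fin_num => //.
exact: (bm_integrable P1 measurableT (bm_pair2 y)).
Qed.

Lemma bm_fubini1 : bounded_measurable (fun x => \int[P2]_y F (x, y)).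
Proof.
split.
  apply/measurable_EFinP; rewrite (_ : _ \o _ =
    (fun x => \int[P2]_y (F (x, y))%:E)%E); last by apply/funext => x /=.
  exact: measurable_fubini_F iF.
case: (bF) => mF [M FM]; exists M => x; apply: bm_int_bound => //.
exact: bm_pair1.
Qed.

Lemma bm_fubini2 : bounded_measurable (fun y => \int[P1]_x F (x, y)).
Proof.
split.
  apply/measurable_EFinP; rewrite (_ : _ \o _ =
    (fun y => \int[P1]_x (F (x, y))%:E)%E); last by apply/funext => x /=.
  exact: measurable_fubini_G iF.
case: (bF) => mF [M FM]; exists M => x; apply: bm_int_bound => //.
exact: bm_pair2.
Qed.

Lemma bm_fubini12 :
  \int[P1]_x \int[P2]_y F (x, y) = \int[(P1 \x P2)%E]_z F z.
Proof.
rewrite {1}/Rintegral; under eq_integral do rewrite FE.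
by congr fine; exact: integral12_prod_meas1 iF.
Qed.

Lemma bm_fubini : \int[P1]_x \int[P2]_y F (x, y) = \int[P2]_y \int[P1]_x F (x, y).
Proof.
rewrite bm_fubini12 [RHS]/Rintegral; under [in RHS]eq_integral do rewrite GE.
by congr fine; apply/esym; exact: integral21_prod_meas1 iF.
Qed.

End fubini_bm.

Lemma bm_mulr (R : realType) (f : R -> R) (u : R) : bounded_measurable f ->
  bounded_measurable (fun b : R => f (b * u)).
Proof. by move=> bf; apply: bm_comp bf _; exact: measurable_funM. Qed.

(** Real powers are measurable but [powR] inverts only nonnegative bases, so the exponent -1 is
    applied to the square: 1/y = y * (y^2)^(-1), both sides being 0 at y = 0. *)
Lemma measurable_funV d (T : measurableType d) (R : realType) (f : T -> R) :
  measurable_fun [set: T] f -> measurable_fun [set: T] (fun x => (f x)^-1).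
Proof.
move=> mf; have -> : (fun x => (f x)^-1) = (fun x => f x * (f x ^+ 2) `^ (-1)).
  apply/funext => x; rewrite powR_inv1 ?sqr_ge0//.
  have [->|x0] := eqVneq (f x) 0; first by rewrite invr0 mul0r.
  by rewrite expr2 invfM mulrA mulfV// mul1r.
apply: measurable_funM => //.
apply: (@measurableT_comp _ _ _ _ _ _ (fun t : R => t `^ (-1))) => //.
exact: measurable_funX.
Qed.

Lemma bm_indic_mul d (T : measurableType d) (R : realType) (D : set T)
    (g : T -> R) (M : R) :
  measurable D -> measurable_fun setT g -> (forall x, D x -> `|g x| <= M) ->
  bounded_measurable (fun x => \1_D x * g x).
Proof.
move=> mD mg gM; split.
  by apply: measurable_funM => //; exact: measurable_indic.
exists `|M| => x; rewrite indicE; have [/set_mem Dx|_] := boolP (x \in D).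
  by rewrite mul1r (le_trans (gM x Dx))// ler_norm.
by rewrite mul0r normr0.
Qed.

(** * The transition kernel of the chain and what is required of it *)

Section logistic_kernel.
Variable R : realType.
Implicit Types (lam nu : probability R R).

(** The logistic map at b = 1; the random factor only multiplies it, so all the folding of the
    dynamics sits here. *)
Definition hump (x : R) : R := 4 * x * (1 - x).

Lemma logistic_mapE (b x : R) : logistic_map b x = b * hump x.
Proof. by rewrite /logistic_map /hump; ring. Qed.

Lemma hump_le1 (x : R) : hump x <= 1.
Proof.
rewrite -subr_ge0 (_ : 1 - hump x = (1 - 2 * x) ^+ 2) ?sqr_ge0//.
by rewrite /hump; ring.
Qed.

Lemma measurable_hump : measurable_fun [set: R] hump.
Proof. by apply: measurable_funM => //; apply: measurable_funB. Qed.

Lemma measurable_logistic_map :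
  measurable_fun [set: R * R] (fun z => logistic_map z.1 z.2).
Proof.
under eq_fun do rewrite logistic_mapE.
by apply: measurable_funM => //; exact: (measurableT_comp measurable_hump).
Qed.

(** A relation between laws rather than a function: the laws of the chain arise as distributions of
    random variables and are known only through their values on Borel sets. *)
Definition logistic_step lam nu nu' := forall A : set R, measurable A ->
  nu' A = (lam \x nu)%E ((fun z => logistic_map z.1 z.2) @^-1` A).

Lemma logistic_step_int lam nu nu' (phi : R -> R) :
  logistic_step lam nu nu' -> bounded_measurable phi ->
  \int[nu']_t phi t = \int[nu]_x \int[lam]_b phi (b * hump x).
Proof.
move=> st bphi.
have bF : bounded_measurable (fun z : R * R => phi (logistic_map z.1 z.2)).
  exact: (bm_comp bphi measurable_logistic_map).
transitivity (\int[nu]_x \int[lam]_b phi (logistic_map b x)); last first.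
  apply: eq_Rintegral => x _; apply: eq_Rintegral => b _.
  by rewrite logistic_mapE.
rewrite -(bm_fubini lam nu bF) (bm_fubini12 lam nu bF) /Rintegral; congr fine.
rewrite -[RHS](@integral_pushforward _ _ _ _ R _ measurable_logistic_map
    (lam \x nu)%E setT (EFin \o phi))//; first last.
- rewrite preimage_setT; case: bF => mF [M FM].
  apply: measurable_bounded_integrable => //.
    rewrite [X in (X < _)%E](_ : _ = 1%E) ?ltry//.
    transitivity (nu' setT); last exact: probability_setT.
    by apply: esym; exact: st measurableT.
  exists M; split; first exact: num_real.
  by move=> N MN x _ /=; rewrite (le_trans (FM x))// ltW.
- by apply/measurable_EFinP; case: bphi.
apply: eq_measure_integral => [|mU A mA _]; last exact: st.
  exact: measurable_logistic_map.
Qed.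

Lemma bm_kernel lam (phi : R -> R) : bounded_measurable phi ->
  bounded_measurable (fun x : R => \int[lam]_b phi (b * hump x)).
Proof.
move=> bphi.
have bF : bounded_measurable (fun z : R * R => phi (logistic_map z.1 z.2)).
  exact: (bm_comp bphi (@measurable_logistic_map)).
have := bm_fubini2 lam lam bF; rewrite (_ : (fun y => _) =
  (fun x => \int[lam]_b phi (b * hump x)))//.
apply/funext => x; apply: eq_Rintegral => b _ /=.
by rewrite logistic_mapE.
Qed.

(** All that is used of a Beta(p,sg) law with p >= 1, whose density is of order (1-b)^(sg-1) near 1.
    The logarithmic derivative of the density is O(1/(b(1-b))), whence [kb_ibp]; the mass of [1-h,1]
    is of order h^sg. The second exponent s <= sg is kept below 1 so that the inverse moment in
    [kb_wt] is a pure power of h, without the logarithm that appears at sg = 1. *)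
Record kernel_bounds lam (sg s K : R) : Prop := {
  kb_s0 : 0 < s ;
  kb_s1 : s < 1 ;
  kb_sg : s <= sg ;
  kb_K : 1 <= K ;
  kb_supp : lam `[0, 1]%classic = 1%E ;
  kb_ibp : forall (F f : R -> R) (b0 b1 : R), 0 < b0 -> b0 < b1 -> b1 < 1 ->
    (forall t : R, is_derive t 1 F (f t)) -> continuous f -> F b0 = 0 ->
    `|\int[lam]_(b in `[b0, b1]) f b| <=
    K * (`|F b1| * (1 - b1) `^ (sg - 1) +
         \int[lam]_(b in `[b0, b1]) (`|F b| / (b * (1 - b)))) ;
  kb_up : forall h, 0 < h <= 1 -> fine (lam `[1 - h, 1]%classic) <= K * h `^ sg ;
  kb_lo : forall h, 0 < h <= 1 -> h `^ sg <= K * fine (lam `[1 - h, 1]%classic) ;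
  kb_wt : forall h H, 0 < h -> h <= H -> H <= 1 ->
    \int[lam]_(b in `[1 - H, 1 - h]) (1 - b)^-1 <=
    K * H `^ (sg - s) * h `^ (s - 1) }.

(** The test function is [dpsi], of height m and supported in a ball of radius d; [psi] is its
    compactly supported primitive. The trivial bound on the primitive is m d, so eps measures
    cancellation: [dpsi] oscillates at relative scale eps. *)
Definition bump_test (psi dpsi : R -> R) (y d eps m : R) : Prop :=
  [/\ forall t : R, is_derive t 1 psi (dpsi t), continuous dpsi,
      forall t, `|psi t| <= m * eps * d, forall t, `|dpsi t| <= m &
      forall t, d < `|t - y| -> psi t = 0 /\ dpsi t = 0].

Lemma bump_bm psi dpsi y d eps m :
  bump_test psi dpsi y d eps m -> bounded_measurable dpsi.
Proof.
by move=> [_ cd _ bd _]; split;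
  [exact: continuous_measurable_fun|exists m].
Qed.

Lemma is_derive_continuous (f df : R -> R) :
  (forall t : R, is_derive t 1 f (df t)) -> continuous f.
Proof.
by move=> h t; apply: differentiable_continuous; apply/derivable1_diffP;
  apply: ex_derive.
Qed.

Lemma is_derive_mul (f g : R -> R) (t df dg : R) :
  is_derive t 1 f df -> is_derive t 1 g dg ->
  is_derive t 1 (fun x : R => f x * g x) (df * g t + f t * dg).
Proof.
move=> hf hg; have := @is_deriveM R _ f g t 1 df dg hf hg.
move=> /is_derive_eq; apply; rewrite /GRing.scale/= addrC; congr (_ + _).
by rewrite mulrC.
Qed.

Lemma is_derive_mulr_cst (f : R -> R) (t df c : R) :
  is_derive t 1 f df -> is_derive t 1 (fun x : R => f x * c) (df * c).
Proof.
move=> hf; have := is_derive_mul hf (is_derive_cst c t 1).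
by move=> /is_derive_eq; apply; rewrite mulr0 addr0.
Qed.

Lemma is_derive_comp_mulr (f df : R -> R) (u t : R) :
  (forall t : R, is_derive t 1 f (df t)) ->
  is_derive t 1 (fun b : R => f (b * u)) (df (t * u) * u).
Proof.
move=> h; have hm : is_derive t 1 (fun b : R => b * u) u.
  have := is_derive_mulr_cst u (is_derive_id t 1).
  by move=> /is_derive_eq; apply; rewrite mul1r.
by have := @is_derive1_comp R f (fun b : R => b * u) t _ _ (h _) hm.
Qed.

End logistic_kernel.

(** * Integration by parts in the kernel variable, away from b = 1 *)

Section smooth_part.
Variable R : realType.
Implicit Types (lam nu : probability R R).

Definition ind_ball (y r : R) : R -> R := \1_(`[y - r, y + r]%classic).

Lemma bm_ind_ball y r : bounded_measurable (ind_ball y r).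
Proof. by apply: bm_indic. Qed.

Lemma ind_ball_ge0 y r x : 0 <= ind_ball y r x.
Proof. by rewrite /ind_ball indicE. Qed.

Lemma ind_ball_in y r x : `|x - y| <= r -> ind_ball y r x = 1.
Proof.
move=> xyr; rewrite /ind_ball indicE mem_set// set_itvE/=.
by move: xyr; rewrite ler_distl.
Qed.

Lemma ind_ball_eq0 y r x : r < `|x - y| -> ind_ball y r x = 0.
Proof.
move=> xyr; rewrite /ind_ball indicE memNset// set_itvE/=.
by move: xyr; rewrite ltNge ler_distl => /negP.
Qed.

Lemma ind_ball_le y r y' r' x x' :
  (`|x - y| <= r -> `|x' - y'| <= r') -> ind_ball y r x <= ind_ball y' r' x'.
Proof.
move=> h; have [xyr|xyr] := leP `|x - y| r; last first.
  by rewrite ind_ball_eq0// ind_ball_ge0.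
by rewrite !ind_ball_in// h.
Qed.

Lemma supp01_int lam (f : R -> R) : lam `[0, 1]%classic = 1%E ->
  bounded_measurable f -> \int[lam]_b f b = \int[lam]_(b in `[0, 1]) f b.
Proof.
move=> l1 bf.
have mC : measurable (~` `[0, 1]%classic : set R) by exact: measurableC.
rewrite (@bm_indic_split _ _ _ lam f `[0, 1]%classic (~` `[0, 1]%classic))//; last exact: setICr.
suff -> : \int[lam]_(b in ~` `[0, 1]) f b = 0 by rewrite addr0.
rewrite bm_int_mkcond; apply/eqP; rewrite -normr_le0.
case: (bf) => mf [M fM].
have b1 := bm_indic R mC.
rewrite (@le_trans _ _ (\int[lam]_b (M * \1_(~` `[0, 1]%classic) b)))//.
  apply: bm_abs_le => [||x]; [exact: bmM|exact: bmM (bm_cst _ _) b1|].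
  rewrite indicE; case: (_ \in _); rewrite ?mul0r ?mulr0 ?normr0//.
  by rewrite mul1r mulr1.
rewrite bm_intZ// prob_indic// [X in fine X](_ : _ = 0%E) ?mulr0//.
by rewrite probability_setC// l1 subee.
Qed.

Lemma kernel_int01 lam sg s K (f : R -> R) : kernel_bounds lam sg s K ->
  bounded_measurable f -> \int[lam]_b f b = \int[lam]_(b in `[0, 1]) f b.
Proof. by move=> kb; apply: supp01_int; exact: kb_supp kb. Qed.

(** For b in [1-dl,1] the point b u moves by at most dl u, hence stays in the ball, and that
    interval has mass at least dl^sg / K. This is how a power of d/y is traded for a ball mass. *)
Lemma kernel_lo_ball lam sg s K (y r u : R) : kernel_bounds lam sg s K ->
  forall dl, 0 < dl <= 1 -> 0 <= u -> `|u - y| + dl * u <= r ->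
  dl `^ sg <= K * \int[lam]_b ind_ball y r (b * u).
Proof.
move=> kb dl dl01 u0 uyr.
apply: (le_trans (kb_lo kb dl01)); rewrite ler_wpM2l//.
  by rewrite (le_trans ler01)// (kb_K kb).
rewrite -prob_indic//; apply: bm_le; first exact: bm_indic.
  exact: bm_mulr (bm_ind_ball y r).
move=> b; rewrite indicE.
have [/set_mem|] := boolP (b \in _); last by rewrite ind_ball_ge0.
rewrite /= in_itv/= => /andP[b1 b2].
rewrite ind_ball_in// (le_trans _ uyr)//.
rewrite (_ : b * u - y = (u - y) - (1 - b) * u); last by ring.
rewrite (le_trans (ler_normB _ _))// lerD2l normrM (ger0_norm u0) ler_wpM2r//.
by rewrite ger0_norm; lra.
Qed.

(** In the variable b the function [dpsi (b * u)] has the primitive psi(bu)/u, smaller by the factor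
    eps; stopping at distance eta d/y from b = 1 keeps the loss from the singular density down to
    eta^(s-1). The result is relative to the kernel mass of a ball, so that it can afterwards be
    integrated in u against any law. *)
Lemma smooth_part lam sg s K : kernel_bounds lam sg s K ->
  exists C : R, 0 <= C /\ forall (psi dpsi : R -> R) (y d eps m eta u : R), 0 < d ->
  0 < eps <= 1 -> 0 <= m -> 0 < eta <= 1 -> 20 * d <= y -> y <= 1 -> u <= 1 ->
  bump_test psi dpsi y d eps m ->
  `|\int[lam]_(b in `[(y - d) / 2, 1 - eta * (d / y)]) dpsi (b * u)| <=
  C * m * eps * eta `^ (s - 1) * \int[lam]_b ind_ball y (6 * d) (b * u).
Proof.
move=> kb; have s0 := kb_s0 kb; have s1 := kb_s1 kb; have ssg := kb_sg kb.
have K1 := kb_K kb.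
(* The first K serves u far above y. In the other summand one K comes from [kb_ibp], one from the
   lower mass bound, and the bracket collects the boundary term and the inverse moment over
   [1 - 6d/y, 1 - h]. *)
pose C := K + 2 * K * K * (1 + K * 6 `^ (sg - s)).
have C0 : K <= C by rewrite /C lerDl mulr_ge0 ?addr_ge0 ?mulr_ge0 ?powR_ge0//; lra.
have CC : 0 <= C by rewrite (le_trans _ C0)// (le_trans _ K1).
exists C; split=> //.
move=> psi dpsi y d eps m eta u d0 /andP[eps0 eps1] m0 /andP[eta0 eta1] dy y1 u1 bt.
have [ps1 cd bp bd sup] := bt.
have y0 : 0 < y by lra.
set b0 := (y - d) / 2; set dl := d / y; set h := eta * dl.
have dl0 : 0 < dl by rewrite divr_gt0.
have dlE : d = dl * y by rewrite /dl divfK// gt_eqF.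
have dl20 : dl <= 1 / 20 by rewrite ler_pdivrMr//; lra.
have h0 : 0 < h by rewrite mulr_gt0.
have hdl : h <= dl by rewrite ger_pMl.
have bI : bounded_measurable (fun b : R => ind_ball y (6 * d) (b * u)).
  exact: bm_mulr (bm_ind_ball _ _).
have I0 : 0 <= \int[lam]_b ind_ball y (6 * d) (b * u).
  by apply: Rintegral_ge0 => b _; exact: ind_ball_ge0.
have eta_s : 1 <= eta `^ (s - 1).
  by rewrite -[leLHS](powRr0 eta) ger_powR ?eta0//; lra.
have RHS0 : 0 <= C * m * eps * eta `^ (s - 1) * \int[lam]_b ind_ball y (6 * d) (b * u).
  by rewrite !mulr_ge0 ?powR_ge0// ltW.
have [uyd|uyd] := ltP u (y - d).
  rewrite [X in `|X|](_ : _ = 0) ?normr0//.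
  rewrite bm_int_mkcond -[RHS](prob_intc lam); apply: eq_Rintegral => b _.
  rewrite indicE; have [/set_mem|] := boolP (b \in _); last by rewrite mul0r.
  rewrite /= in_itv/= mul1r => /andP[b0b bh].
  have b00 : 0 <= b by apply: le_trans b0b; rewrite /b0; clear -dy d0; lra.
  have b11 : b <= 1 by clear -bh h0; lra.
  have bu : b * u < y - d.
    have [u0|u0] := ltP u 0.
      rewrite (@le_lt_trans _ _ 0)//; first by rewrite mulr_ge0_le0// ltW.
      by clear -dy d0; lra.
    by rewrite (le_lt_trans _ uyd)// ler_piMl.
  suff /sup[_ ->] : d < `|b * u - y| by [].
  by rewrite ltr0_norm; clear -bu d0; lra.
have u0 : 0 < u by lra.
have b00 : 0 < b0 by rewrite /b0; lra.
have b0h : b0 < 1 - h by rewrite /b0; lra.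
have h1 : 1 - h < 1 by lra.
(* From here u >= y - d > 0. The lower limit (y-d)/2 lies below the support of the integrand, so F
   vanishes there and only the upper boundary term survives. *)
pose F b := psi (b * u) / u.
have F1 (t : R) : is_derive t 1 F (dpsi (t * u)).
  have := is_derive_mulr_cst u^-1 (is_derive_comp_mulr u t ps1).
  by move=> /is_derive_eq; apply; rewrite mulfK// gt_eqF.
have cF : continuous (fun b : R => dpsi (b * u)).
  by move=> t; apply: (@continuous_comp _ _ _ (fun b : R => b * u) dpsi);
    [exact: mulrr_continuous|exact: cd].
have Fb0 : F b0 = 0.
  suff /sup[p0 _] : d < `|b0 * u - y| by rewrite /F p0 mul0r.
  have b0u : b0 * u <= b0 by rewrite ler_piMr// ltW.
  by rewrite ltr0_norm; move: b0u; rewrite {2}/b0; clear -dy d0; lra.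
apply: (le_trans (kb_ibp kb b00 b0h h1 F1 cF Fb0)).
rewrite (_ : 1 - (1 - h) = h); last by ring.
have normF b : `|F b| = `|psi (b * u)| / u by rewrite /F normrM (gtr0_norm (x := u^-1)) ?invr_gt0.
have mF : measurable_fun [set: R] F.
  apply: continuous_measurable_fun; exact: is_derive_continuous F1.
pose D := `[b0, 1 - h]%classic : set R.
have mg : measurable_fun [set: R] (fun b => `|F b| / (b * (1 - b))).
  apply: measurable_funM; first exact: measurableT_comp.
  apply: measurable_funV.
  by apply: measurable_funM => //; exact: measurable_funB.
have F0 b : `|b * u - y| > d -> F b = 0.
  by move=> /sup[p0 _]; rewrite /F p0 mul0r.
have FD b : D b -> `|F b| / (b * (1 - b)) <=
    m * eps * d / ((y - d) * (1 - b)) * ind_ball y d (b * u).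
  rewrite /D /= in_itv/= => /andP[b0b bh].
  have [buy|buy] := leP `|b * u - y| d; last first.
    by rewrite F0// normr0 mul0r ind_ball_eq0// mulr0.
  rewrite ind_ball_in// mulr1 normF.
  have b1 : 0 < 1 - b by clear -bh h1 h0; lra.
  have bb : 0 < b := lt_le_trans b00 b0b.
  have yd : y - d <= b * u by move: buy; rewrite ler_distl => /andP[].
  rewrite -mulrA -invfM ler_pM ?invr_ge0//.
    by rewrite !mulr_ge0 ?ltW//; lra.
  rewrite lef_pV2 ?posrE ?mulr_gt0//; last by clear -dy d0; lra.
  rewrite [leRHS](_ : _ = b * u * (1 - b)); last by ring.
  by rewrite ler_wpM2r// ltW.
have K0 : 0 <= K by lra.
have meps : 0 <= m * eps by rewrite mulr_ge0// ltW.
have bD : bounded_measurable (fun b => \1_D b * (`|F b| / (b * (1 - b)))).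
  have mD : measurable D by exact: measurable_itv.
  apply: (@bm_indic_mul _ _ _ _ _ (m * eps * d / ((y - d) * h)) mD mg) => b Db.
  have := Db; rewrite /D /= in_itv/= => /andP[b0b bh].
  have b1 : 0 < 1 - b by clear -bh h1 h0; lra.
  have bb : 0 < b := lt_le_trans b00 b0b.
  have yd0 : 0 < y - d by clear -dy d0; lra.
  rewrite ger0_norm; last by rewrite divr_ge0// mulr_ge0// ltW.
  apply: (le_trans (FD b Db)).
  apply: (@le_trans _ _ (m * eps * d / ((y - d) * (1 - b)))).
    have [buy|buy] := leP `|b * u - y| d; first by rewrite ind_ball_in// mulr1.
    by rewrite ind_ball_eq0// mulr0 divr_ge0 ?mulr_ge0// ltW.
  rewrite ler_wpM2l ?mulr_ge0 ?(ltW d0) ?(ltW eps0)//.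
  have p1 : 0 < (y - d) * (1 - b) by exact: mulr_gt0.
  have p2 : 0 < (y - d) * h by exact: mulr_gt0.
  rewrite lef_pV2//; apply: ler_wpM2l; first exact: ltW.
  by clear -bh; lra.
(* If u >= y + 4d, then b u can be within d of y only when 1-b is at least of order d/y: the
   boundary term vanishes and d/((y-d)(1-b)) <= 1. Otherwise u is within 4d of y, and [lo] converts
   (d/y)^sg into the ball mass. *)
have [uy4|uy4] := leP (y + 4 * d) u.
  have -> : F (1 - h) = 0.
    apply: F0; rewrite ltr_normr; apply/orP; left.
    have h1u : (1 - dl) * (y + 4 * d) <= (1 - h) * u.
      by rewrite ler_pM//; clear -hdl dl20 y0 d0; lra.
    rewrite (lt_le_trans _ (lerB h1u (lexx y)))//.
    rewrite (_ : _ - y = 3 * d - 4 * (dl * d)); last by rewrite mulrBl mul1r mulrDr -dlE; ring.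
    have : dl * d <= 1 / 20 * d by rewrite ler_wpM2r// ltW.
    by clear -d0; lra.
  rewrite normr0 mul0r add0r bm_int_mkcond.
  have step : \int[lam]_b (\1_D b * (`|F b| / (b * (1 - b)))) <=
      m * eps * \int[lam]_b ind_ball y (6 * d) (b * u).
    rewrite -bm_intZ//; apply: bm_le => //; first exact: bmM (bm_cst _ _) bI.
    move=> b; rewrite indicE; have [/set_mem Db|_] := boolP (b \in D); last first.
      by rewrite mul0r mulr_ge0// ind_ball_ge0.
    rewrite mul1r (le_trans (FD b Db))//.
    have := Db; rewrite /D /= in_itv/= => /andP[b0b bh].
    have [buy|buy] := leP `|b * u - y| d; last first.
      by rewrite ind_ball_eq0// mulr0 mulr_ge0// ind_ball_ge0.
    rewrite !ind_ball_in//; last by rewrite (le_trans buy)//; clear -d0; lra.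
    rewrite mulr1 -mulrA [leRHS]mulr1 ler_piMr//.
    have b1 : 0 < 1 - b by clear -bh h1 h0; lra.
    have yd0 : 0 < y - d by clear -dy d0; lra.
    rewrite ler_pdivrMr ?mulr_gt0// mul1r -(ler_pM2r u0).
    have bu : b * u <= y + d by move: buy; rewrite ler_distl => /andP[].
    have t1 : (y - d) * (u - (y + d)) <= (y - d) * (1 - b) * u.
      rewrite -mulrA; apply: ler_wpM2l; first exact: ltW.
      by rewrite mulrBl mul1r; apply: lerB.
    apply: le_trans t1.
    have t2 : (y + 4 * d) * (y - 2 * d) <= u * (y - 2 * d).
      by rewrite ler_wpM2r//; clear -dy d0; lra.
    by clear -t2 dy d0; nra.
  apply: (le_trans (ler_wpM2l K0 step)).
  rewrite [leRHS](_ : _ = C * (eta `^ (s - 1) *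
    (m * eps * \int[lam]_b ind_ball y (6 * d) (b * u)))); last by ring.
  have J0 : 0 <= m * eps * \int[lam]_b ind_ball y (6 * d) (b * u).
    by rewrite mulr_ge0.
  by rewrite ler_pM// ler_peMl.
have sg0 : 0 < sg by rewrite (lt_le_trans s0).
have lo : dl `^ sg <= K * \int[lam]_b ind_ball y (6 * d) (b * u).
  apply: (kernel_lo_ball kb) => //; first by rewrite dl0; clear -dl20; lra.
    exact: ltW.
  have : dl * u <= dl * (y + 4 * d) by rewrite ler_wpM2l// ltW.
  have -> : dl * (y + 4 * d) = d + 4 * (dl * d) by rewrite mulrDr -dlE; ring.
  have : dl * d <= 1 / 20 * d by rewrite ler_wpM2r// ltW.
  have : `|u - y| <= 4 * d by rewrite ler_distl; clear -uyd uy4 d0; lra.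
  by clear -d0; lra.
have dlp : dl * dl `^ (sg - 1) = dl `^ sg by rewrite mulr_powRB1// ltW.
have etap : eta `^ (sg - 1) <= eta `^ (s - 1).
  by rewrite ger_powR ?eta0// lerB.
have d2 x : y - d <= x -> d / x <= 2 * dl.
  move=> yx; have x0 : 0 < x by clear -dy d0 yx; lra.
  rewrite ler_pdivrMr// (_ : 2 * dl * x = dl * (2 * x)); last by ring.
  rewrite [leLHS]dlE; apply: ler_wpM2l; first exact: ltW.
  by clear -dy d0 yx; lra.
pose A := m * eps; have A0 : 0 <= A by [].
have P1 : `|F (1 - h)| * h `^ (sg - 1) <= 2 * A * eta `^ (s - 1) * dl `^ sg.
  rewrite normF.
  have -> : 2 * A * eta `^ (s - 1) * dl `^ sg =
      (A * (2 * dl)) * (eta `^ (s - 1) * dl `^ (sg - 1)).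
    by rewrite -dlp; ring.
  apply: ler_pM; rewrite ?powR_ge0//.
  - by rewrite divr_ge0// ltW.
  - apply: (@le_trans _ _ (A * d / u)).
      by apply: ler_wpM2r; rewrite ?invr_ge0 ?(ltW u0)//; exact: bp.
    by rewrite -mulrA; apply: ler_wpM2l => //; exact: d2.
  - rewrite /h powRM ?(ltW eta0) ?(ltW dl0)//.
    by apply: ler_wpM2r => //; exact: powR_ge0.
(* With u < y + 4d, having b u >= y - d forces b >= 1 - 6d/y, so the inverse moment is needed only
   over this short range. *)
pose H := 6 * dl.
have hH : h <= H by rewrite /H; clear -hdl dl0; lra.
have H1 : H <= 1 by rewrite /H; clear -dl20; lra.
have P2 : \int[lam]_(b in `[b0, 1 - h]) (`|F b| / (b * (1 - b))) <=
    2 * A * eta `^ (s - 1) * dl `^ sg * (K * 6 `^ (sg - s)).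
  rewrite bm_int_mkcond.
  pose D' := `[1 - H, 1 - h]%classic : set R.
  have bD' : bounded_measurable (fun b => \1_D' b * (1 - b)^-1).
    apply: (@bm_indic_mul _ _ _ _ _ h^-1).
    - exact: measurable_itv.
    - by apply: measurable_funV; exact: measurable_funB.
    move=> b; rewrite /D' /= in_itv/= => /andP[bH bh].
    have b1 : h <= 1 - b by clear -bh; lra.
    have b2 := lt_le_trans h0 b1.
    by rewrite ger0_norm ?invr_ge0 ?(ltW b2)//; rewrite lef_pV2.
  apply: (@le_trans _ _ (\int[lam]_b (A * d / (y - d) * (\1_D' b * (1 - b)^-1)))).
    apply: bm_le => // [|b]; first exact: bmM (bm_cst _ _) bD'.
    have yd0 : 0 < y - d by clear -dy d0; lra.
    have nn : 0 <= A * d / (y - d) * (\1_D' b * (1 - b)^-1).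
      rewrite indicE; have [/set_mem|_] := boolP (b \in D'); last first.
        by rewrite mul0r mulr0.
      rewrite /D' /= in_itv/= => /andP[bH bh].
      rewrite mul1r; have b1 : 0 < 1 - b by clear -bh h0; lra.
      apply: mulr_ge0; last by rewrite invr_ge0 ltW.
      by apply: divr_ge0; [apply: mulr_ge0 => //|]; exact: ltW.
    rewrite indicE; have [/set_mem Db|_] := boolP (b \in D); last first.
      by rewrite mul0r.
    rewrite mul1r (le_trans (FD b Db))//.
    have [buy|buy] := leP `|b * u - y| d; last by rewrite ind_ball_eq0// mulr0.
    rewrite ind_ball_in// mulr1 indicE mem_set; last first.
      have := Db; rewrite /D /D' /= !in_itv/= => /andP[b0b ->]; rewrite andbT.
      rewrite leNgt; apply/negP => bH.
      have ydb : y - d <= b * u by move: buy; rewrite ler_distl => /andP[].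
      have b00' : 0 < b by exact: lt_le_trans b00 b0b.
      have : b * u <= (1 - H) * (y + 4 * d).
        by apply: ler_pM; exact: ltW.
      have -> : (1 - H) * (y + 4 * d) = y + 4 * d - 6 * d - 24 * (dl * d).
        by rewrite /H mulrBl mul1r -mulrA mulrDr -dlE; ring.
      have : 0 < dl * d by rewrite mulr_gt0.
      by clear -ydb d0; lra.
    by rewrite mul1r invfM mulrA lexx.
  rewrite bm_intZ// -bm_int_mkcond.
  have := kb_wt kb h0 hH H1 => wt.
  have -> : 2 * A * eta `^ (s - 1) * dl `^ sg * (K * 6 `^ (sg - s)) =
     (A * (2 * dl)) * (K * (6 `^ (sg - s) * dl `^ (sg - s)) *
      (eta `^ (s - 1) * dl `^ (s - 1))).
    have -> : dl `^ sg = dl * (dl `^ (sg - s) * dl `^ (s - 1)).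
      rewrite -powRD; last by rewrite (gt_eqF dl0) implybT.
      by rewrite (_ : _ + _ = sg - 1) ?dlp//; ring.
    by ring.
  apply: ler_pM.
  - apply: divr_ge0; first by apply: mulr_ge0 => //; exact: ltW.
    by clear -dy d0; lra.
  - apply: Rintegral_ge0 => b; rewrite /D' /= in_itv/= => /andP[_ bh].
    by rewrite invr_ge0; clear -h0 bh; lra.
  - by rewrite -mulrA; apply: ler_wpM2l => //; exact: d2.
  - rewrite -powRM ?(ltW dl0)// -powRM ?(ltW eta0) ?(ltW dl0)//.
apply: (le_trans (ler_wpM2l K0 (lerD P1 P2))).
set Q := 6 `^ (sg - s) in C C0 CC RHS0 P2 *.
have Q0 : 0 <= Q by exact: powR_ge0.
rewrite -/Q; set E := eta `^ (s - 1) in eta_s etap P1 P2 RHS0 *.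
set I := (X in _ <= _ * X).
have E0 : 0 <= E by rewrite (le_trans ler01).
have KQ0 : 0 <= 1 + K * Q by rewrite addr_ge0// mulr_ge0.
apply: (@le_trans _ _ (2 * K * (1 + K * Q) * (A * E) * (K * I))).
  rewrite [leLHS](_ : _ = 2 * K * (1 + K * Q) * (A * E) * dl `^ sg); last by ring.
  apply: ler_wpM2l; last exact: lo.
  apply: mulr_ge0; last exact: mulr_ge0.
  by apply: mulr_ge0 => //; apply: mulr_ge0.
rewrite [leLHS](_ : _ = (2 * K * K * (1 + K * Q)) * (A * E * I)); last by ring.
rewrite [leRHS](_ : _ = C * (A * E * I)); last by rewrite /A; ring.
apply: ler_wpM2r; last by rewrite /C lerDr.
by apply: mulr_ge0; [exact: mulr_ge0|exact: I0].
Qed.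

End smooth_part.

(** * Derivatives of functions of one variable *)

Section calculus.
Variable R : realType.

Lemma is_derive_near (f g : R -> R) (t df : R) :
  (\forall x \near t, f x = g x) -> is_derive t 1 f df -> is_derive t 1 g df.
Proof.
move=> fg hf; have fgt : f t = g t by exact: nbhs_singleton fg.
have cf : (fun h : R => h^-1 *: (f (h *: 1 + t) - f t)) @ 0^' --> df.
  by case: hf => dv <-; exact: dv.
have cg : (fun h : R => h^-1 *: (g (h *: 1 + t) - g t)) @ 0^' --> df.
  apply: cvg_trans cf; apply: near_eq_cvg.
  have c0 : (fun h : R => h *: 1 + t) @ 0 --> t.
    rewrite -[X in _ --> X]add0r -[X in _ --> X + _](scale0r (1 : R)).
    by apply: cvgD; [apply: cvgZr_tmp; exact: cvg_id|exact: cvg_cst].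
  have := c0 _ fg; rewrite nbhs_filterE => /(@nbhs_dnbhs _ _) {}h.
  by apply: filterS h => h /= ->; rewrite fgt.
apply: DeriveDef; first by apply/cvg_ex; exists df.
by apply: cvg_lim.
Qed.

Lemma continuous_near (f g : R -> R) (t : R) :
  (\forall x \near t, f x = g x) -> {for t, continuous f} ->
  {for t, continuous g}.
Proof.
move=> fg cf; have fgt : f t = g t by exact: nbhs_singleton fg.
rewrite /prop_for /continuous_at -fgt; apply: cvg_trans cf; apply: near_eq_cvg.
by apply: filterS fg => x ->.
Qed.

Lemma is_deriveN (f : R -> R) (t df : R) :
  is_derive t 1 f df -> is_derive t 1 (fun x => - f x) (- df).
Proof.
move=> hf; have := is_derive_mulr_cst (-1) hf.
by rewrite mulrN1; under eq_fun do rewrite mulrN1.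
Qed.

Lemma is_derive_inv (f : R -> R) (t df : R) : f t != 0 ->
  is_derive t 1 f df -> is_derive t 1 (fun x : R => (f x)^-1) (- df / f t ^+ 2).
Proof.
move=> f0 hf; have := is_deriveV f0 hf.
by move=> /is_derive_eq; apply; rewrite /GRing.scale/= mulNr mulrC mulNr.
Qed.

Lemma is_derive_add (f g : R -> R) (t df dg : R) :
  is_derive t 1 f df -> is_derive t 1 g dg ->
  is_derive t 1 (fun x : R => f x + g x) (df + dg).
Proof. by move=> hf hg; exact: (@is_deriveD R _ _ f g t 1 df dg hf hg). Qed.

Lemma is_derive_onemr (c t : R) :
  is_derive t 1 (fun x : R => 1 - c * x) (- c).
Proof.
have h1 : is_derive t 1 (fun x : R => x * c) c.
  by have := is_derive_mulr_cst c (is_derive_id t 1); rewrite mul1r.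
have := is_derive_add (is_derive_cst (1 : R) t 1) (is_deriveN h1).
rewrite add0r (_ : (fun x => _) = fun x => 1 - c * x)//.
by apply/funext => x; rewrite /= (mulrC c).
Qed.

Lemma is_derive_hump (t : R) : is_derive t 1 (@hump R) (4 * (1 - 2 * t)).
Proof.
have h1 : is_derive t 1 (fun x : R => x * 4) 4.
  by have := is_derive_mulr_cst 4 (is_derive_id t 1); rewrite mul1r.
have h2 := is_derive_onemr 1 t.
have := is_derive_mul h1 h2.
rewrite (_ : (fun x => _) = @hump R); last first.
  by apply/funext => x; rewrite /hump (mulrC x) mul1r.
by move=> /is_derive_eq; apply; ring.
Qed.

Lemma hump_onem (x : R) : 1 - hump x = (1 - 2 * x) ^+ 2.
Proof. by rewrite /hump; ring. Qed.

End calculus.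

(** * Pulling a bump back along the two branches of the quadratic map *)

Section branch.
Variables (R : realType) (e : R).
Hypothesis e2 : e * e = 1.
Variables (psi dpsi : R -> R) (y d eps m b dl : R).
Hypotheses (d0 : 0 < d) (eps01 : 0 < eps <= 1) (m0 : 0 <= m).
Hypotheses (dy : 20 * d <= y) (dy1 : 20 * d <= 1 - y).
Hypothesis bt : bump_test psi dpsi y d eps m.
Hypotheses (b1 : b <= 1) (bdl : 1 - d / y <= b).

(** The sign e = 1 or -1 selects the half-line x < 1/2 or x > 1/2. Dividing by 4b(1-2x) undoes the
    chain rule, so the derivative is the pulled-back [dpsi] plus the term psi/(2b(1-2x)^2) coming
    from the denominator. *)
Definition branch (x : R) : R :=
  if 0 < e * (1 - 2 * x) then psi (hump x * b) / (4 * b * (1 - 2 * x)) else 0.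

Definition dbranch (x : R) : R :=
  if 0 < e * (1 - 2 * x) then
    dpsi (hump x * b) + psi (hump x * b) * ((2 * b)^-1 / (1 - 2 * x) ^+ 2)
  else 0.

Let y0 : 0 < y. Proof. by have := d0; have := dy; lra. Qed.
Let dly : d / y * y = d. Proof. by rewrite divfK// gt_eqF. Qed.
Let dl0 : 0 < d / y. Proof. by rewrite divr_gt0. Qed.
Let dl20 : d / y <= 1 / 20.
Proof. by rewrite ler_pdivrMr//; move: dy; lra. Qed.
Let b0 : 19 / 20 <= b. Proof. by move: bdl dl20; lra. Qed.

(** Since b is within d/y of 1, dividing by b displaces points near y by little more than d. *)
Lemma branch_supp (x : R) : `|hump x * b - y| <= d ->
  y - d <= hump x <= y + 4 * d.
Proof.
rewrite ler_distl => /andP[l1 l2].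
have bp : 0 < b by move: b0; lra.
have u0 : 0 <= hump x.
  rewrite leNgt; apply/negP => u0; have : hump x * b < 0 by rewrite pmulr_llt0.
  by move: l1 dy d0; lra.
have hb : hump x * b <= hump x by rewrite ler_piMr.
apply/andP; split; first by move: l1 hb; lra.
rewrite leNgt; apply/negP => h4.
have : (y + 4 * d) * (1 - d / y) <= hump x * b.
  by apply: ler_pM; move: dl20 h4 bdl d0 dy; lra.
rewrite (_ : (y + 4 * d) * _ = y + 4 * d - d / y * y - 4 * (d / y * d)); last by ring.
rewrite dly; have : d / y * d <= 1 / 20 * d by rewrite ler_wpM2r// ltW.
by move: l2 d0; lra.
Qed.

(** A margin around the critical point: if |1-2x| < omega, then 1 - hump x = (1-2x)^2 < omega,
    whereas 1 - (y+4d) >= 4(1-y)/5 because 20d <= 1-y. So both pulled-back functions vanish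
    there. *)
Let omega : R := (1 - y) / 4.
Let om0 : 0 < omega. Proof. by rewrite /omega; move: d0 dy1; lra. Qed.

Let om1 : omega <= 1 / 4. Proof. by rewrite /omega; move: y0; lra. Qed.

Let psi_crit (x : R) : `|1 - 2 * x| < omega -> psi (hump x * b) = 0 /\ dpsi (hump x * b) = 0.
Proof.
move=> xo; have [_ _ _ _ sup] := bt; apply: sup; rewrite ltNge; apply/negP => /branch_supp/andP[_].
have : (1 - 2 * x) ^+ 2 < omega.
  rewrite -real_normK ?num_real// expr2.
  have : `|1 - 2 * x| * `|1 - 2 * x| <= omega * omega by apply: ler_pM => //; exact: ltW.
  have : omega * omega <= omega * (1 / 4) by rewrite ler_wpM2l// ltW.
  by move: om0; lra.
by rewrite -hump_onem /omega; move: dy1 d0; lra.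
Qed.

Let e_near (t : R) : \forall x \near t, e * (1 - 2 * t) - omega < e * (1 - 2 * x)
   < e * (1 - 2 * t) + omega.
Proof.
have c : {for t, continuous (fun x : R => (1 - 2 * x) * e)}.
  by apply: is_derive_continuous => s; exact: is_derive_mulr_cst (is_derive_onemr 2 s).
have cg := @cvgr_dist_lt _ _ _ _ _ _ _ c _ om0.
apply: filterS (cg (nbhs_filter t)) => x; rewrite ltr_distlC /= => /andP[h1 h2].
by rewrite -![e * _]mulrC h1 h2.
Qed.

Let e_norm (x : R) : `|e * (1 - 2 * x)| = `|1 - 2 * x|.
Proof.
have : `|e| = 1.
  have : `|e| * `|e| = 1 by rewrite -normrM e2 normr1.
  by move: (normr_ge0 e); nra.
by rewrite normrM => ->; rewrite mul1r.
Qed.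

(** A local property passes to the function cut at x = 1/2: near a point with e(1-2t) > 0 the cut is
    invisible, and near any other point the cut function is identically 0 because f vanishes close
    to the critical point. *)
Let branch_cases (t : R) (P : (R -> R) -> Prop) (f : R -> R) :
  (0 < e * (1 - 2 * t) -> P f) -> (forall x, `|1 - 2 * x| < omega -> f x = 0) ->
  (e * (1 - 2 * t) <= 0 -> P (fun=> 0)) ->
  (forall f1 f2 : R -> R, (\forall x \near t, f1 x = f2 x) -> P f1 -> P f2) ->
  P (fun x => if 0 < e * (1 - 2 * x) then f x else 0).
Proof.
move=> Pf f0 P0 Pn; have [t0|t0] := ltP 0 (e * (1 - 2 * t)).
  apply: Pn (Pf t0); have c : {for t, continuous (fun x : R => (1 - 2 * x) * e)}.
    by apply: is_derive_continuous => s; exact: is_derive_mulr_cst (is_derive_onemr 2 s).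
  have t0' : 0 < (1 - 2 * t) * e by rewrite mulrC.
  have cg := @cvgr_gt _ _ _ _ _ _ c _ t0'.
  by apply: filterS (cg (nbhs_filter t)) => x; rewrite /= mulrC => ->.
apply: Pn (P0 t0); apply: filterS (e_near t) => x /andP[_ h].
case: ifPn => // x0; rewrite f0// -e_norm gtr0_norm//.
by rewrite (lt_le_trans h)// gerDr.
Qed.

Lemma branch_derive (t : R) : is_derive t 1 branch (dbranch t).
Proof.
have [ps1 cd bp bd sup] := bt.
have D1 (x : R) : is_derive x 1 (fun x : R => psi (hump x * b)) (dpsi (hump x * b) * (4 * (1 - 2 * x) * b)).
  exact: (@is_derive1_comp R psi (fun x : R => hump x * b) x _ _ (ps1 _)
    (is_derive_mulr_cst b (is_derive_hump x))).
rewrite /branch; apply: (@branch_cases t (fun f => is_derive t 1 f (dbranch t))).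
- move=> t0; have t0' : 1 - 2 * t != 0.
    by move: (lt0r_neq0 t0); rewrite mulf_eq0 negb_or => /andP[].
  have bn : b != 0 by rewrite gt_eqF//; move: b0; lra.
  have := is_derive_mul (D1 t) (is_derive_mulr_cst (4 * b)^-1 
    (is_derive_inv (f := fun x : R => 1 - 2 * x) t0' (is_derive_onemr 2 t))).
  rewrite (_ : (fun x => _ * _) = fun x => psi (hump x * b) / (4 * b * (1 - 2 * x))); last first.
    by apply/funext => x; rewrite [in RHS]invfM; congr (_ * _); exact: mulrC.
  move=> /is_derive_eq; apply; rewrite /dbranch t0.
  by field; rewrite bn t0'.
- by move=> x /psi_crit[-> _]; rewrite mul0r.
- by move=> t0; rewrite /dbranch ltNge t0/=; exact: is_derive_cst.
- by move=> f1 f2; exact: is_derive_near.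
Qed.

Lemma continuous_dbranch : continuous dbranch.
Proof.
have [ps1 cd bp bd sup] := bt; move=> t.
have D1 (x : R) : is_derive x 1 (fun x : R => psi (hump x * b)) (dpsi (hump x * b) * (4 * (1 - 2 * x) * b)).
  exact: (@is_derive1_comp R psi (fun x : R => hump x * b) x _ _ (ps1 _)
    (is_derive_mulr_cst b (is_derive_hump x))).
rewrite /dbranch; apply: (@branch_cases t (fun f => {for t, continuous f})).
- move=> t0; have t0' : 1 - 2 * t != 0.
    by move: (lt0r_neq0 t0); rewrite mulf_eq0 negb_or => /andP[].
  have t0'' : (1 - 2 * t) * (1 - 2 * t) != 0 by rewrite mulf_neq0.
  have D2 := is_derive_mul (D1 t) (is_derive_mulr_cst (2 * b)^-1
    (is_derive_inv (f := fun x : R => (1 - 2 * x) * (1 - 2 * x)) t0''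
      (is_derive_mul (is_derive_onemr 2 t) (is_derive_onemr 2 t)))).
  have c2 : {for t, continuous (fun x : R => psi (hump x * b) * ((2 * b)^-1 / (1 - 2 * x) ^+ 2))}.
    rewrite (_ : (fun x => _) =
       fun x : R => psi (hump x * b) * (((1 - 2 * x) * (1 - 2 * x))^-1 / (2 * b))).
      by apply: differentiable_continuous; apply/derivable1_diffP; case: D2.
    by apply/funext => x; rewrite expr2; congr (_ * _); exact: mulrC.
  apply: (@continuousD _ _ _ (fun x : R => dpsi (hump x * b))) => //.
  apply: (@continuous_comp _ _ _ (fun x : R => hump x * b) dpsi); last exact: cd.
  by apply: is_derive_continuous => s; exact: is_derive_mulr_cst (is_derive_hump s).
- by move=> x /psi_crit[-> ->]; rewrite mul0r addr0.
- by move=> _; exact: cst_continuous.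
- by move=> f1 f2; exact: continuous_near.
Qed.

(** The preimages of y under [hump] are (1-w)/2 and (1+w)/2, and its slope there has modulus 4w. *)
Let w := Num.sqrt (1 - y).
Let w2 : w * w = 1 - y.
Proof. by rewrite -expr2 sqr_sqrtr//; move: d0 dy1; lra. Qed.
Let w0 : 0 < w. Proof. by rewrite sqrtr_gt0; move: d0 dy1; lra. Qed.

Lemma branch_geom (x : R) : 0 < e * (1 - 2 * x) -> `|hump x * b - y| <= d ->
  [/\ 4 / 5 * w <= e * (1 - 2 * x), 4 / 5 * (w * w) <= (1 - 2 * x) ^+ 2 &
      `|x - (1 - e * w) / 2| <= 2 * d / w].
Proof.
set W := e * (1 - 2 * x) => W0 /branch_supp/andP[u1 u2].
have W2 : W * W = 1 - hump x.
  by rewrite hump_onem /W mulrACA e2 mul1r expr2.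
have Ww : 4 / 5 * (w * w) <= W * W by rewrite W2 w2; move: u2 dy1; lra.
have Ww1 : 4 / 5 * w <= W.
  rewrite leNgt; apply/negP => h; have : W * W <= (4 / 5 * w) * (4 / 5 * w).
    by apply: ler_pM; exact: ltW.
  by have : 0 < w * w by [rewrite mulr_gt0]; move: Ww; lra.
split=> //; first by rewrite -hump_onem -W2.
have -> : x - (1 - e * w) / 2 = e * ((w - W) / 2).
  rewrite /W; have -> : e * ((w - e * (1 - 2 * x)) / 2) =
    (e * w - (e * e) * (1 - 2 * x)) / 2 by ring.
  by rewrite e2; field.
have -> : `|e * ((w - W) / 2)| = `|w - W| / 2.
  have e1 : `|e| = 1.
    have : `|e| * `|e| = 1 by rewrite -normrM e2 normr1.
    by move: (normr_ge0 e); nra.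
  by rewrite !normrM e1 mul1r (ger0_norm (x := 2^-1)).
rewrite ler_pdivlMr//.
have wW : `|w - W| * (w + W) <= 4 * d.
  rewrite -(ger0_norm (x := w + W)) ?addr_ge0 ?(ltW w0) ?(ltW W0)// -normrM.
  have -> : (w - W) * (w + W) = hump x - y.
    by rewrite (_ : _ * _ = w * w - W * W); [rewrite w2 W2|]; ring.
  by rewrite ler_distl; move: u1 u2 d0; lra.
have : `|w - W| * w <= `|w - W| * (w + W).
  by rewrite ler_wpM2l// lerDl ltW.
by move: wW; lra.
Qed.

(** Pulling back stretches lengths by about 1/w and divides the primitive accordingly, so the
    relative height eps is preserved. The correction term is at most m because w^2 = 1-y >= 20d;
    hence the height 2m. *)
Lemma branch_bump :
  bump_test branch dbranch ((1 - e * w) / 2) (2 * d / w) eps (2 * m).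
Proof.
have [ps1 cd bp bd sup] := bt.
have [eps0 eps1] : 0 < eps /\ eps <= 1 by apply/andP.
have me : 0 <= m * eps by rewrite mulr_ge0// ltW.
have bp0 : 0 < b by move: b0; lra.
have w00 : 0 < w := w0.
have RH : 0 <= 2 * m * eps * (2 * d / w).
  apply: mulr_ge0; first by rewrite -mulrA; exact: mulr_ge0.
  by apply: divr_ge0; [apply: mulr_ge0 => //|]; exact: ltW.
split.
- exact: branch_derive.
- exact: continuous_dbranch.
- move=> x; rewrite /branch; case: ifPn => [W0|_]; last first.
    by rewrite normr0.
  have [h|h] := leP `|hump x * b - y| d; last first.
    have [-> _] := sup _ h.
    by rewrite mul0r normr0.
  have [g1 g2 g3] := branch_geom W0 h.
  have nW : `|1 - 2 * x| = e * (1 - 2 * x) by rewrite -e_norm gtr0_norm.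
  rewrite normrM normfV normrM nW (gtr0_norm (x := 4 * b)); last by rewrite mulr_gt0.
  rewrite ler_pdivrMr; last by apply: mulr_gt0 => //; exact: mulr_gt0.
  apply: (le_trans (bp _)).
  have -> : 2 * m * eps * (2 * d / w) * (4 * b * (e * (1 - 2 * x))) =
    m * eps * d * (16 * b * ((e * (1 - 2 * x)) / w)) by ring.
  apply: ler_peMr; first by apply: mulr_ge0 => //; exact: ltW.
  have : 4 / 5 <= e * (1 - 2 * x) / w by rewrite ler_pdivlMr.
  by move: b0; nra.
- move=> x; rewrite /dbranch; case: ifPn => [W0|_]; last first.
    by rewrite normr0 mulr_ge0.
  have [h|h] := leP `|hump x * b - y| d; last first.
    by have [-> ->] := sup _ h; rewrite mul0r addr0 normr0 mulr_ge0.
  have [g1 g2 g3] := branch_geom W0 h.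
  apply: (le_trans (ler_normD _ _)); rewrite [2 * m](_ : _ = m + m); last by ring.
  apply: lerD; first exact: bd.
  have x2 : 0 < (1 - 2 * x) ^+ 2.
    by apply: lt_le_trans g2; apply: mulr_gt0 => //; exact: mulr_gt0.
  rewrite normrM (ger0_norm (x := _ / _)); last first.
    apply: divr_ge0; last exact: ltW.
    by rewrite invr_ge0; apply: mulr_ge0 => //; exact: ltW.
  rewrite -invfM ler_pdivrMr; last by apply: mulr_gt0 => //; exact: mulr_gt0.
  apply: (le_trans (bp _)); rewrite -mulrA; apply: ler_wpM2l => //.
  have k1 : eps * d <= d by rewrite ler_piMl// ltW.
  have k2 : 4 / 5 * (w * w) <= 2 * b * (1 - 2 * x) ^+ 2.
    apply: (le_trans g2); apply: ler_peMl; first exact: ltW.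
    by move: b0; lra.
  by move: k1 k2 dy1; rewrite w2; move: d0; lra.
- move=> x hx.
  suff : branch x = 0 /\ dbranch x = 0 by [].
  rewrite /branch /dbranch; case: ifPn => [W0|//].
  have [h|h] := leP `|hump x * b - y| d; last first.
    by have [-> ->] := sup _ h; rewrite !mul0r addr0.
  by have [_ _] := branch_geom W0 h; rewrite leNgt hx.
Qed.

(** Replacing the pulled-back function by an exact derivative costs a term involving [psi] itself,
    which gains the full factor eps. *)
Lemma branch_low (x : R) : 0 < e * (1 - 2 * x) ->
  `|dbranch x - dpsi (hump x * b)| <= m * eps * ind_ball y (4 * d) (hump x).
Proof.
have [ps1 cd bp bd sup] := bt.
have [eps0 eps1] : 0 < eps /\ eps <= 1 by apply/andP.
have me : 0 <= m * eps by rewrite mulr_ge0// ltW.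
have bp0 : 0 < b by move: b0; lra.
have w00 : 0 < w := w0.
move=> W0; rewrite /dbranch W0 addrAC subrr add0r.
have [h|h] := leP `|hump x * b - y| d; last first.
  by have [-> _] := sup _ h; rewrite mul0r normr0 mulr_ge0// ind_ball_ge0.
have [g1 g2 g3] := branch_geom W0 h.
rewrite ind_ball_in ?mulr1; last first.
  by rewrite ler_distl; have /andP[] := branch_supp h; move: d0; lra.
have x2 : 0 < (1 - 2 * x) ^+ 2.
  by apply: lt_le_trans g2; apply: mulr_gt0 => //; exact: mulr_gt0.
rewrite normrM (ger0_norm (x := _ / _)); last first.
  apply: divr_ge0; last exact: ltW.
  by rewrite invr_ge0; apply: mulr_ge0 => //; exact: ltW.
rewrite -invfM ler_pdivrMr; last by apply: mulr_gt0 => //; exact: mulr_gt0.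
apply: (le_trans (bp _)); apply: ler_wpM2l => //.
have k2 : 4 / 5 * (w * w) <= 2 * b * (1 - 2 * x) ^+ 2.
  apply: (le_trans g2); apply: ler_peMl; first exact: ltW.
  by move: b0; lra.
by move: k2 dy1; rewrite w2; move: d0; lra.
Qed.

End branch.

(** * Local smoothness of a law and its propagation by one step *)

Section smoothness.
Variable R : realType.
Implicit Types (lam nu : probability R R).

(** Fractional smoothness of order r tested on oscillating bumps, relative to the law's own mass of
    a ball L times larger that stays inside [0,1]. Every law has r = 0, and no density is
    assumed. *)
Definition local_smoothness nu (C r L : R) : Prop :=
  forall (psi dpsi : R -> R) (y d eps m : R), 0 < d -> 0 < eps <= 1 -> 0 <= m ->
  L * d <= y -> L * d <= 1 - y -> bump_test psi dpsi y d eps m ->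
  `|\int[nu]_x dpsi x| <= C * m * eps `^ r * \int[nu]_x ind_ball y (L * d) x.

Lemma local_smoothness0 nu : local_smoothness nu 1 0 1.
Proof.
move=> psi dpsi y d eps m d0 eps01 m0 _ _ bt.
rewrite powRr0 !mul1r mulr1 -bm_intZ; last exact: bm_ind_ball.
apply: bm_abs_le; [exact: bump_bm bt|exact: bmM (bm_cst _ _) (bm_ind_ball _ _)|].
move=> x; have [_ _ _ bd sup] := bt.
have [xy|xy] := leP `|x - y| d; first by rewrite ind_ball_in// mulr1.
by have [_ ->] := sup _ xy; rewrite normr0 mulr_ge0// ind_ball_ge0.
Qed.

(** For fixed b, the function x -> dpsi(b hump x) is the sum of the two exact derivatives minus a
    remainder of size m eps. Each derivative is a bump around a preimage of y, to which the
    smoothness of [nu] applies. *)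
Lemma branch_int (nu : probability R R) (C r L : R) psi dpsi y d eps m b :
  0 <= C -> 0 <= r <= 1 -> 1 <= L -> local_smoothness nu C r L ->
  0 < d -> 0 < eps <= 1 -> 0 <= m -> 20 * L * d <= y -> 20 * L * d <= 1 - y ->
  bump_test psi dpsi y d eps m -> b <= 1 -> 1 - d / y <= b ->
  `|\int[nu]_x dpsi (b * hump x)| <=
  (4 * C + 1) * m * eps `^ r * \int[nu]_x ind_ball y (9 * L * d) (hump x).
Proof.
move=> C0 /andP[r0 r1] L1 ls d0 eps01 m0 dy dy1 bt b1 bdl.
have [eps0 eps1] : 0 < eps /\ eps <= 1 by apply/andP.
have dLd : d <= L * d by rewrite ler_peMl// ltW.
have dy' : 20 * d <= y by move: dy; rewrite -mulrA; lra.
have dy1' : 20 * d <= 1 - y by move: dy1; rewrite -mulrA; lra.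
set w := Num.sqrt (1 - y).
have w2 : w * w = 1 - y by rewrite -expr2 sqr_sqrtr//; lra.
have w0 : 0 < w by rewrite sqrtr_gt0; lra.
have w1 : w <= 1 by rewrite leNgt; apply/negP => h; nra.
set J := (X in _ <= _ * X).
have bJ : bounded_measurable (fun x : R => ind_ball y (9 * L * d) (hump x)).
  by have := bm_comp (bm_ind_ball y (9 * L * d)) (@measurable_hump R).
have J0 : 0 <= J by apply: Rintegral_ge0 => x _; exact: ind_ball_ge0.
have key e : e * e = 1 -> bounded_measurable (dbranch e psi dpsi b) /\
    `|\int[nu]_x dbranch e psi dpsi b x| <= 2 * C * m * eps `^ r * J.
  move=> e2; have bb := branch_bump e2 d0 eps01 m0 dy' dy1' bt b1 bdl.
  split; first exact: bump_bm bb.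
  have dp0 : 0 < 2 * d / w by rewrite divr_gt0// mulr_gt0.
  have e1 : -1 <= e <= 1.
    by apply/andP; split; rewrite leNgt; apply/negP => h; nra.
  (* Needed for the ball of radius 2Ld/w around (1-w)/2 to fit in [0,1], since y = (1-w)(1+w) <=
     2(1-w). For w >= 1/2 it comes from y >= 20Ld; otherwise y >= 3/4 and w^2 = 1-y >= 20Ld. *)
  have yw : 8 * (L * d) <= y * w.
    have [h|h] := leP (1 / 2) w.
      have : y * (1 / 2) <= y * w by rewrite ler_wpM2l//; lra.
      by move: dy; rewrite -mulrA; lra.
    have : 3 / 4 * w <= y * w by apply: ler_wpM2r; [exact: ltW|nra].
    have : w * w <= 1 / 2 * w by rewrite ler_wpM2r// ltW.
    by move: dy1; rewrite -mulrA -w2; lra.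
  have g : L * (2 * d / w) <= (1 - w) / 2.
    rewrite mulrA ler_pdivrMr//.
    have : y = (1 - w) * (1 + w) by rewrite (_ : _ * _ = 1 - w * w); [rewrite w2|]; ring.
    move: yw => /[swap] yE; have : y * w <= ((1 - w) * 2) * w.
      rewrite yE; apply: ler_wpM2r; first exact: ltW.
      by apply: ler_wpM2l; lra.
    lra.
  have ew : -w <= e * w <= w by apply/andP; split; nra.
  have h1 : L * (2 * d / w) <= (1 - e * w) / 2 by case/andP: ew; lra.
  have h2 : L * (2 * d / w) <= 1 - (1 - e * w) / 2 by case/andP: ew; lra.
  have m20 : 0 <= 2 * m by rewrite mulr_ge0.
  apply: (le_trans (ls _ _ _ _ _ _ dp0 eps01 m20 h1 h2 bb)).
  rewrite [C * _](_ : _ = 2 * C * m); last by ring.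
  apply: ler_wpM2l; first by rewrite !mulr_ge0// powR_ge0.
  apply: bm_le => //; first exact: bm_ind_ball.
  move=> x; apply: ind_ball_le => hx.
  set V := e * (1 - 2 * x).
  have V2 : V * V = 1 - hump x by rewrite hump_onem /V mulrACA e2 mul1r expr2.
  have xE : x - (1 - e * w) / 2 = e * ((w - V) / 2).
    rewrite /V; have -> : e * ((w - e * (1 - 2 * x)) / 2) =
      (e * w - (e * e) * (1 - 2 * x)) / 2 by ring.
    by rewrite e2; field.
  have e11 : `|e| = 1.
    have : `|e| * `|e| = 1 by rewrite -normrM e2 normr1.
    by move: (normr_ge0 e); nra.
  (* Origin of the radius 9Ld: if |w-V| <= q then |hump x - y| <= q(2w+q) = 8Ld + q^2, and q^2 <=
     16Ld/20 because w^2 >= 20Ld. *)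
  pose q := 4 * (L * d) / w.
  have q0 : 0 <= q by apply: divr_ge0; [apply: mulr_ge0 => //; lra|exact: ltW].
  have wV : `|w - V| <= q.
    have := hx; rewrite xE normrM e11 mul1r normrM (ger0_norm (x := 2^-1))//.
    by rewrite /q -mulrA [L * _]mulrA [leRHS]mulrA ler_pdivrMr//; lra.
  have wVp : `|w + V| <= 2 * w + q.
    have -> : w + V = 2 * w - (w - V) by ring.
    by rewrite (le_trans (ler_normB _ _))// lerD// ger0_norm// mulr_ge0// ltW.
  have -> : hump x - y = (w - V) * (w + V).
    by rewrite (_ : _ * _ = w * w - V * V); [rewrite w2 V2|]; ring.
  rewrite normrM (le_trans (ler_pM _ _ wV wVp))//.
  have qw : q * w = 4 * (L * d) by rewrite /q divfK// gt_eqF.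
  have qq : q * q * (w * w) = 16 * (L * d) * (L * d).
    by rewrite mulrACA qw; ring.
  have : q * q <= 16 / 20 * (L * d).
    have w20 : 0 < w * w by rewrite mulr_gt0.
    rewrite -(ler_pM2r w20) qq.
    have : 16 * (L * d) * (20 * (L * d)) <= 16 * (L * d) * (w * w).
      by apply: ler_wpM2l; [lra|rewrite w2; move: dy1; rewrite -mulrA].
    lra.
  by rewrite mulrDr [q * (2 * w)]mulrCA qw -mulrA; lra.
have [b1' k1] := key 1 (mulr1 1).
have em1 : (-1) * (-1) = 1 :> R by rewrite mulrNN mulr1.
have [b2' k2] := key (-1) em1.
have bd0 : bounded_measurable (fun x : R => dpsi (b * hump x)).
  apply: bm_comp (bump_bm bt) _; apply: measurable_funM => //.
  exact: measurable_hump.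
pose low x := dbranch 1 psi dpsi b x + dbranch (-1) psi dpsi b x - dpsi (b * hump x).
have blow : bounded_measurable low by apply: bmB => //; exact: bmD.
have -> : \int[nu]_x dpsi (b * hump x) = \int[nu]_x dbranch 1 psi dpsi b x +
    \int[nu]_x dbranch (-1) psi dpsi b x - \int[nu]_x low x.
  rewrite -bm_intD// -bm_intB//; last exact: bmD.
  by apply: eq_Rintegral => x _; rewrite /low opprB addrC subrK.
have me : 0 <= m * eps by rewrite mulr_ge0// ltW.
have k3 : `|\int[nu]_x low x| <= m * eps * J.
  rewrite -bm_intZ//; apply: bm_abs_le => //; first exact: bmM (bm_cst _ _) bJ.
  move=> x; have [x0|x0|x0] := ltgtP 0 (1 - 2 * x).
  - have e0 : 0 < 1 * (1 - 2 * x) by rewrite mul1r.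
    have := branch_low (mulr1 1) d0 eps01 m0 dy' dy1' bt b1 bdl e0.
    have -> : low x = dbranch 1 psi dpsi b x - dpsi (hump x * b).
      rewrite /low [dbranch (-1) _ _ _ _]/dbranch mulN1r oppr_gt0 ltNge (ltW x0)/=.
      by rewrite addr0 (mulrC b).
    move=> /le_trans; apply; apply: ler_wpM2l => //; apply: ind_ball_le => h.
    by rewrite (le_trans h)// -mulrA; lra.
  - have e0 : 0 < -1 * (1 - 2 * x) by rewrite mulN1r oppr_gt0.
    have := branch_low em1 d0 eps01 m0 dy' dy1' bt b1 bdl e0.
    have -> : low x = dbranch (-1) psi dpsi b x - dpsi (hump x * b).
      rewrite /low [dbranch 1 _ _ _ _]/dbranch mul1r ltNge (ltW x0)/=.
      by rewrite add0r (mulrC b).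
    move=> /le_trans; apply; apply: ler_wpM2l => //; apply: ind_ball_le => h.
    by rewrite (le_trans h)// -mulrA; lra.
  (* At x = 1/2 both branches are cut to 0, and hump x = 1 is too far above y for b to bring it into
     the support. *)
  - have -> : low x = 0.
      rewrite /low /dbranch -x0 !mulr0 ltxx add0r sub0r mulrC.
      have hx1 : hump x = 1.
        by apply/eqP; rewrite -subr_eq0 -oppr_eq0 opprB hump_onem -x0 expr0n.
      have [_ _ _ _ sup] := bt; have [|_ ->] := sup (hump x * b) _; rewrite ?oppr0//.
      rewrite ltNge; apply/negP => /(branch_supp d0 dy' b1 bdl)/andP[_].
      by rewrite hx1; lra.
    by rewrite normr0 mulr_ge0// ind_ball_ge0.
rewrite (le_trans (ler_normB _ _))// (_ : (4 * C + 1) * m * _ * J =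
  2 * C * m * eps `^ r * J + 2 * C * m * eps `^ r * J + m * eps `^ r * J); last by ring.
apply: lerD; first by rewrite (le_trans (ler_normD _ _))// lerD.
apply: (le_trans k3); apply: ler_wpM2r => //; apply: ler_wpM2l => //.
by rewrite -[leLHS](powRr1 (ltW eps0)) ger_powR// eps0.
Qed.

End smoothness.

Section smoothness_step.
Variable R : realType.
Implicit Types (lam nu : probability R R).

(** The kernel integral is cut at 1-b = eta d/y. Below the cut, integration by parts in b gains eps
    eta^(s-1); above it, the smoothness of [nu] for each b gains eps^r on a set of relative kernel
    mass eta^s. The defects 1-r and 1-s multiply. *)
Lemma smoothness_step lam sg s K C r L : kernel_bounds lam sg s K ->
  0 <= C -> 0 <= r <= 1 -> 1 <= L ->
  exists C' : R, 0 <= C' /\ forall nu nu', local_smoothness nu C r L ->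
    logistic_step lam nu nu' ->
    local_smoothness nu' C' (1 - (1 - r) * (1 - s)) (20 * L).
Proof.
move=> kb C0 r01 L1; have [r0 r1] : 0 <= r /\ r <= 1 by apply/andP.
have s0 := kb_s0 kb; have s1 := kb_s1 kb; have ssg := kb_sg kb.
have K1 := kb_K kb; have K0 : 0 <= K by rewrite (le_trans ler01).
have sg0 : 0 < sg by rewrite (lt_le_trans s0).
have [CA [CA0 smooth]] := smooth_part kb.
have C40 : 0 <= 4 * C + 1 by rewrite addr_ge0// mulr_ge0.
exists (CA + (4 * C + 1) * (K * K)); split.
  by rewrite addr_ge0// mulr_ge0// mulr_ge0.
move=> nu nu' ls st psi dpsi y d eps m d0 eps01 m0 dy dy1 bt.
have [eps0 eps1] : 0 < eps /\ eps <= 1 by apply/andP.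
have dLd : d <= L * d by rewrite ler_peMl// ltW.
have dyL : 20 * d <= y by move: dy; rewrite -mulrA; clear -dLd; lra.
have y0 : 0 < y by clear -dyL d0; lra.
have y1 : y <= 1 by move: dy1; rewrite -mulrA; clear -dLd d0; lra.
(* The choice that balances eps eta^(s-1) against eps^r eta^s; both become eps^(1-(1-r)(1-s)). *)
pose eta := eps `^ (1 - r).
have eta0 : 0 < eta by rewrite powR_gt0.
have eta1 : eta <= 1.
  by rewrite -[leRHS](powRr0 eps) ger_powR ?eps0// subr_ge0.
have eta01 : 0 < eta <= 1 by rewrite eta0.
set dl := d / y.
have dl0 : 0 < dl by rewrite divr_gt0.
have dlE : dl * y = d by rewrite /dl divfK// gt_eqF.
have dl20 : dl <= 1 / 20 by rewrite ler_pdivrMr//; clear -dyL; lra.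
set h := eta * dl.
have h0 : 0 < h by rewrite mulr_gt0.
have hdl : h <= dl by rewrite ger_pMl.
have h1 : h <= 1 by clear -hdl dl20; lra.
set b0 := (y - d) / 2.
have b00 : 0 < b0 by rewrite /b0; clear -dyL d0; lra.
have b0h : b0 < 1 - h by rewrite /b0; clear -hdl dl20 y1 d0; lra.
have bdp := bump_bm bt; have [_ _ bp bd sup] := bt.
have bF : bounded_measurable (fun z : R * R => dpsi (z.2 * hump z.1)).
  apply: (@bm_comp _ _ _ _ _ dpsi (fun z : R * R => z.2 * hump z.1) bdp).
  by apply: measurable_funM => //; exact: (measurableT_comp (@measurable_hump R)).
pose D1 := `[b0, 1 - h]%classic : set R.
pose D2 := `]1 - h, 1]%classic : set R.
have mD1 : measurable D1 by exact: measurable_itv.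
have mD2 : measurable D2 by exact: measurable_itv.
have bind (D : set R) : measurable D ->
    bounded_measurable (fun z : R * R => \1_D z.2 * dpsi (z.2 * hump z.1)).
  move=> mD; apply: bmM => //.
  by have := bm_comp (bm_indic R mD) (@measurable_snd _ _ R R).
have bS := bm_fubini1 nu lam (bind _ mD1).
have bR := bm_fubini1 nu lam (bind _ mD2).
have split12 x : \int[lam]_b dpsi (b * hump x) =
    \int[lam]_b (\1_D1 b * dpsi (b * hump x)) +
    \int[lam]_b (\1_D2 b * dpsi (b * hump x)).
  rewrite (kernel_int01 kb); last exact: bm_mulr.
  have m01 : measurable (`[0, 1]%classic : set R) by exact: measurable_itv.
  rewrite bm_int_mkcond (@bm_indic_split _ _ _ lam _ D1 D2)//.
  - rewrite (bm_int_mkcond lam D1) (bm_int_mkcond lam D2); congr (_ + _); apply: eq_Rintegral => b _;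
      rewrite !indicE.
    + have [/set_mem|_] := boolP (b \in D1); last by rewrite !mul0r.
      rewrite /D1 /= in_itv/= => /andP[b1 b2].
      rewrite (mem_set (A := `[0, 1]%classic)) ?mul1r//= in_itv/=.
      by apply/andP; split; [rewrite (le_trans _ b1)// ltW|clear -b2 h0; lra].
    + have [/set_mem|_] := boolP (b \in D2); last by rewrite !mul0r.
      rewrite /D2 /= in_itv/= => /andP[b1 b2].
      rewrite (mem_set (A := `[0, 1]%classic)) ?mul1r//= in_itv/= b2 andbT.
      by clear -b1 h1; lra.
  - by apply: bmM; [exact: bm_indic|exact: bm_mulr].
  - apply/seteqP; split => // b; rewrite /D1 /D2 /= !in_itv/=.
    by move=> [/andP[_ +] /andP[+ _]]; rewrite ltNge => ->.
  - move=> b; rewrite /D1 /D2 /= !in_itv/= => n1 n2; rewrite indicE.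
    have [/set_mem|_] := boolP (b \in _); last by rewrite mul0r.
    rewrite /= in_itv/= mul1r => /andP[bb0 bb1].
    have bb : b < b0.
      rewrite ltNge; apply/negP => bb; apply: n1; rewrite bb/= leNgt.
      by apply/negP => hb; apply: n2; rewrite hb.
    suff /sup[_ ->] : d < `|b * hump x - y| by [].
    have hb : b * hump x < y - d.
      have [u0|u0] := leP 0 (hump x); last first.
        apply: (@le_lt_trans _ _ 0); last by clear -dyL d0; lra.
        by rewrite mulr_ge0_le0// ltW.
      have : b * hump x <= b * 1 by rewrite ler_wpM2l// hump_le1.
      by move: bb; rewrite /b0; clear -dyL d0; lra.
    by rewrite ltr0_norm; clear -hb d0; lra.
rewrite (logistic_step_int st bdp).
under eq_Rintegral do rewrite split12.
rewrite bm_intD//.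
set I := \int[nu']_x _.
have I20 : \int[nu]_x \int[lam]_b ind_ball y (20 * L * d) (b * hump x) = I.
  by rewrite -(logistic_step_int st (bm_ind_ball _ _)).
have bI r' : bounded_measurable (fun z : R * R => ind_ball y r' (z.2 * hump z.1)).
  apply: (@bm_comp _ _ _ _ _ _ (fun z : R * R => z.2 * hump z.1) (bm_ind_ball y r')).
  by apply: measurable_funM => //; exact: (measurableT_comp (@measurable_hump R)).
have bII r' := bm_fubini1 nu lam (bI r').
have me : 0 <= m * eps by rewrite mulr_ge0// ltW.
have I0 : 0 <= I by apply: Rintegral_ge0 => x _; exact: ind_ball_ge0.
set r' := 1 - (1 - r) * (1 - s).
have e1 : eps * eta `^ (s - 1) = eps `^ r'.
  rewrite -[X in X * _](powRr1 (ltW eps0)) -powRrM -powRD.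
    by rewrite /r'; congr (_ `^ _); ring.
  by rewrite (gt_eqF eps0) implybT.
have e2 : eps `^ r * eta `^ s = eps `^ r'.
  rewrite -powRrM -powRD; last by rewrite (gt_eqF eps0) implybT.
  by rewrite /r'; congr (_ `^ _); ring.
have partS : `|\int[nu]_x \int[lam]_b (\1_D1 b * dpsi (b * hump x))| <=
    CA * m * eps `^ r' * I.
  have b6 := bII (6 * d).
  apply: (@le_trans _ _ (\int[nu]_x (CA * m * eps * eta `^ (s - 1) *
      \int[lam]_b ind_ball y (6 * d) (b * hump x)))).
    apply: bm_abs_le => //; first exact: bmM (bm_cst _ _) b6.
    move=> x; rewrite -bm_int_mkcond.
    apply: (smooth psi dpsi y d eps m eta (hump x)) => //; exact: hump_le1.
  rewrite bm_intZ//.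
  rewrite [CA * m * eps * _](_ : _ = CA * m * eps `^ r'); last first.
    by rewrite -e1; ring.
  apply: ler_wpM2l; first by rewrite mulr_ge0 ?powR_ge0// mulr_ge0.
  rewrite -I20; apply: bm_le => //.
  move=> x; apply: bm_le; [exact: bm_mulr (bm_ind_ball _ _)..|].
  move=> b; apply: ind_ball_le => hb; rewrite (le_trans hb)//.
  by rewrite -mulrA; clear -dLd d0; lra.
have partR : `|\int[nu]_x \int[lam]_b (\1_D2 b * dpsi (b * hump x))| <=
    (4 * C + 1) * (K * K) * m * eps `^ r' * I.
  rewrite (bm_fubini nu lam (bind _ mD2)).
  pose J := \int[nu]_x ind_ball y (9 * L * d) (hump x).
  have bJ : bounded_measurable (fun x : R => ind_ball y (9 * L * d) (hump x)).
    by have := bm_comp (bm_ind_ball y (9 * L * d)) (@measurable_hump R).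
  have J0 : 0 <= J by apply: Rintegral_ge0 => x _; exact: ind_ball_ge0.
  have Jm : 0 <= (4 * C + 1) * m * eps `^ r * J.
    by rewrite mulr_ge0// mulr_ge0 ?powR_ge0// mulr_ge0.
  apply: (@le_trans _ _ (\int[lam]_b ((4 * C + 1) * m * eps `^ r * J * \1_D2 b))).
    apply: bm_abs_le; first exact: bm_fubini2 (bind _ mD2).
      by apply: bmM; [exact: bm_cst|exact: bm_indic].
    move=> b; rewrite indicE; have [/set_mem|_] := boolP (b \in D2); last first.
      under eq_Rintegral do rewrite mul0r.
      by rewrite prob_intc normr0 mulr0.
    rewrite /D2 /= in_itv/= => /andP[bh b1]; rewrite mulr1.
    under eq_Rintegral do rewrite mul1r.
    apply: (branch_int C0 r01 L1 ls d0 eps01 m0 dy dy1 bt b1).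
    by rewrite -/dl; clear -bh hdl; lra.
  rewrite bm_intZ; last exact: bm_indic.
  rewrite prob_indic//.
  have lD2 : fine (lam D2) <= K * (eta `^ s * dl `^ sg).
    apply: (@le_trans _ _ (fine (lam `[1 - h, 1]%classic))).
      rewrite -!prob_indic//; apply: bm_le; [exact: bm_indic..|].
      move=> b; rewrite !indicE; have [/set_mem|_] := boolP (b \in D2) => //.
      rewrite /D2 /= in_itv/= => /andP[bh b1].
      by rewrite mem_set//= in_itv/= b1 ltW.
    apply: (le_trans (kb_up kb _)); first by rewrite h0.
    apply: ler_wpM2l => //; rewrite /h powRM ?(ltW eta0) ?(ltW dl0)//.
    by apply: ler_wpM2r; [exact: powR_ge0|rewrite ger_powR].
  (* The kernel mass (d/y)^sg and the [nu]-mass of hump x near y combine into the mass of a ball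
     under the new law: from such an x, a factor b within d/y of 1 lands within 20Ld of y. *)
  have dJ : dl `^ sg * J <= K * I.
    rewrite -I20 -!bm_intZ//.
    apply: bm_le; [exact: bmM (bm_cst _ _) bJ|exact: bmM (bm_cst _ _) (bII (20 * L * d))|].
    move=> x; have [hx|hx] := leP `|hump x - y| (9 * L * d); last first.
      rewrite ind_ball_eq0// mulr0 mulr_ge0//.
      by apply: Rintegral_ge0 => b _; exact: ind_ball_ge0.
    rewrite ind_ball_in// mulr1; apply: (kernel_lo_ball kb).
    - by rewrite dl0; clear -dl20; lra.
    - by move: hx dy; rewrite ler_distl -!mulrA => /andP[+ _]; clear -dLd d0; lra.
    - have hu : hump x <= y + 9 * L * d by move: hx; rewrite ler_distl => /andP[].
      have : dl * hump x <= dl * (y + 9 * L * d) by apply: ler_wpM2l => //; exact: ltW.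
      have -> : dl * (y + 9 * L * d) = d + 9 * (dl * (L * d)).
        by rewrite mulrDr dlE; ring.
      have : dl * (L * d) <= 1 / 20 * (L * d).
        by apply: ler_wpM2r => //; clear -dLd d0; lra.
      by move: hx; rewrite -!mulrA; clear -dLd d0; lra.
  apply: (le_trans (ler_wpM2l Jm lD2)).
  rewrite [leLHS](_ : _ = (4 * C + 1) * m * K * (eps `^ r * eta `^ s) * (dl `^ sg * J)); last by ring.
  rewrite e2 [leRHS](_ : _ = (4 * C + 1) * m * K * eps `^ r' * (K * I)); last by ring.
  apply: ler_wpM2l => //.
  by apply: mulr_ge0; [apply: mulr_ge0 => //; exact: mulr_ge0|exact: powR_ge0].
apply: (le_trans (ler_normD _ _)); rewrite [leRHS](_ : _ =
  CA * m * eps `^ r' * I + (4 * C + 1) * (K * K) * m * eps `^ r' * I); last by ring.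
exact: lerD.
Qed.

End smoothness_step.

(** * The kernel sends suitably growing derivatives to Lipschitz functions *)

Section kernel_lipschitz.
Variable R : realType.

Lemma MVT_bound (f df : R -> R) (u v M : R) : u <= v ->
  (forall t : R, is_derive t 1 f (df t)) ->
  (forall t, u < t < v -> `|df t| <= M) -> `|f v - f u| <= M * (v - u).
Proof.
rewrite le_eqVlt => /predU1P[->|uv] f1 fM; first by rewrite !subrr normr0 mulr0.
have cf : {within `[u, v], continuous f}.
  by apply: continuous_subspaceT; exact: is_derive_continuous f1.
have [c] := MVT uv (fun x _ => f1 x) cf.
rewrite in_itv/= => /fM dM ->; rewrite normrM (gtr0_norm (x := v - u)) ?subr_gt0//.
by apply: ler_wpM2r => //; rewrite subr_ge0 ltW.
Qed.

Lemma kernel_derive (lam : probability R R) (phi dphi : R -> R) (M0 M2 w : R) :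
  (forall t : R, is_derive t 1 phi (dphi t)) -> continuous dphi ->
  (forall t, `|phi t| <= M0) -> (forall t, `|dphi t| <= M2) ->
  is_derive w 1 (fun w : R => \int[lam]_(b in `[0, 1]) phi (b * w))
    (\int[lam]_(b in `[0, 1]) (b * dphi (b * w))).
Proof.
move=> p1 cd pM dM.
have D1 (b x : R) : is_derive x 1 (fun w : R => phi (b * w)) (b * dphi (b * x)).
  have := is_derive_comp_mulr b x p1.
  under eq_fun do rewrite mulrC.
  by move=> /is_derive_eq; apply; rewrite mulrC (mulrC x).
have M20 : 0 <= M2 by rewrite (le_trans _ (dM 0)).
have bphi : bounded_measurable phi.
  by split; [exact: continuous_measurable_fun (is_derive_continuous p1)|exists M0].
have m01 : measurable (`[0, 1]%classic : set R) by exact: measurable_itv.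
have intf x : (w - 1 < x < w + 1) -> lam.-integrable `[0, 1] (EFin \o (fun b => phi (b * x))).
  by move=> _; apply: bm_integrable => //; exact: bm_mulr.
have d1E x b : partial1of2 (fun w b => phi (b * w)) x b = b * dphi (b * x).
  by rewrite partial1of2E; case: (D1 b x).
have Iw : (`](w - 1), (w + 1)[%classic : set R) w.
  by rewrite /= in_itv/=; apply/andP; split; lra.
have intf' x : (`](w - 1), (w + 1)[%classic : set R) x ->
    lam.-integrable `[0, 1] (EFin \o (fun b => phi (b * x))).
  by rewrite /= in_itv/=; exact: intf.
have derf x b : (`](w - 1), (w + 1)[%classic : set R) x ->
    (`[0, 1]%classic : set R) b -> derivable ((fun w b => phi (b * w)) ^~ b) x 1.
  by move=> _ _; case: (D1 b x).
have intG : lam.-integrable `[0, 1] (EFin \o (fun=> M2)).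
  by apply: bm_integrable => //; exact: bm_cst.
have Gub x b : (`](w - 1), (w + 1)[%classic : set R) x ->
    (`[0, 1]%classic : set R) b -> `|partial1of2 (fun w b => phi (b * w)) x b| <= M2.
  rewrite /= !in_itv/= => _ /andP[b0 b1]; rewrite d1E normrM (ger0_norm b0).
  by rewrite (le_trans (ler_wpM2l b0 (dM _)))// ler_piMl.
have E := differentiation_under_integral m01 Iw intf' derf (fun=> M20) intG Gub.
have D := derivable_under_integral m01 Iw intf' derf (fun=> M20) intG Gub.
apply: DeriveDef; first exact: D.
rewrite -derive1E E; apply: eq_Rintegral => b _; exact: d1E.
Qed.

(** The integral is cut at 1-b = h with h = (S/(4w))^kap / 2. Below the cut only |phi| <= M0 is
    used, by parts, at cost h^(s-1)/w; above it the derivative bound is paid on mass at most h^s.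
    Since kap(1-s) = 1, both are of order 1/S. *)
Lemma kernel_deriv_bound (lam : probability R R) (sg s K M0 M1 : R) :
  kernel_bounds lam sg s K -> 0 <= M0 -> 0 <= M1 ->
  exists C : R, 0 <= C /\ forall (phi dphi : R -> R) (S w : R),
  0 < S <= 1 -> 0 < w <= 1 ->
  (forall t : R, is_derive t 1 phi (dphi t)) -> continuous dphi ->
  (forall t, `|phi t| <= M0) ->
  (forall t, 0 < t ->
    `|dphi t| <= M1 * S `^ (- (1 - s)^-1) * t `^ ((1 - s)^-1 - 1)) ->
  (forall t, t <= S / 4 -> phi t = 0 /\ dphi t = 0) ->
  `|\int[lam]_(b in `[0, 1]) (b * dphi (b * w))| <= C / S.
Proof.
move=> kb M00 M10.
have s0 := kb_s0 kb; have s1 := kb_s1 kb; have ssg := kb_sg kb.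
have K1 := kb_K kb; have K0 : 0 <= K by rewrite (le_trans ler01).
pose C := K * (M0 * 8 * (1 + K)) + 4 * M0 + M1 * K.
have C0 : 0 <= C by rewrite /C !addr_ge0 ?mulr_ge0 ?addr_ge0.
exists C; split => // phi dphi S w /andP[S0 S1] /andP[w0 w1] p1 cd pM dM p0.
set kap := (1 - s)^-1 in dM.
have s10 : 0 < 1 - s by rewrite subr_gt0.
have kap1 : 1 <= kap by rewrite /kap invf_ge1//; lra.
have kap0 : 0 < kap by lra.
have kaps : kap * (1 - s) = 1 by rewrite /kap mulVf// gt_eqF.
have [wS|wS] := leP w (S / 4).
  rewrite [X in `|X|](_ : _ = 0); first by rewrite normr0 divr_ge0// ltW.
  rewrite bm_int_mkcond -[RHS](prob_intc lam); apply: eq_Rintegral => b _.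
  rewrite indicE; have [/set_mem|] := boolP (b \in _); last by rewrite mul0r.
  rewrite /= in_itv/= mul1r => /andP[b0 b1].
  by have [|_ ->] := p0 (b * w); rewrite ?mulr0// (le_trans _ wS)// ler_piMl// ltW.
(* In the remaining case w > S/4, hence q < 1. *)
pose q := S / (4 * w).
have q0 : 0 < q by rewrite divr_gt0// mulr_gt0.
have q1 : q <= 1 by rewrite ler_pdivrMr ?mulr_gt0//; lra.
pose h := q `^ kap / 2.
have qk0 : 0 < q `^ kap by exact: powR_gt0.
have qk1 : q `^ kap <= 1.
  by rewrite -[leRHS](powRr0 q) ger_powR ?q0 ?q1// ltW.
have h0 : 0 < h by rewrite divr_gt0.
have h2 : h <= 1 / 2 by rewrite ler_pdivrMr//; lra.
have bphi : bounded_measurable phi.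
  by split; [exact: continuous_measurable_fun (is_derive_continuous p1)|exists M0].
have mdphi : measurable_fun [set: R] dphi by exact: continuous_measurable_fun.
pose b0 := S / 8.
have b00 : 0 < b0 by rewrite divr_gt0.
have b0h : b0 < 1 - h by rewrite /b0; clear -S1 h2; lra.
have h1 : 1 - h < 1 by clear -h0; lra.
(* The factor b makes the wanted integrand b dphi(bw) equal to F' minus the harmless term phi(bw)/w,
   which is at most 4 M0/S because w > S/4. *)
pose F (b : R) := b * phi (b * w) / w.
pose f (b : R) := phi (b * w) / w + b * dphi (b * w).
have F1 (t : R) : is_derive t 1 F (f t).
  have := is_derive_mulr_cst w^-1
    (is_derive_mul (is_derive_id t 1) (is_derive_comp_mulr w t p1)).
  by move=> /is_derive_eq; apply; rewrite /f; field; rewrite gt_eqF.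
have cphi : continuous (fun b : R => phi (b * w)).
  by move=> t; apply: (@continuous_comp _ _ _ (fun b : R => b * w) phi);
    [exact: mulrr_continuous|exact: is_derive_continuous p1 _].
have cdphi : continuous (fun b : R => dphi (b * w)).
  by move=> t; apply: (@continuous_comp _ _ _ (fun b : R => b * w) dphi);
    [exact: mulrr_continuous|exact: cd].
have cf : continuous f.
  move=> t; apply: (@continuousD _ _ _ (fun b : R => phi (b * w) / w)).
    by apply: (@continuousM _ _ (fun b : R => phi (b * w)) (fun=> w^-1)); [exact: cphi|exact: cst_continuous].
  by apply: (@continuousM _ _ (fun b : R => b) (fun b : R => dphi (b * w))); [exact: cvg_id|exact: cdphi].
have phi0 b : b * w <= S / 4 -> phi (b * w) = 0 /\ dphi (b * w) = 0 by exact: p0.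
have bw0 b : b <= b0 -> b * w <= S / 4.
  have [bn|bn] := leP b 0 => bb.
    apply: (@le_trans _ _ 0); last by rewrite divr_ge0// ltW.
    by rewrite mulr_le0_ge0// ltW.
  apply: (@le_trans _ _ (b * 1)); first by rewrite ler_wpM2l// ltW.
  by move: bb; rewrite /b0 mulr1; lra.
have Fb0 : F b0 = 0.
  by rewrite /F; have [-> _] := phi0 _ (bw0 _ (lexx _)); rewrite mulr0 mul0r.
have ibp := kb_ibp kb b00 b0h h1 F1 cf Fb0.
rewrite (_ : 1 - (1 - h) = h) in ibp; last by ring.
pose D1 := `[b0, 1 - h]%classic : set R.
pose D2 := `]1 - h, 1]%classic : set R.
have mD1 : measurable D1 by exact: measurable_itv.
have mD2 : measurable D2 by exact: measurable_itv.
have m01 : measurable (`[0, 1]%classic : set R) by exact: measurable_itv.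
have FM b : 0 <= b <= 1 -> `|F b| <= b * (M0 / w).
  move=> /andP[bb0 bb1]; rewrite /F !normrM (ger0_norm bb0) normfV (gtr0_norm w0).
  rewrite -mulrA; apply: ler_wpM2l => //; apply: ler_wpM2r; last exact: pM.
  by rewrite invr_ge0 ltW.
have hs : h `^ (s - 1) <= 2 * (q^-1).
  have -> : q^-1 = (q `^ kap) `^ (s - 1).
    rewrite -powRrM (_ : kap * (s - 1) = -1) ?powR_inv1 ?(ltW q0)//.
    by rewrite -(opprB 1 s) mulrN kaps.
  have -> : h `^ (s - 1) = (q `^ kap) `^ (s - 1) * 2 `^ (1 - s).
    rewrite /h powRM ?(ltW qk0) ?invr_ge0 ?ler0n//; congr (_ * _).
    by rewrite -[2^-1]powR_inv1 ?ler0n// -powRrM; congr (_ `^ _); ring.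
  rewrite mulrC; apply: ler_wpM2r; first exact: powR_ge0.
  rewrite -[leRHS](@powRr1 _ (2 : R)) ?ler0n//; apply: ler_powR; [exact: ler1n|].
  by lra.
have qV : q^-1 / w = 4 / S by rewrite /q; field; rewrite !gt_eqF.
have hsg : h `^ (sg - 1) <= h `^ (s - 1).
  by apply: ger_powR; [rewrite h0; clear -h2; lra|clear -ssg; lra].
have I1 : `|\int[lam]_(b in `[b0, 1 - h]) f b| <= K * (M0 * 8 * (1 + K)) / S.
  apply: (le_trans ibp); rewrite -mulrA; apply: ler_wpM2l => //.
  have MwS : M0 / w * (2 * q^-1) = M0 * 8 / S.
    have -> : M0 / w * (2 * q^-1) = M0 * 2 * (q^-1 / w) by ring.
    by rewrite qV; ring.
  rewrite [leRHS](_ : _ = M0 * 8 / S + M0 * 8 / S * K); last by ring.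
  apply: lerD.
    rewrite -MwS; apply: ler_pM; rewrite ?powR_ge0 ?normr_ge0//; last exact: le_trans hs.
    apply: (le_trans (FM (1 - h) _)); first by apply/andP; split; clear -h0 h2; lra.
    by rewrite ler_piMl ?divr_ge0// ltW.
  (* Kept in the shape [1 - 1] to match [kb_wt] with H = 1. *)
  pose D' := `[1 - 1, 1 - h]%classic : set R.
  have mD' : measurable D' by exact: measurable_itv.
  have bD' : bounded_measurable (fun b => \1_D' b * (1 - b)^-1).
    apply: (@bm_indic_mul _ _ _ _ _ h^-1) => //.
      by apply: measurable_funV; exact: measurable_funB.
    move=> b; rewrite /D' /= in_itv/= => /andP[_ bh].
    have b1 : h <= 1 - b by clear -bh; lra.
    have b2 : 0 < 1 - b := lt_le_trans h0 b1.
    by rewrite ger0_norm ?invr_ge0 ?(ltW b2)//; rewrite lef_pV2.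
  have hle1 : h <= 1 by clear -h2; lra.
  have wt := kb_wt kb h0 hle1 (lexx 1).
  rewrite powR1 mulr1 in wt.
  have GD b : D1 b -> 0 <= `|F b| / (b * (1 - b)) <= M0 / w * (1 - b)^-1.
    rewrite /D1 /= in_itv/= => /andP[b1 b2].
    have bp : 0 < b by exact: lt_le_trans b1.
    have b1p : 0 < 1 - b by clear -b2 h0; lra.
    apply/andP; split; first by apply: divr_ge0 => //; apply: mulr_ge0; exact: ltW.
    rewrite invfM mulrA; apply: ler_wpM2r; first by rewrite invr_ge0 ltW.
    by rewrite ler_pdivrMr// mulrC; apply: FM; apply/andP; split; clear -bp b1p; lra.
  have bD1 : bounded_measurable (fun b => \1_D1 b * (`|F b| / (b * (1 - b)))).
    apply: (@bm_indic_mul _ _ _ _ _ (M0 / w * h^-1)) => //.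
      apply: measurable_funM.
        apply: measurableT_comp => //.
        exact: continuous_measurable_fun (is_derive_continuous F1).
      by apply: measurable_funV; apply: measurable_funM => //; exact: measurable_funB.
    move=> b Db; have /andP[g0 g1] := GD b Db; rewrite ger0_norm// (le_trans g1)//.
    apply: ler_wpM2l; first by rewrite divr_ge0// ltW.
    move: Db; rewrite /D1 /= in_itv/= => /andP[_ b2].
    by rewrite lef_pV2 ?posrE//; clear -b2 h0; lra.
  rewrite bm_int_mkcond.
  apply: (@le_trans _ _ (\int[lam]_b (M0 / w * (\1_D' b * (1 - b)^-1)))).
    apply: bm_le => // [|b]; first exact: bmM (bm_cst _ _) bD'.
    rewrite !indicE; have [/set_mem Db|_] := boolP (b \in D1); last first.
      rewrite mul0r; apply: mulr_ge0; first by rewrite divr_ge0// ltW.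
      have [/set_mem|_] := boolP (b \in D'); last by rewrite mul0r.
      by rewrite /D' /= in_itv/= mul1r invr_ge0 => /andP[_ b2]; clear -b2 h0; lra.
    have /andP[_ g1] := GD b Db.
    rewrite mul1r (mem_set (A := D')) ?mul1r//.
    by move: Db; rewrite /D1 /D' /= !in_itv/= => /andP[b1 ->]; rewrite andbT; clear -b1 b00; lra.
  rewrite bm_intZ// -bm_int_mkcond.
  rewrite [leRHS](_ : _ = M0 / w * (K * (2 * q^-1))); last by rewrite -MwS; ring.
  apply: ler_wpM2l; first by rewrite divr_ge0// ltW.
  by apply: (le_trans wt); apply: ler_wpM2l.
have I2 : `|\int[lam]_b (\1_D1 b * (phi (b * w) / w))| <= 4 * M0 / S.
  apply: bm_int_bound.
    by apply: bmM; [exact: bm_indic|apply: bmM; [exact: bm_mulr|exact: bm_cst]].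
  move=> b; apply: (@le_trans _ _ (M0 / w)).
    rewrite indicE; case: (_ \in _); last first.
      by rewrite mul0r normr0 divr_ge0// ltW.
    rewrite mul1r normrM normfV (gtr0_norm w0); apply: ler_wpM2r; last exact: pM.
    by rewrite invr_ge0 ltW.
  rewrite (mulrC 4) -mulrA; apply: ler_wpM2l => //.
  by rewrite ler_pdivlMr// mulrC ler_pdivrMr//; clear -wS; lra.
pose B := M1 * S `^ (- kap) * w `^ (kap - 1).
have B0 : 0 <= B by rewrite mulr_ge0 ?powR_ge0// mulr_ge0 ?powR_ge0.
have dB b : 0 <= b <= 1 -> `|b * dphi (b * w)| <= B.
  move=> /andP[bb0 bb1]; rewrite normrM (ger0_norm bb0).
  have [->|bn] := eqVneq b 0; first by rewrite mul0r.
  have bp : 0 < b by rewrite lt_neqAle eq_sym bn.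
  apply: (@le_trans _ _ (1 * `|dphi (b * w)|)); first by apply: ler_wpM2r.
  rewrite mul1r (le_trans (dM _ _)) ?mulr_gt0//; apply: ler_wpM2l.
    by rewrite mulr_ge0 ?powR_ge0.
  apply: ge0_ler_powR; rewrite ?nnegrE ?subr_ge0 ?mulr_ge0 ?(ltW w0)//.
  by rewrite ler_piMl// ltW.
have bdm (D : set R) : measurable D -> D `<=` `[0, 1]%classic ->
    bounded_measurable (fun b => \1_D b * (b * dphi (b * w))).
  move=> mD D01; apply: (@bm_indic_mul _ _ _ _ _ B) => //.
    by apply: measurable_funM => //; exact: continuous_measurable_fun.
  by move=> b /D01; rewrite /= in_itv/=; exact: dB.
have D101 : D1 `<=` `[0, 1]%classic.
  by move=> b; rewrite /D1 /= !in_itv/= => /andP[b1 b2]; apply/andP; split; clear -b1 b2 b00 h0 h2; lra.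
have D201 : D2 `<=` `[0, 1]%classic.
  by move=> b; rewrite /D2 /= !in_itv/= => /andP[b1 b2]; apply/andP; split; clear -b1 b2 b00 h0 h2; lra.
have I3 : `|\int[lam]_b (\1_D2 b * (b * dphi (b * w)))| <= M1 * K / S.
  apply: (@le_trans _ _ (\int[lam]_b (B * \1_(`[1 - h, 1]%classic) b))).
    apply: bm_abs_le; first exact: bdm.
      by apply: bmM; [exact: bm_cst|exact: bm_indic].
    move=> b; rewrite !indicE; have [/set_mem Db|_] := boolP (b \in D2); last first.
      by rewrite mul0r normr0 mulr_ge0.
    rewrite (mem_set (A := `[1 - h, 1]%classic)) ?mulr1 ?mul1r.
      by apply: dB; have := D201 _ Db; rewrite /= in_itv.
    by move: Db; rewrite /D2 /= !in_itv/= => /andP[/ltW -> ->].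
  rewrite bm_intZ; last exact: bm_indic.
  rewrite prob_indic//.
  have h01 : 0 < h <= 1 by rewrite h0; clear -h2; lra.
  have up := kb_up kb h01.
  have hsq : h `^ sg <= (q `^ kap) `^ s.
    apply: (@le_trans _ _ (h `^ s)); first exact: ger_powR.
    apply: ge0_ler_powR; rewrite ?nnegrE ?(ltW h0) ?(ltW s0) ?powR_ge0//.
    by rewrite /h; clear -qk0; lra.
  apply: (@le_trans _ _ (B * (K * (q `^ kap) `^ s))).
    by apply: ler_wpM2l => //; apply: (le_trans up); apply: ler_wpM2l.
  have q4 : (q `^ kap) `^ s <= (S / w) `^ (kap - 1).
    rewrite -powRrM (_ : kap * s = kap - 1); last first.
      by rewrite -[X in _ - X]kaps; ring.
    apply: ge0_ler_powR; rewrite ?nnegrE ?subr_ge0 ?(ltW q0) ?divr_ge0 ?(ltW S0) ?(ltW w0)//.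
    rewrite /q [leRHS](_ : _ = 4 * (S / (4 * w))); last by clear -w0; field; rewrite gt_eqF.
    by rewrite ler_peMl ?ler1n// divr_ge0 ?mulr_ge0 ?(ltW S0) ?(ltW w0).
  apply: (@le_trans _ _ (B * (K * (S / w) `^ (kap - 1)))).
    by apply: ler_wpM2l => //; apply: ler_wpM2l.
  have -> : (S / w) `^ (kap - 1) = S `^ (kap - 1) / w `^ (kap - 1).
    by rewrite powRM ?invr_ge0 ?(ltW S0) ?(ltW w0)// -[w^-1]powR_inv1 ?(ltW w0)// -powRrM mulN1r powRN.
  have -> : S^-1 = S `^ (- kap) * S `^ (kap - 1).
    rewrite -powRD ?(gt_eqF S0) ?implybT// (_ : _ + _ = -1) ?powR_inv1 ?(ltW S0)//.
    by ring.
  rewrite /B le_eqVlt; apply/orP; left; apply/eqP; field.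
  by rewrite gt_eqF// powR_gt0.
have -> : \int[lam]_(b in `[0, 1]) (b * dphi (b * w)) =
    \int[lam]_(b in `[b0, 1 - h]) f b -
    \int[lam]_b (\1_D1 b * (phi (b * w) / w)) +
    \int[lam]_b (\1_D2 b * (b * dphi (b * w))).
  have b1 : bounded_measurable (fun b => \1_D1 b * (phi (b * w) / w)).
    by apply: bmM; [exact: bm_indic|apply: bmM; [exact: bm_mulr|exact: bm_cst]].
  rewrite (bm_int_mkcond lam `[0, 1]%classic) (bm_int_mkcond lam D1).
  have -> : \int[lam]_b (\1_D1 b * f b) = \int[lam]_b (\1_D1 b * (phi (b * w) / w)) +
      \int[lam]_b (\1_D1 b * (b * dphi (b * w))).
    rewrite -bm_intD//; last exact: bdm.
    by apply: eq_Rintegral => b _; rewrite -mulrDr.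
  rewrite [X in _ = X + _]addrAC subrr add0r -bm_intD; [|exact: bdm..].
  apply: eq_Rintegral => b _; rewrite -mulrDl.
  have [bb|bb] := leP b b0.
    by have [_ ->] := phi0 b (bw0 b bb); rewrite !mulr0.
  congr (_ * _); rewrite !indicE.
  have -> : (b \in `[0, 1]%classic) = (b <= 1).
    by rewrite mem_setE in_itv/= ltW// (lt_trans b00).
  have -> : (b \in D1) = (b <= 1 - h) by rewrite /D1 mem_setE in_itv/= ltW.
  have -> : (b \in D2) = (1 - h < b) && (b <= 1) by rewrite /D2 mem_setE in_itv.
  have [bh|bh] := leP b (1 - h); last by rewrite add0r.
  by rewrite addr0 (le_trans bh)// ltW.
rewrite [C / S](_ : _ = K * (M0 * 8 * (1 + K)) / S + 4 * M0 / S + M1 * K / S); last first.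
  by rewrite /C; ring.
by rewrite (le_trans (ler_normD _ _))// lerD// (le_trans (ler_normB _ _))// lerD.
Qed.

(** The bound M2 only justifies differentiation under the integral and does not enter C; the
    quantitative input is the growth condition in t. *)
Lemma kernel_lipschitz (lam : probability R R) (sg s K M0 M1 : R) :
  kernel_bounds lam sg s K -> 0 <= M0 -> 0 <= M1 ->
  exists C : R, 0 <= C /\ forall (phi dphi : R -> R) (S M2 : R),
  0 < S <= 1 ->
  (forall t : R, is_derive t 1 phi (dphi t)) -> continuous dphi ->
  (forall t, `|phi t| <= M0) -> (forall t, `|dphi t| <= M2) ->
  (forall t, 0 < t ->
    `|dphi t| <= M1 * S `^ (- (1 - s)^-1) * t `^ ((1 - s)^-1 - 1)) ->
  (forall t, t <= S / 4 -> phi t = 0 /\ dphi t = 0) ->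
  forall u v, 0 <= u <= 1 -> 0 <= v <= 1 ->
  `|\int[lam]_b phi (b * u) - \int[lam]_b phi (b * v)| <= C / S * `|u - v|.
Proof.
move=> kb M00 M10; have [C [C0 H]] := kernel_deriv_bound kb M00 M10.
exists C; split => // phi dphi S M2 S01 p1 cd pM d2 dM p0 u v.
wlog vu : u v / v <= u.
  move=> W u01 v01; have [vu|/ltW uv] := leP v u; first exact: W.
  by rewrite distrC (distrC u); apply: W.
move=> /andP[u0 u1] /andP[v0 v1].
have bphi : bounded_measurable phi.
  by split; [exact: continuous_measurable_fun (is_derive_continuous p1)|exists M0].
rewrite !(kernel_int01 kb); [|exact: bm_mulr..].
rewrite (ger0_norm (x := u - v)) ?subr_ge0//.
pose h (w : R) := \int[lam]_(b in `[0, 1]) phi (b * w).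
pose dh (w : R) := \int[lam]_(b in `[0, 1]) (b * dphi (b * w)).
rewrite -/(h u) -/(h v).
apply: (@MVT_bound h dh v u (C / S) vu) => [t|t /andP[vt tu]].
  exact: (kernel_derive lam t p1 cd pM d2).
apply: (H phi dphi S t) => //; apply/andP; split; first exact: le_lt_trans vt.
by rewrite (le_trans (ltW tu)).
Qed.

End kernel_lipschitz.

(** * Primitives and one-sided mollification *)

Section antiderivative.
Variable R : realType.

(** Vanishing on the negative half-line makes the integral from -oo converge, and is inherited by
    the primitive, so the construction can be iterated. *)
Lemma antiderivative (f : R -> R) : continuous f ->
  (forall t, t <= 0 -> f t = 0) ->
  exists F : R -> R, (forall t : R, is_derive t 1 F (f t)) /\
    forall t, t <= 0 -> F t = 0.
Proof.
move=> cf f0; pose F (x : R) := \int[@lebesgue_measure R]_(t in `]-oo, x]) f t.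
have intf (y : R) : (@lebesgue_measure R).-integrable `]-oo, y] (EFin \o f).
  have h : (@lebesgue_measure R).-integrable (`]-oo, y] `&` `[0, `|y|]) (EFin \o f).
    have : (@lebesgue_measure R).-integrable `[0, `|y|] (EFin \o f).
      apply: continuous_compact_integrable; first exact: segment_compact.
      exact: continuous_subspaceT.
    apply: integrableS => //; exact: measurableI.
  have h' := (integrable_restrict (@lebesgue_measure R) (measurable_itv `[0, `|y|])
    (measurable_itv `]-oo, y]) (EFin \o f)).1 h.
  apply: eq_integrable h' => // x; rewrite inE/= in_itv/= => xy.
  rewrite patchE; case: ifPn => // /negP; rewrite inE/= in_itv/= => n.
  rewrite f0//; rewrite leNgt; apply/negP => x0; apply: n.
  by rewrite ltW//= (le_trans xy)// ler_norm.
exists F; split => [t|t t0].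
  have tu : t < t + 1 by rewrite ltrDl.
  have [] := @continuous_FTC1 R f -oo%O t (t + 1) tu (intf _) _ (cf t).
    by rewrite ltNyr.
  move=> d1 d2; apply: DeriveDef; first exact: d1.
  by rewrite -derive1E; exact: d2.
transitivity (\int[@lebesgue_measure R]_(x in `]-oo, t]) (0 : R)).
  by apply: eq_Rintegral => x; rewrite inE/= in_itv/= => xt; rewrite f0// (le_trans xt).
by rewrite Rintegral_cst ?mul0r//; exact: measurable_itv.
Qed.

(** The function [qe] is the average of q over [t, t+e], a difference quotient of a primitive Q; the
    primitive of q - qe is Q minus its own average over the same window, hence at most e. The window
    is one-sided, so supports grow only to the left. *)
Lemma mollify (q : R -> R) (p1 p2 e : R) : continuous q -> 0 < e -> e < p1 ->
  (forall t, 0 <= q t <= 1) -> (forall t, t < p1 \/ p2 < t -> q t = 0) ->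
  exists qe dqe psi : R -> R,
  [/\ forall t : R, is_derive t 1 qe (dqe t), continuous dqe,
      forall t, 0 <= qe t <= 1, forall t, `|dqe t| <= e^-1 &
      forall t, t + e < p1 \/ p2 < t -> qe t = 0 /\ dqe t = 0] /\
  [/\ forall t : R, is_derive t 1 psi (q t - qe t), forall t, `|psi t| <= e &
      forall t, t + e < p1 \/ p2 < t -> psi t = 0].
Proof.
move=> cq e0 ep q01 qs.
have qm t : t <= 0 -> q t = 0.
  by move=> t0; apply: qs; left; rewrite (le_lt_trans t0)// (lt_trans e0).
have [Q [Q1 Q0]] := antiderivative cq qm.
have cQ := is_derive_continuous Q1.
have [QQ [QQ1 _]] := antiderivative cQ Q0.
have shift (f df : R -> R) (t : R) : (forall t : R, is_derive t 1 f (df t)) ->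
    is_derive t 1 (fun t : R => f (t + e)) (df (t + e)).
  move=> f1; have h : is_derive t 1 (fun t : R => t + e) 1.
    have := is_derive_add (is_derive_id t 1) (is_derive_cst e t 1).
    by rewrite addr0.
  have := @is_derive1_comp R f (fun t : R => t + e) t _ _ (f1 _) h.
  by rewrite mulr1.
have mvt (f df : R -> R) (u v : R) : u < v -> (forall t : R, is_derive t 1 f (df t)) ->
    exists2 c, u < c < v & f v - f u = df c * (v - u).
  move=> uv f1; have cf : {within `[u, v], continuous f}.
    by apply: continuous_subspaceT; exact: is_derive_continuous f1.
  by have [c] := MVT uv (fun x _ => f1 x) cf; rewrite in_itv/= => ? ?; exists c.
have te t : t < t + e by rewrite ltrDl.
have qeE t : exists2 c, t < c < t + e & (Q (t + e) - Q t) / e = q c.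
  have [c ct E] := mvt Q q _ _ (te t) Q1; exists c => //.
  by rewrite E (_ : t + e - t = e) ?mulfK ?gt_eqF//; ring.
have zone t c : t + e < p1 \/ p2 < t -> t <= c <= t + e -> q c = 0.
  move=> h /andP[c1 c2]; apply: qs; case: h => h; [left|right].
    exact: le_lt_trans h.
  exact: lt_le_trans c1.
exists (fun t => (Q (t + e) - Q t) / e), (fun t => (q (t + e) - q t) / e),
  (fun t => Q t - (QQ (t + e) - QQ t) / e); split; split.
- move=> t; exact: is_derive_mulr_cst e^-1
    (is_derive_add (shift Q q t Q1) (is_deriveN (Q1 t))).
- move=> t; apply: (@continuousM _ _ (fun t : R => q (t + e) - q t) (fun=> e^-1)).
    apply: (@continuousB _ _ _ (fun t : R => q (t + e))); last exact: cq.
    apply: (@continuous_comp _ _ _ (fun t : R => t + e) q); last exact: cq.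
    by apply: cvgD; [exact: cvg_id|exact: cvg_cst].
  exact: cst_continuous.
- by move=> t; have [c _ ->] := qeE t.
- move=> t; rewrite normrM normfV (gtr0_norm e0) ler_piMl ?invr_ge0 ?(ltW e0)//.
  have /andP[a1 a2] := q01 t; have /andP[b1 b2] := q01 (t + e).
  by rewrite ler_norml; apply/andP; split; lra.
- move=> t h; have [c /andP[c1 c2] ->] := qeE t; split.
    by apply: (zone t) => //; rewrite !ltW.
  by rewrite !(zone t) ?subrr ?mul0r// ?lexx ?(ltW (te t)).
- move=> t; exact: is_derive_add (Q1 t) (is_deriveN (is_derive_mulr_cst e^-1
    (is_derive_add (shift QQ Q t QQ1) (is_deriveN (QQ1 t))))).
(* The average of Q is a value Q c with c in the window, and Q has slope between 0 and 1. *)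
- move=> t; have [c /andP[c1 c2] E] := mvt QQ Q _ _ (te t) QQ1.
  have -> : (QQ (t + e) - QQ t) / e = Q c.
    by rewrite E (_ : t + e - t = e) ?mulfK ?gt_eqF//; ring.
  have [c' _ E'] := mvt Q q _ _ c1 Q1.
  rewrite distrC E' normrM (gtr0_norm (x := c - t)) ?subr_gt0//.
  have /andP[a1 a2] := q01 c'; rewrite ger0_norm//.
  apply: (@le_trans _ _ (1 * (c - t))).
    by apply: ler_wpM2r => //; rewrite subr_ge0 ltW.
  by rewrite mul1r lerBlDl ltW.
- move=> t h; have [c /andP[c1 c2] E] := mvt QQ Q _ _ (te t) QQ1.
  have -> : (QQ (t + e) - QQ t) / e = Q c.
    by rewrite E (_ : t + e - t = e) ?mulfK ?gt_eqF//; ring.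
  have [c' /andP[d1 d2] E'] := mvt Q q _ _ c1 Q1.
  apply/eqP; rewrite -oppr_eq0 opprB E' (zone t) ?mul0r//.
  by rewrite ltW//= ltW// (lt_trans d2).
Qed.

End antiderivative.

Lemma bm_dominated_cvg d (T : measurableType d) (R : realType)
    (P : probability T R) (f_ : nat -> T -> R) (f : T -> R) (M : R) :
  (forall n, measurable_fun [set: T] (f_ n)) ->
  (forall n x, `|f_ n x| <= M) -> (forall x, f_ n x @[n --> \oo] --> f x) ->
  \int[P]_x f_ n x @[n --> \oo] --> \int[P]_x f x.
Proof.
move=> mf fM cf.
have mf' : measurable_fun [set: T] f.
  by apply: (measurable_fun_cvg (h := f_)) => // x _; exact: cf.
have fM' x : `|f x| <= M.
  rewrite leNgt; apply/negP => h.
  have c : (fun n => `|f_ n x|) @ \oo --> `|f x| by apply: cvg_norm; exact: cf.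
  have := @cvgr_gt _ _ _ _ _ _ c _ h => /(_ _) [N _ /(_ N (leqnn N))/=].
  by rewrite ltNge fM.
have mfe n : measurable_fun [set: T] (fun x => (f_ n x)%:E).
  by apply/measurable_EFinP; exact: mf.
have mfe' : measurable_fun [set: T] (fun x => (f x)%:E).
  by apply/measurable_EFinP; exact: mf'.
have h1 : {ae P, forall x, setT x -> (f_ n x)%:E @[n --> \oo] --> (f x)%:E}.
  by apply: aeW => x _; apply: cvg_EFin; [exact: nearW|exact: cf].
have h2 : P.-integrable setT (fun=> M%:E).
  exact: (bm_integrable P measurableT (bm_cst T M)).
have h3 : {ae P, forall x n, setT x -> (`|(f_ n x)%:E| <= M%:E)%E}.
  by apply: aeW => x n _; rewrite lee_fin.
have [_ _ h] := dominated_convergence measurableT mfe mfe' h1 h2 h3.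
apply: fine_cvg; rewrite /Rintegral fineK; first exact: h.
apply: (integrable_fin_num measurableT).
by apply: (bm_integrable P measurableT); split => //; exists M.
Qed.

(** * Approximation of Borel sets by continuous functions *)

Section continuous_approximation.
Variable R : realType.
Implicit Types nu : probability R R.

Definition clamp (v : R) : R := Num.max 0 (Num.min 1 v).

Lemma clamp01 v : 0 <= clamp v <= 1.
Proof.
rewrite /clamp; case: (leP 1 v) => h; first by rewrite max_r ?ler01 ?lexx.
by case: (leP 0 v) => h'; rewrite ?lexx ?ler01 ?h' ?(ltW h).
Qed.

Lemma clamp_le0 v : v <= 0 -> clamp v = 0.
Proof. by move=> v0; rewrite /clamp min_r ?max_l// (le_trans v0). Qed.

Lemma clamp_ge1 v : 1 <= v -> clamp v = 1.
Proof. by move=> v1; rewrite /clamp min_l// max_r. Qed.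

Lemma clamp_le u v : u <= v -> clamp u <= clamp v.
Proof.
move=> uv; have [v0|v0] := leP v 0; first by rewrite !clamp_le0// (le_trans uv).
have [v1|v1] := leP 1 v; first by rewrite (clamp_ge1 v1); case/andP: (clamp01 u).
have [u0|u0] := leP u 0; first by rewrite (clamp_le0 u0); case/andP: (clamp01 v).
rewrite /clamp !min_r ?(ltW v1) ?(le_trans uv (ltW v1))//.
by rewrite !max_r ?(ltW u0) ?(ltW v0).
Qed.

Lemma clamp_lip u v : `|clamp u - clamp v| <= `|u - v|.
Proof.
wlog uv : u v / u <= v.
  move=> W; have [uv|/ltW uv] := leP u v; first exact: W.
  by rewrite distrC (distrC u); apply: W.
have c := clamp_le uv.
rewrite distrC (distrC u) !ger0_norm ?subr_ge0//.
have [v0|v0] := leP v 0.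
  by rewrite !clamp_le0// ?subrr ?subr_ge0// (le_trans uv).
have cv : clamp v <= v.
  by rewrite /clamp ge_max (ltW v0)/= ge_min lexx orbT.
have [u1|u1] := leP 1 u.
  by rewrite !clamp_ge1// ?subrr ?subr_ge0// (le_trans u1).
have cu : u <= clamp u.
  by rewrite /clamp le_max le_min lexx (ltW u1) orbT.
by rewrite lerB.
Qed.

Lemma continuous_clamp : continuous clamp.
Proof.
move=> x; apply/cvgrPdist_lt => e e0; near=> t.
rewrite (le_lt_trans (clamp_lip _ _))//; near: t.
Unshelve. all: by end_near. Qed.

(** One function must serve both laws, because it will be used to compare them. *)
Definition approximable nu nu' (A : set R) := forall eps : R, 0 < eps ->
  exists phi : R -> R, [/\ continuous phi, forall t, 0 <= phi t <= 1,
    \int[nu]_x `|phi x - \1_A x| <= eps & \int[nu']_x `|phi x - \1_A x| <= eps].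

Lemma continuous01_bm (phi : R -> R) : continuous phi ->
  (forall t, 0 <= phi t <= 1) -> bounded_measurable phi.
Proof.
move=> c h; split; first exact: continuous_measurable_fun.
by exists 1 => x; have /andP[a b] := h x; rewrite ger0_norm.
Qed.

Lemma approximableC nu nu' A : approximable nu nu' A -> approximable nu nu' (~` A).
Proof.
move=> h eps e0; have [phi [c b i1 i2]] := h eps e0.
have E x : `|1 - phi x - \1_(~` A) x| = `|phi x - \1_A x|.
  rewrite !indicE in_setC distrC; congr `|_|; case: (x \in A) => /=.
    by rewrite mulr0n mulr1n; ring.
  by rewrite mulr0n mulr1n; ring.
exists (fun t => 1 - phi t); split.
- move=> t; apply: (@continuousB _ _ _ (fun _ : R => 1 : R) phi); [exact: cst_continuous|exact: c].
- by move=> t; have /andP[a1 a2] := b t; rewrite subr_ge0 a2 lerBlDr lerDl.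
- by under eq_Rintegral do rewrite E.
- by under eq_Rintegral do rewrite E.
Qed.

Lemma approximableU nu nu' A B : measurable A -> measurable B ->
  approximable nu nu' A -> approximable nu nu' B -> approximable nu nu' (A `|` B).
Proof.
move=> mA mB hA hB eps e0; have e2 : 0 < eps / 2 by rewrite divr_gt0.
have [f [cf f01 f1 f2]] := hA _ e2; have [g [cg g01 g1 g2]] := hB _ e2.
have bf := continuous01_bm cf f01; have bg := continuous01_bm cg g01.
(* That is 1 - (1-f)(1-g), which has values in [0,1] and equals the indicator of a union when f and
   g are indicators. *)
pose k x := f x + g x - f x * g x.
have k01 x : 0 <= k x <= 1.
  have /andP[a1 a2] := f01 x; have /andP[b1 b2] := g01 x.
  have -> : k x = 1 - (1 - f x) * (1 - g x) by rewrite /k; ring.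
  have h : 0 <= (1 - f x) * (1 - g x) by rewrite mulr_ge0 ?subr_ge0.
  have h' : (1 - f x) * (1 - g x) <= 1 by rewrite mulr_ile1 ?subr_ge0// lerBlDr lerDl.
  by rewrite subr_ge0 h' lerBlDr lerDl.
have ck : continuous k.
  move=> x; apply: (@continuousB _ _ _ (fun x : R => f x + g x) (fun x : R => f x * g x)).
    by apply: continuousD; [exact: cf|exact: cg].
  by apply: continuousM; [exact: cf|exact: cg].
have bA := bm_norm (bmB bf (bm_indic R mA)).
have bB := bm_norm (bmB bg (bm_indic R mB)).
have kAB x : `|k x - \1_(A `|` B) x| <= `|f x - \1_A x| + `|g x - \1_B x|.
  have /andP[a1 a2] := f01 x; have /andP[b1 b2] := g01 x.
  have kE : k x = 1 - (1 - f x) * (1 - g x) by rewrite /k; ring.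
  have n0 (p : R) : 0 <= p -> `|p - 0| = p by move=> p0; rewrite subr0 ger0_norm.
  have n1 (p : R) : p <= 1 -> `|p - 1| = 1 - p.
    by move=> p1; rewrite distrC ger0_norm// subr_ge0.
  have /andP[k0 k1] := k01 x; have fg : 0 <= f x * g x by rewrite mulr_ge0.
  have fg1 : f x * g x <= f x by rewrite ler_piMr.
  have fg2 : f x * g x <= g x by rewrite ler_piMl.
  rewrite !indicE in_setU; case: (x \in A); case: (x \in B);
    rewrite /= ?mulr1n ?mulr0n !(n0, n1)// /k; lra.
have bk := bm_norm (bmB (continuous01_bm ck k01) (bm_indic R (measurableU _ _ mA mB))).
have E (P : probability R R) : \int[P]_x `|f x - \1_A x| <= eps / 2 ->
    \int[P]_x `|g x - \1_B x| <= eps / 2 -> \int[P]_x `|k x - \1_(A `|` B) x| <= eps.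
  move=> p1 p2; apply: (@le_trans _ _ (\int[P]_x (`|f x - \1_A x| + `|g x - \1_B x|))).
    by apply: bm_le => //; exact: bmD.
  by rewrite bm_intD// [eps]splitr lerD.
by exists k; split => //; exact: E.
Qed.

(** The rising ramp starts at a and the falling ramp starts at b, so the limit is the half-open
    indicator at the endpoints too, and atoms do no harm. *)
Lemma approximable_itv nu nu' (a b : R) : approximable nu nu' `]a, b]%classic.
Proof.
pose f n (x : R) := clamp (n%:R * (x - a)) * clamp (1 + n%:R * (b - x)).
have cf n : continuous (f n).
  move=> x; apply: (@continuousM _ _ (fun x : R => clamp (n%:R * (x - a)))).
    apply: (@continuous_comp _ _ _ (fun x : R => n%:R * (x - a)) clamp); last exact: continuous_clamp.
    by apply: cvgM; [exact: cvg_cst|apply: cvgB; [exact: cvg_id|exact: cvg_cst]].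
  apply: (@continuous_comp _ _ _ (fun x : R => 1 + n%:R * (b - x)) clamp); last exact: continuous_clamp.
  apply: cvgD; first exact: cvg_cst.
  by apply: cvgM; [exact: cvg_cst|apply: cvgB; [exact: cvg_cst|exact: cvg_id]].
have f01 n t : 0 <= f n t <= 1.
  have /andP[a1 a2] := clamp01 (n%:R * (t - a)).
  have /andP[b1 b2] := clamp01 (1 + n%:R * (b - t)).
  by rewrite /f mulr_ge0// mulr_ile1.
have mI : measurable (`]a, b]%classic : set R) by exact: measurable_itv.
pose g n x := `|f n x - \1_(`]a, b]%classic) x|.
have bg n : bounded_measurable (g n).
  by apply: bm_norm; apply: bmB; [exact: continuous01_bm|exact: bm_indic].
have big (e M : R) : 0 < e -> exists N, forall n, (N <= n)%N -> M <= n%:R * e.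
  move=> e0; exists (Num.bound `|M / e|) => n Nn.
  rewrite -ler_pdivrMr// (le_trans (ler_norm _))//.
  by rewrite (le_trans (ltW (archi_boundP (normr_ge0 (M / e)))))// ler_nat.
have cg x : g n x @[n --> \oo] --> 0.
  suff [N h] : exists N, forall n, (N <= n)%N -> g n x = 0.
    apply: (@cvg_near_cst _ _ _ _ _ _ _); exists N => // n /= Nn; exact: h.
  rewrite /g indicE mem_setE in_itv/=; have [ax|ax] := ltP a x; last first.
    exists 0%N => n _; rewrite /f clamp_le0 ?mul0r ?subrr ?normr0//.
    by rewrite mulr_ge0_le0// subr_le0.
  have xa : 0 < x - a by rewrite subr_gt0.
  have [N hN] := big _ 1 xa.
  have [xb|xb] := leP x b.
    exists N => n Nn; rewrite /f !clamp_ge1 ?hN// ?mulr1 ?subrr ?normr0//.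
    by rewrite lerDl mulr_ge0// subr_ge0.
  have bx : 0 < x - b by rewrite subr_gt0.
  have [N' hN'] := big _ 1 bx.
  exists N' => n Nn; rewrite /f (clamp_le0 (v := 1 + _)) ?mulr0 ?subrr ?normr0//.
  by rewrite -[b - x]opprB mulrN subr_le0 hN'.
have gM n x : `|g n x| <= 1.
  have /andP[f0 f1] := f01 n x.
  rewrite /g normr_id indicE; case: (_ \in _) => /=.
    by rewrite distrC ger0_norm ?subr_ge0// lerBlDr lerDl.
  by rewrite subr0 ger0_norm.
have lim (P : probability R R) : \int[P]_x g n x @[n --> \oo] --> 0.
  have := @bm_dominated_cvg _ _ R P g (fun=> 0) 1 (fun n => (bg n).1) gM cg.
  by rewrite prob_intc.
move=> eps e0.
have [N _ hN] := @cvgr_dist_lt _ _ _ _ _ _ _ (lim nu) _ e0.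
have [N' _ hN'] := @cvgr_dist_lt _ _ _ _ _ _ _ (lim nu') _ e0.
exists (f (maxn N N')); split => //.
- have := hN (maxn N N') (leq_maxl _ _); rewrite /= sub0r normrN => h.
  by apply: le_trans (ltW h); exact: ler_norm.
- have := hN' (maxn N N') (leq_maxr _ _); rewrite /= sub0r normrN => h.
  by apply: le_trans (ltW h); exact: ler_norm.
Qed.

Lemma approximable_bigcup nu nu' (A : nat -> set R) :
  (forall n, measurable (A n)) -> (forall n, approximable nu nu' (A n)) ->
  approximable nu nu' (\bigcup_n A n).
Proof.
move=> mA hA eps e0; have e2 : 0 < eps / 2 by rewrite divr_gt0.
pose U n := \big[setU/set0]_(i < n) A i.
have mU n : measurable (U n) by exact: bigsetU_measurable.
have hU n : approximable nu nu' (U n).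
  rewrite /U; elim: n => [|n IH].
    move=> e e00; exists (fun=> 0); split => //.
    - exact: cst_continuous.
    - by move=> _; rewrite lexx ler01.
    - by under eq_Rintegral do rewrite big_ord0 indic0 subr0 normr0; rewrite prob_intc ltW.
    - by under eq_Rintegral do rewrite big_ord0 indic0 subr0 normr0; rewrite prob_intc ltW.
  by rewrite big_ord_recr/=; apply: approximableU => //; exact: mU.
have mUA : measurable (\bigcup_n A n) by exact: bigcupT_measurable.
have lim (P : probability R R) : \int[P]_x `|\1_(U n) x - \1_(\bigcup_n A n) x : R| @[n --> \oo] --> (0 : R).
  have := @bm_dominated_cvg _ _ R P (fun n x => `|\1_(U n) x - \1_(\bigcup_n A n) x|) (fun=> 0) 1.
  rewrite prob_intc; apply.
  - by move=> n; case: (bm_norm (bmB (bm_indic R (mU n)) (bm_indic R mUA))).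
  - move=> n x; rewrite normr_id !indicE; case: (_ \in _); case: (_ \in _);
      by rewrite /= ?subrr ?subr0 ?sub0r ?normrN ?normr0 ?normr1 ?ler01.
  - move=> x; suff [N h] : exists N, forall n, (N <= n)%N ->
        `|\1_(U n) x - \1_(\bigcup_n A n) x| = 0 :> R.
      by apply: (@cvg_near_cst _ _ _ _ _ _ _); exists N => // n /= Nn; exact: h.
    have [[k _ Ak]|nx] := pselect ((\bigcup_n A n) x).
      exists k.+1 => n kn; rewrite !indicE (mem_set (A := \bigcup_n A n)); last by exists k.
      rewrite mem_set ?subrr ?normr0//.
      by rewrite /U -bigcup_mkord; exists k.
    exists 0%N => n _; rewrite !indicE (memNset nx) memNset ?subrr ?normr0//.
    by rewrite /U -bigcup_mkord => -[k _ Ak]; apply: nx; exists k.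
have [N _ hN] := @cvgr_dist_lt _ _ _ _ _ _ _ (lim nu) _ e2.
have [N' _ hN'] := @cvgr_dist_lt _ _ _ _ _ _ _ (lim nu') _ e2.
pose n := maxn N N'.
have [phi [c p01 p1 p2]] := hU n _ e2.
have bphi := continuous01_bm c p01.
have E (P : probability R R) : \int[P]_x `|phi x - \1_(U n) x| <= eps / 2 ->
    \int[P]_x `|\1_(U n) x - \1_(\bigcup_n A n) x : R| <= eps / 2 ->
    \int[P]_x `|phi x - \1_(\bigcup_n A n) x| <= eps.
  move=> h1 h2; have b1 := bm_norm (bmB bphi (bm_indic R (mU n))).
  have b2 := bm_norm (bmB (bm_indic R (mU n)) (bm_indic R mUA)).
  apply: (@le_trans _ _ (\int[P]_x (`|phi x - \1_(U n) x| + `|\1_(U n) x - \1_(\bigcup_n A n) x|))).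
    apply: bm_le; [exact: bm_norm (bmB bphi (bm_indic R mUA))|exact: bmD|].
    by move=> x; rewrite (le_trans _ (ler_normD _ _))// addrA subrK.
  by rewrite bm_intD// [eps]splitr lerD.
exists phi; split => //; apply: E => //.
- have := hN n (leq_maxl _ _); rewrite /= sub0r normrN => h.
  by apply: le_trans (ltW h); exact: ler_norm.
- have := hN' n (leq_maxr _ _); rewrite /= sub0r normrN => h.
  by apply: le_trans (ltW h); exact: ler_norm.
Qed.

Lemma measurable_approximable nu nu' (A : set R) : measurable A -> approximable nu nu' A.
Proof.
pose G : set (set R) := [set A | measurable A /\ approximable nu nu' A].
move=> mA; suff : G A by case.
apply: (smallest_sub (C := sigma_algebra setT) (G := R.-ocitv.-measurable) (X := G)); last exact: mA.
- split => [|B [mB hB]|F hF].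
  + split => //; move=> e e0; exists (fun=> 0); split => //.
    * exact: cst_continuous.
    * by move=> _; rewrite lexx ler01.
    * by under eq_Rintegral do rewrite indic0 subr0 normr0; rewrite prob_intc ltW.
    * by under eq_Rintegral do rewrite indic0 subr0 normr0; rewrite prob_intc ltW.
  + by rewrite setTD; split; [exact: measurableC|exact: approximableC].
  + split; first by apply: bigcupT_measurable => n; case: (hF n).
    by apply: approximable_bigcup => n; case: (hF n).
- move=> B [[x y] _ <-]; split; first exact: measurable_itv.
  exact: approximable_itv.
Qed.

End continuous_approximation.

(** * A grid whose mesh at t is comparable to t(1-t) *)

Section grid.
Variables (R : realType) (l : R) (N : nat).
Hypotheses (l1 : 1 < l) (l98 : l <= 9 / 8).

(** The odds g/(1-g) run through l^(i-N). The grid is therefore geometric near both ends, symmetric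
    about its value 1/2 at i = N, and starts at order S = l^(-N). *)
Definition grid (i : nat) : R := l ^+ i / (l ^+ N + l ^+ i).

Definition grid_var (i : nat) : R := grid i * (1 - grid i).

Let l0 : 0 < l. Proof. exact: lt_trans l1. Qed.
Let X0 i : 0 < l ^+ i. Proof. exact: exprn_gt0. Qed.
Let den0 i : 0 < l ^+ N + l ^+ i. Proof. by rewrite addr_gt0. Qed.
Let denN0 i : l ^+ N + l ^+ i != 0. Proof. by rewrite gt_eqF. Qed.

Lemma grid_gt0 i : 0 < grid i. Proof. by rewrite divr_gt0. Qed.

Lemma onem_grid i : 1 - grid i = l ^+ N / (l ^+ N + l ^+ i).
Proof. by rewrite /grid; field; rewrite denN0. Qed.

Lemma onem_grid_gt0 i : 0 < 1 - grid i.
Proof. by rewrite onem_grid divr_gt0. Qed.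

Lemma grid_var_gt0 i : 0 < grid_var i.
Proof. by rewrite mulr_gt0 ?grid_gt0 ?onem_grid_gt0. Qed.

Lemma grid_varE i : grid_var i = l ^+ N * l ^+ i / (l ^+ N + l ^+ i) ^+ 2.
Proof. by rewrite /grid_var onem_grid /grid; field; rewrite denN0. Qed.

Lemma grid_var_le i : grid_var i <= grid i.
Proof.
by rewrite /grid_var ler_piMr ?(ltW (grid_gt0 _))// lerBlDr lerDl ltW// grid_gt0.
Qed.

Let gapE i : grid i.+1 - grid i =
  l ^+ N * l ^+ i * (l - 1) / ((l ^+ N + l ^+ i) * (l ^+ N + l * l ^+ i)).
Proof.
by rewrite /grid exprS; field; rewrite denN0 -exprS denN0.
Qed.

Lemma grid_lt i : grid i < grid i.+1.
Proof.
rewrite -subr_gt0 gapE divr_gt0 ?mulr_gt0 ?subr_gt0//.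
by rewrite -exprS.
Qed.

Lemma grid_le i j : (i <= j)%N -> grid i <= grid j.
Proof.
move=> /subnK <-; elim: (j - i)%N => [//|k IH].
by rewrite addSn (le_trans IH)// ltW// grid_lt.
Qed.

Lemma grid_gap i : grid i.+1 - grid i <= (l - 1) * grid_var i.
Proof.
rewrite gapE grid_varE mulrA [(l - 1) * _]mulrC.
apply: ler_wpM2l; first by rewrite !mulr_ge0 ?(ltW (X0 _))// subr_ge0 ltW.
rewrite lef_pV2 ?posrE ?mulr_gt0 ?exprn_gt0// -?exprS//.
rewrite expr2; apply: ler_wpM2l; first exact: ltW.
by rewrite lerD2l exprS ler_peMl ?(ltW (X0 _))// ltW.
Qed.

Lemma grid_gap' i : grid i.+1 - grid i <= (l - 1) * grid_var i.+1.
Proof.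
rewrite gapE grid_varE exprS; set A := l ^+ N; set B := l ^+ i.
have A0 : 0 < A := X0 N; have B0 : 0 < B := X0 i.
have D0 : 0 < A + B by rewrite addr_gt0.
have D1 : 0 < A + l * B by rewrite addr_gt0// mulr_gt0.
rewrite [leRHS](_ : _ = A * B * (l - 1) * (l / (A + l * B) / (A + l * B))); last first.
  by field; rewrite gt_eqF.
apply: ler_wpM2l; first by rewrite !mulr_ge0 ?subr_ge0 ?(ltW l1) ?(ltW A0) ?(ltW B0).
rewrite invfM; apply: ler_wpM2r; first by rewrite invr_ge0 ltW.
rewrite ler_pdivlMr// mulrC ler_pdivrMr// mulrDr lerD2r.
by rewrite ler_peMl ?(ltW A0)// ltW.
Qed.

(** Leaves room for the averaging window: mollifying the piece centred at node i+2 extends its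
    support to the left by at most (l-1)/4 times the variance there, hence not beyond node i. *)
Lemma grid_var_gap i : (l - 1) * grid_var i.+2 / 4 <= grid i.+1 - grid i.
Proof.
rewrite gapE grid_varE !exprS.
set A := l ^+ N; set B := l ^+ i.
have A0 : 0 < A := X0 N; have B0 : 0 < B := X0 i.
have D0 : 0 < A + B by rewrite addr_gt0.
have D1 : 0 < A + l * B by rewrite addr_gt0// mulr_gt0.
have D2 : 0 < A + l * (l * B) by rewrite addr_gt0// mulr_gt0// mulr_gt0.
rewrite [leLHS](_ : _ = (A * B * (l - 1)) * (l * l / 4 / (A + l * (l * B)) ^+ 2)); last first.
  by field; rewrite gt_eqF.
apply: ler_wpM2l.
  by rewrite !mulr_ge0 ?subr_ge0 ?(ltW l1) ?(ltW A0) ?(ltW B0).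
have ll : l * l / 4 <= 1 by have : l * l <= 9 / 8 * (9 / 8) by [apply: ler_pM; rewrite ?(ltW l0)]; lra.
apply: (@le_trans _ _ (1 / (A + l * (l * B)) ^+ 2)).
  by apply: ler_wpM2r => //; rewrite invr_ge0 sqr_ge0.
rewrite div1r lef_pV2 ?posrE ?mulr_gt0 ?exprn_gt0// expr2.
have lB : B <= l * B by rewrite ler_peMl ?(ltW B0)// ltW.
have llB : l * B <= l * (l * B) by apply: ler_wpM2l => //; exact: ltW.
by apply: ler_pM; rewrite ?(ltW D0) ?(ltW D1)//; lra.
Qed.

Lemma grid_step i : grid i.+1 <= l * grid i.
Proof.
rewrite /grid exprS mulrA ler_wpM2l ?mulr_ge0 ?(ltW l0) ?(ltW (X0 _))//.
rewrite lef_pV2 ?posrE// -?exprS// lerD2l exprS.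
by rewrite ler_peMl ?(ltW (X0 _))// ltW.
Qed.

Let S := l ^- N.
Let S0 : 0 < S. Proof. by rewrite invr_gt0. Qed.

Lemma grid2_le : grid 2 <= 2 * S.
Proof.
rewrite /grid; apply: (@le_trans _ _ (l ^+ 2 / l ^+ N)).
  apply: ler_wpM2l; first exact: ltW.
  by rewrite lef_pV2 ?posrE// lerDl ltW.
apply: ler_wpM2r; first exact: ltW.
have : l * l <= 9 / 8 * (9 / 8) by apply: ler_pM; rewrite ?(ltW l0).
by rewrite expr2; lra.
Qed.

Lemma onem_gridN_le : 1 - grid (N + N) <= 2 * S.
Proof.
rewrite onem_grid exprD -[X in X + _]mulr1 -mulrDr invfM mulrA mulfV ?gt_eqF// mul1r.
apply: (@le_trans _ _ S); last by rewrite ler_peMl ?(ltW S0)// ler1n.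
by rewrite /S lef_pV2 ?posrE ?addr_gt0// lerDr.
Qed.

Lemma grid0_ge : S / 2 <= grid 0.
Proof.
rewrite /grid expr0 div1r /S -invfM lef_pV2 ?posrE ?mulr_gt0 ?addr_gt0//.
have : 1 <= l ^+ N by rewrite exprn_ege1// ltW.
by lra.
Qed.

(** Together with its mirror image for j >= N, this turns powers of S/(8 tau) along the grid into
    geometric series started from the two ends. *)
Lemma grid_var_low1 j : (j <= N)%N -> S / (8 * grid_var j) <= l ^- j.
Proof.
move=> jN.
have g0 : 0 < 8 * grid_var j by apply: mulr_gt0 => //; exact: grid_var_gt0.
rewrite ler_pdivrMr//.
rewrite grid_varE; set A := l ^+ N; set B := l ^+ j.
have A0 : 0 < A := X0 N; have B0 : 0 < B := X0 j.
have BA : B <= A by rewrite /A /B ler_weXn2l// ltW.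
rewrite [leRHS](_ : _ = 8 * A / (A + B) ^+ 2); last first.
  by field; rewrite !gt_eqF// addr_gt0.
rewrite ler_pdivlMr ?exprn_gt0 ?addr_gt0//.
rewrite /S -/A mulrC ler_pdivrMr//.
have : (A + B) ^+ 2 <= (A + A) ^+ 2.
  by rewrite lerXn2r ?nnegrE ?addr_ge0 ?(ltW A0) ?(ltW B0)// lerD2l.
have := mulr_gt0 A0 A0; rewrite !expr2; lra.
Qed.

Lemma grid_var_low2 j : (N <= j)%N -> (j <= N + N)%N ->
  S / (8 * grid_var j) <= l ^- (N + N - j).
Proof.
move=> Nj jN.
have g0 : 0 < 8 * grid_var j by apply: mulr_gt0 => //; exact: grid_var_gt0.
rewrite ler_pdivrMr//.
rewrite grid_varE; set A := l ^+ N; set B := l ^+ j; set D := l ^+ (N + N - j).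
have A0 : 0 < A := X0 N; have B0 : 0 < B := X0 j; have D0 : 0 < D := X0 _.
have BA : A <= B by rewrite /A /B ler_weXn2l// ltW.
have DB : D * B = A * A by rewrite /D /B -exprD subnK// exprD.
rewrite [leRHS](_ : _ = 8 * A * B / (D * (A + B) ^+ 2)); last first.
  by field; rewrite !gt_eqF// addr_gt0.
have AB0 : 0 < A + B by rewrite addr_gt0.
rewrite ler_pdivlMr ?mulr_gt0 ?exprn_gt0//.
rewrite /S -/A mulrC ler_pdivrMr//.
have h : (A + B) ^+ 2 <= (B + B) ^+ 2.
  by rewrite lerXn2r ?nnegrE ?addr_ge0 ?(ltW A0) ?(ltW B0)// lerD2r.
apply: (@le_trans _ _ (D * (B + B) ^+ 2)); first by apply: ler_wpM2l => //; exact: ltW.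
rewrite [leLHS](_ : _ = 4 * (D * B) * B); last by ring.
rewrite DB [leRHS](_ : _ = 8 * (A * A) * B); last by ring.
apply: ler_wpM2r; first exact: ltW.
by have := mulr_gt0 A0 A0; lra.
Qed.

End grid.

(** * Edge regions and a partition of unity on the grid *)

Section partition.
Variable R : realType.

(** Neighbourhoods of both ends of [0,1] in a single set, which also contains everything outside
    [0,1]. *)
Definition edge (rho : R) : R -> R := \1_([set t : R | t * (1 - t) <= rho]).

Lemma bm_edge rho : bounded_measurable (edge rho).
Proof.
apply: bm_indic; rewrite (_ : mkset _ = (fun t : R => t * (1 - t)) @^-1` `]-oo, rho]%classic).
  rewrite -[X in measurable X]setTI; apply: measurable_funM => //.
  exact: measurable_funB.
by apply/seteqP; split => t /=; rewrite in_itv.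
Qed.

Lemma edge_in rho t : t * (1 - t) <= rho -> edge rho t = 1.
Proof. by move=> h; rewrite /edge indicE mem_set. Qed.

Lemma edge_eq0 rho t : rho < t * (1 - t) -> edge rho t = 0.
Proof.
by move=> h; rewrite /edge indicE memNset//= => h'; move: h; rewrite ltNge h'.
Qed.

Lemma edge_ge0 rho t : 0 <= edge rho t.
Proof. by rewrite /edge indicE. Qed.

(** Moving by at most y(1-y)/4 at most doubles t(1-t), so ball masses at every grid scale are
    controlled by edge masses. The generous factor 8 is the one for which 8 tau >= S along the
    grid. *)
Lemma ind_ball_edge (y tau r : R) t : tau = y * (1 - y) -> 0 < y < 1 ->
  r <= tau / 4 -> ind_ball y r t <= edge (8 * tau) t.
Proof.
move=> tE /andP[y0 y1] r4; have [h|h] := leP `|t - y| r; last first.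
  by rewrite ind_ball_eq0// edge_ge0.
rewrite ind_ball_in// edge_in//.
have t0 : 0 < tau by rewrite tE mulr_gt0// subr_gt0.
have := le_trans h r4; rewrite ler_distl => /andP[h1 h2].
have hy : tau <= y by rewrite tE; apply: ler_piMr; lra.
have hy' : tau <= 1 - y by rewrite tE; apply: ler_piMl; lra.
have t1 : t * (1 - t) = tau + (t - y) * (1 - 2 * y) - (t - y) ^+ 2.
  by rewrite tE expr2; ring.
rewrite t1; have := sqr_ge0 (t - y).
have : (t - y) * (1 - 2 * y) <= tau by nra.
by lra.
Qed.

Lemma sum_pow_le (x : R) n : 0 <= x -> x < 1 ->
  \sum_(i < n) x ^+ i <= (1 - x)^-1.
Proof.
move=> x0 x1; have h : 0 < 1 - x by rewrite subr_gt0.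
rewrite -[leRHS]div1r ler_pdivlMr// mulrC.
have -> : (1 - x) * \sum_(i < n) x ^+ i = 1 - x ^+ n.
  elim: n => [|n IH]; first by rewrite big_ord0 mulr0 expr0 subrr.
  by rewrite big_ord_recr/= mulrDr IH exprS; ring.
by rewrite lerBlDr lerDl exprn_ge0.
Qed.

(** The sum telescopes with step 4. For H i the indicator of g i <= t, it says that at most four of
    the intervals from g i to g (i+4) contain t. *)
Lemma sum_overlap (H : nat -> R) n : (forall i, 0 <= H i <= 1) ->
  \sum_(i < n) (H i - H i.+4) <= 4.
Proof.
move=> H01; have -> : \sum_(i < n) (H i - H i.+4) =
    H 0 + H 1 + H 2 + H 3 - (H n + H n.+1 + H n.+2 + H n.+3).
  elim: n => [|n IH]; first by rewrite big_ord0 subrr.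
  by rewrite big_ord_recr/= IH; ring.
have := (H01 0, H01 1, H01 2, H01 3, H01 n, H01 n.+1, H01 n.+2, H01 n.+3).
move=> [[[[[[[/andP[? ?] /andP[? ?]] /andP[? ?]] /andP[? ?]] /andP[? ?]]
   /andP[? ?]] /andP[? ?]] /andP[? ?]].
by lra.
Qed.

Lemma is_derive_bigsum (I : Type) (s : seq I) (f df : I -> R -> R) (t : R) :
  (forall i (t : R), is_derive t 1 (f i) (df i t)) ->
  is_derive t 1 (fun x : R => \sum_(i <- s) f i x) (\sum_(i <- s) df i t).
Proof.
move=> h; elim: s => [|i s IH].
  rewrite big_nil; under eq_fun do rewrite big_nil; exact: is_derive_cst.
rewrite big_cons; under eq_fun do rewrite big_cons.
exact: is_derive_add.
Qed.

Lemma continuous_bigsum (I : Type) (s : seq I) (f : I -> R -> R) :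
  (forall i, continuous (f i)) -> continuous (fun x : R => \sum_(i <- s) f i x).
Proof.
move=> h; elim: s => [|i s IH].
  by under eq_fun do rewrite big_nil; exact: cst_continuous.
under eq_fun do rewrite big_cons.
by move=> x; apply: (@continuousD _ _ _ (f i)); [exact: h|exact: IH].
Qed.

Variables (l : R) (N : nat).
Hypotheses (l1 : 1 < l) (l98 : l <= 9 / 8).
Let g := grid l N.

Definition ramp (i : nat) (t : R) : R :=
  clamp ((t - grid l N i.+1) / (grid l N i.+2 - grid l N i.+1)).

(** As a difference of consecutive ramps it sums by telescoping; the piece is centred at node i+2
    and supported between nodes i+1 and i+3. *)
Definition hat (i : nat) (t : R) : R := ramp i t - ramp i.+1 t.

Let glt i : 0 < g i.+1 - g i.
Proof. by rewrite subr_gt0; exact: grid_lt. Qed.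

Lemma ramp0 i t : t <= g i.+1 -> ramp i t = 0.
Proof.
move=> h; rewrite /ramp clamp_le0//.
by rewrite pmulr_lle0 ?invr_gt0 ?glt// subr_le0.
Qed.

Lemma ramp1 i t : g i.+2 <= t -> ramp i t = 1.
Proof.
move=> h; rewrite /ramp clamp_ge1// ler_pdivlMr ?glt//.
by rewrite mul1r lerB.
Qed.

Lemma continuous_ramp i : continuous (ramp i).
Proof.
pose a := grid l N i.+1; pose b := (grid l N i.+2 - a)^-1.
move=> t.
have h : {for t, continuous (fun t : R => (t - a) * b)}.
  apply: (@continuousM _ _ (fun t : R => t - a) (fun=> b)); last exact: cst_continuous.
  by apply: (@cvgB _ R^o); [exact: cvg_id|exact: cvg_cst].
exact: (continuous_comp h (@continuous_clamp R _)).
Qed.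

Lemma continuous_hat i : continuous (hat i).
Proof.
by move=> t; apply: (@continuousB _ _ _ (ramp i) (ramp i.+1)); exact: continuous_ramp.
Qed.

Lemma hat01 i t : 0 <= hat i t <= 1.
Proof.
have /andP[a1 a2] : 0 <= ramp i t <= 1 by exact: clamp01.
have /andP[b1 b2] : 0 <= ramp i.+1 t <= 1 by exact: clamp01.
rewrite /hat; have [h|/ltW h] := leP t (g i.+2).
  by rewrite (ramp0 h) subr0 a1.
by rewrite (ramp1 h) subr_ge0 b2 lerBlDr lerDl.
Qed.

Lemma hat_supp i t : t < g i.+1 \/ g i.+3 < t -> hat i t = 0.
Proof.
rewrite /hat; case=> /ltW h.
  by rewrite !ramp0 ?subrr// (le_trans h)// ltW// -subr_gt0 glt.
by rewrite !ramp1 ?subrr// (le_trans _ h)// ltW// -subr_gt0 glt.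
Qed.

Lemma hat_sum n t : \sum_(i < n) hat i t = ramp 0 t - ramp n t.
Proof.
elim: n => [|n IH]; first by rewrite big_ord0 subrr.
by rewrite big_ord_recr/= IH /hat; ring.
Qed.

(** The hats add up to 1 between nodes 2 and 2N, and outside this range t(1-t) <= 2S. *)
Lemma hat_sum_edge t : (1 < N)%N ->
  0 <= 1 - \sum_(i < N.*2.-1) hat i t <= edge (2 * l ^- N) t.
Proof.
move=> N1; rewrite hat_sum.
have /andP[a1 a2] : 0 <= ramp 0 t <= 1 by exact: clamp01.
have /andP[b1 b2] : 0 <= ramp N.*2.-1 t <= 1 by exact: clamp01.
have NE : N.*2.-1.+1 = (N + N)%N by rewrite prednK ?double_gt0 ?(ltn_trans _ N1)// addnn.
have gN : g 2 <= g N.*2.-1.+1.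
  by apply: grid_le => //; rewrite NE (@leq_add 1 1) // ltnW.
have S0 : 0 < l ^- N by rewrite invr_gt0 exprn_gt0// (lt_trans ltr01).
have in01 : t * (1 - t) <= 2 * l ^- N -> 0 <= 1 - (ramp 0 t - ramp N.*2.-1 t) <= edge (2 * l ^- N) t.
  move=> h; rewrite edge_in//; have [h'|/ltW h'] := leP t (g N.*2.-1.+1).
    by rewrite (ramp0 h'); lra.
  by rewrite (ramp1 (i := 0)) ?(le_trans gN)//; lra.
have [h2|h2] := ltP t (g 2).
  apply: in01; have := grid2_le N l1 l98; rewrite -/(g 2) => h.
  have [t0|t0] := ltP t 0; first by have : t * (1 - t) <= 0 by [nra]; lra.
  by have : t * (1 - t) <= t by [nra]; lra.
have [h3|h3] := ltP (g N.*2.-1.+1) t.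
  apply: in01; have := onem_gridN_le N l1; rewrite -NE -/(g _) => h.
  have t0 : 0 < t by apply: lt_le_trans h2; exact: grid_gt0.
  have [t1|t1] := ltP 1 t; first by have : t * (1 - t) <= 0 by [nra]; lra.
  by have : t * (1 - t) <= 1 - t by [nra]; lra.
by rewrite ramp1// (ramp0 h3) subr0 subrr lexx edge_ge0.
Qed.

End partition.

(** * Transport bounds, edge masses, and the cost of smoothing one piece *)

Section estimate.
Variable R : realType.
Implicit Types (lam mu nu pi : probability R R).

(** The dual form of a Wasserstein bound, restricted to functions that are Lipschitz on [0,1];
    couplings enter the estimates only through it. *)
Definition lip01_close mu pi (c : R) := forall (f : R -> R) (Lam : R),
  bounded_measurable f -> 0 <= Lam ->
  (forall x y, 0 <= x <= 1 -> 0 <= y <= 1 -> `|f x - f y| <= Lam * `|x - y|) ->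
  `|\int[mu]_x f x - \int[pi]_x f x| <= Lam * c.

Lemma hump01 (x : R) : 0 <= x <= 1 -> 0 <= hump x <= 1.
Proof. by move=> /andP[x0 x1]; rewrite hump_le1 andbT /hump; nra. Qed.

Lemma hump_lip (x y : R) : 0 <= x <= 1 -> 0 <= y <= 1 ->
  `|hump x - hump y| <= 4 * `|x - y|.
Proof.
move=> /andP[x0 x1] /andP[y0 y1].
have -> : hump x - hump y = 4 * (x - y) * (1 - x - y) by rewrite /hump; ring.
rewrite !normrM (ger0_norm (x := 4))//.
by rewrite -[leRHS]mulr1; apply: ler_wpM2l => //; rewrite ler_norml; lra.
Qed.

(** By invariance of [pi], one step is applied to both laws, so f may be replaced by its image under
    the kernel; the factor 4 is the Lipschitz constant of [hump]. *)
Lemma lip01_close_step lam sg s K mu mu' pi c (f : R -> R) (Lam : R) :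
  kernel_bounds lam sg s K -> logistic_step lam mu mu' -> logistic_step lam pi pi ->
  lip01_close mu pi c -> bounded_measurable f -> 0 <= Lam ->
  (forall u v, 0 <= u <= 1 -> 0 <= v <= 1 ->
    `|\int[lam]_b f (b * u) - \int[lam]_b f (b * v)| <= Lam * `|u - v|) ->
  `|\int[mu']_x f x - \int[pi]_x f x| <= 4 * Lam * c.
Proof.
move=> kb st sp cl bf L0 lip.
rewrite (logistic_step_int st bf) (logistic_step_int sp bf).
apply: cl; last 2 first.
- by apply: mulr_ge0.
- move=> x y x01 y01; apply: (le_trans (lip _ _ (hump01 x01) (hump01 y01))).
  by rewrite -mulrA mulrCA; apply: ler_wpM2l => //; exact: hump_lip.
exact: bm_kernel.
Qed.

Lemma edge_test (tau : R) : 0 < tau -> exists chi : R -> R,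
  [/\ bounded_measurable chi, forall t, edge tau t <= chi t,
      forall t, chi t <= edge (2 * tau) t &
      forall u v, 0 <= u <= 1 -> 0 <= v <= 1 -> `|chi u - chi v| <= tau^-1 * `|u - v|].
Proof.
move=> tau0; pose chi (t : R) := clamp (2 - t * (1 - t) / tau).
have cc : continuous chi.
  move=> t; have h : {for t, continuous (fun t : R => 2 - t * (1 - t) / tau)}.
    apply: (@cvgB _ R^o); first exact: cvg_cst.
    apply: cvgM; last exact: cvg_cst.
    by apply: cvgM; [exact: cvg_id|apply: (@cvgB _ R^o); [exact: cvg_cst|exact: cvg_id]].
  exact: (continuous_comp h (@continuous_clamp R _)).
have c01 t : 0 <= chi t <= 1 := clamp01 _.
exists chi; split.
- exact: continuous01_bm.
- move=> t; have [h|h] := leP (t * (1 - t)) tau; last first.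
    by rewrite edge_eq0//; case/andP: (c01 t).
  rewrite edge_in// /chi clamp_ge1//.
  have : t * (1 - t) / tau <= 1 by rewrite ler_pdivrMr// mul1r.
  by lra.
- move=> t; have [h|h] := leP (t * (1 - t)) (2 * tau).
    by rewrite edge_in//; case/andP: (c01 t).
  rewrite /chi clamp_le0 ?edge_ge0//.
  by rewrite subr_le0 ler_pdivlMr// ltW.
- move=> u v /andP[u0 u1] /andP[v0 v1]; apply: (le_trans (clamp_lip _ _)).
  rewrite [X in `|X|](_ : _ = tau^-1 * ((u - v) * (u + v - 1))); last by ring.
  rewrite normrM (ger0_norm (x := tau^-1)) ?invr_ge0 ?(ltW tau0)//.
  apply: ler_wpM2l; first by rewrite invr_ge0 ltW.
  by rewrite normrM; apply: ler_piMr => //; rewrite ler_norml; lra.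
Qed.

(** Nothing is known beforehand about how the chain charges the edges. A test function of Lipschitz
    constant 1/sig compares it with [pi] at cost 4 S^(a+1)/sig, which is at most 4 sig^a precisely
    because sig >= S. *)
Lemma edge_mass_transfer lam sg s K mu mu' pi a Cp S sig :
  kernel_bounds lam sg s K -> logistic_step lam mu mu' -> logistic_step lam pi pi ->
  0 < a -> 0 < S -> S <= sig -> (forall sig, 0 < sig -> \int[pi]_t edge sig t <= Cp * sig `^ a) ->
  lip01_close mu pi (S `^ (a + 1)) ->
  \int[mu']_t edge sig t <= (2 `^ a * Cp + 4) * sig `^ a.
Proof.
move=> kb st sp a0 S0 Ss hp cl; have sig0 : 0 < sig := lt_le_trans S0 Ss.
have [chi [bc e1 e2 chil]] := edge_test sig0.
have lip u v : 0 <= u <= 1 -> 0 <= v <= 1 ->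
    `|\int[lam]_b chi (b * u) - \int[lam]_b chi (b * v)| <= sig^-1 * `|u - v|.
  move=> u01 v01; rewrite -bm_intB; [|exact: bm_mulr..].
  rewrite (kernel_int01 kb); last by apply: bmB; exact: bm_mulr.
  rewrite (bm_int_mkcond lam); apply: bm_int_bound.
    by apply: bmM; [exact: bm_indic|apply: bmB; exact: bm_mulr].
  move=> b; rewrite indicE; have [/set_mem/=|_] := boolP (b \in _); last first.
    by rewrite mul0r normr0 mulr_ge0// invr_ge0 ltW.
  rewrite in_itv/= => /andP[b0 b1]; rewrite mul1r.
  have b01 w : 0 <= w <= 1 -> 0 <= b * w <= 1.
    by move=> /andP[w0 w1]; rewrite mulr_ge0//= mulr_ile1.
  apply: (le_trans (chil _ _ (b01 _ u01) (b01 _ v01))).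
  apply: ler_wpM2l; first by rewrite invr_ge0 ltW.
  by rewrite -mulrBr normrM (ger0_norm b0); apply: ler_piMl.
have si0 : 0 <= sig^-1 by rewrite invr_ge0 ltW.
have := lip01_close_step kb st sp cl bc si0 lip.
rewrite ler_norml => /andP[_ h].
have h1 : \int[mu']_t edge sig t <= \int[mu']_t chi t by apply: bm_le => //; exact: bm_edge.
have h2 : \int[pi]_t chi t <= \int[pi]_t edge (2 * sig) t by apply: bm_le => //; exact: bm_edge.
have := hp (2 * sig) (mulr_gt0 (ltr0n _ 2) sig0).
rewrite powRM// ?(ltW sig0)// => h3.
have h4 : sig^-1 * S `^ (a + 1) <= sig `^ a.
  rewrite mulrC ler_pdivrMr// -[X in _ * X]powRr1 ?(ltW sig0)//.
  rewrite -powRD; last by rewrite (gt_eqF sig0) implybT.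
  by apply: ge0_ler_powR; rewrite ?nnegrE ?(ltW S0) ?(ltW sig0)// addr_ge0// ltW.
rewrite mulrDl; rewrite -mulrA in h.
by rewrite -mulrA mulrCA; lra.
Qed.

(** The difference between a piece and its mollification is a derivative with small primitive, so
    local smoothness bounds its integral by eps^r times an edge mass. The mollified function is
    fixed before the law, and can therefore serve two laws. *)
Lemma smooth_piece (L y p1 p2 eps : R) (q : R -> R) : 1 <= L -> 0 < y < 1 ->
  let tau := y * (1 - y) in let e := eps * (tau / (32 * L)) in
  0 < eps <= 1 -> y - tau / (8 * L) <= p1 -> p2 <= y + tau / (8 * L) ->
  continuous q -> (forall t, 0 <= q t <= 1) ->
  (forall t, t < p1 \/ p2 < t -> q t = 0) ->
  exists qe dqe : R -> R,
  [/\ forall t : R, is_derive t 1 qe (dqe t), continuous dqe,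
      forall t, 0 <= qe t <= 1, forall t, `|dqe t| <= e^-1 &
      forall t, t + e < p1 \/ p2 < t -> qe t = 0 /\ dqe t = 0] /\
  forall nu (Cs r : R), 0 <= Cs -> local_smoothness nu Cs r L ->
   `|\int[nu]_t q t - \int[nu]_t qe t| <= Cs * eps `^ r * \int[nu]_t edge (8 * tau) t.
Proof.
move=> L1 /andP[y0 y1] tau e /andP[eps0 eps1] hp1 hp2 cq q01 qs.
have L0 : 0 < L by lra.
have tau0 : 0 < tau by rewrite mulr_gt0// subr_gt0.
(* Chosen so that L d = tau/4, which keeps the larger ball inside [0,1] and inside the edge region.
   The piece then lives within d/2 of y and the window is eps d/8. *)
pose d := tau / (4 * L).
have d0 : 0 < d by rewrite divr_gt0// mulr_gt0.
have Ld : L * d = tau / 4 by rewrite /d; field; rewrite gt_eqF.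
have dE : tau / (8 * L) = d / 2 by rewrite /d; field; rewrite gt_eqF.
have eE : e = eps * (d / 8) by rewrite /e /d; congr (_ * _); field; rewrite gt_eqF.
rewrite dE in hp1 hp2.
have tauy : tau <= y by rewrite /tau; apply: ler_piMr; lra.
have tauy' : tau <= 1 - y by rewrite /tau; apply: ler_piMl; lra.
have dtau : d <= tau / 4 by rewrite -Ld ler_peMl// ltW.
have e0 : 0 < e by rewrite eE; apply: mulr_gt0 => //; apply: divr_gt0.
have ed : e <= d / 8 by rewrite eE; apply: ler_piMl => //; rewrite divr_ge0// ltW.
have ep1 : e < p1 by lra.
have [qe [dqe [psi [h1 [h2 h3 h4]]]]] := mollify cq e0 ep1 q01 qs.
exists qe, dqe; split=> //; case: h1 => [g1 g2 g3 g4 g5] nu Cs r Cs0 ls.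
have cqe := is_derive_continuous g1.
have bq := continuous01_bm cq q01; have bqe := continuous01_bm cqe g3.
rewrite -bm_intB//.
have bt : bump_test psi (fun t => q t - qe t) y d eps 1.
  split=> //.
  - by move=> t; apply: (@continuousB _ _ _ q qe); [exact: cq|exact: cqe].
  - move=> t; apply: (le_trans (h3 t)); rewrite mul1r eE.
    by apply: ler_wpM2l; [exact: ltW|lra].
  - move=> t; have := q01 t; have := g3 t => /andP[? ?] /andP[? ?].
    by rewrite ler_norml; lra.
  - move=> t; have [ty|ty] := leP y t => h.
      have h' : p2 < t by move: h; rewrite ger0_norm ?subr_ge0//; lra.
      by rewrite h4 ?qs ?(g5 t _).1 ?subrr//; right.
    have h' : t + e < p1 by move: h; rewrite ltr0_norm ?subr_lt0//; lra.
    rewrite h4 ?qs ?(g5 t _).1 ?subrr//; first by left.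
      by left; lra.
    by left.
have eps01 : 0 < eps <= 1 by rewrite eps0.
have hLy : L * d <= y by lra.
have hLy' : L * d <= 1 - y by lra.
have := ls _ _ _ _ _ _ d0 eps01 (@ler01 R) hLy hLy' bt.
rewrite mulr1 Ld => h; apply: (le_trans h).
apply: ler_wpM2l; first by rewrite mulr_ge0// powR_ge0.
apply: bm_le; [exact: bm_ind_ball|exact: bm_edge|move=> t].
by apply: ind_ball_edge; rewrite ?y0.
Qed.

End estimate.

(** * Smoothing at all scales of the grid *)

Section smooth_approximation.
Variable R : realType.

(** With eps = (S/(8 tau))^kap the derivative of a mollified piece is of order 1/(eps tau), that is
    S^(-kap) tau^(kap-1), the growth accepted by [kernel_lipschitz]. The errors eps^r tau^a equal
    S^a (S/tau)^(kap r - a) up to constants and sum geometrically from both ends; the part outside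
    the partition costs the edge mass at height 2S. *)
Lemma smooth_approx (L kap : R) (N : nat) (phi : R -> R) :
  1 <= L -> 1 < kap -> (1 < N)%N -> continuous phi -> (forall t, 0 <= phi t <= 1) ->
  let l := 1 + (8 * L)^-1 in let S := l ^- N in
  exists F dF : R -> R,
  [/\ forall t : R, is_derive t 1 F (dF t), continuous dF,
      forall t, `|F t| <= 4 & exists M2, forall t, `|dF t| <= M2] /\
  [/\ forall t, 0 < t -> `|dF t| <=
        4 * (32 * L * 8 `^ kap * 2 `^ (kap - 1)) * S `^ (- kap) * t `^ (kap - 1),
      forall t, t <= S / 4 -> F t = 0 /\ dF t = 0 &
   forall (nu : probability R R) (Cs r Cm a : R), 0 <= Cs -> 0 <= Cm -> local_smoothness nu Cs r L ->
     0 < a -> a < kap * r ->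
     (forall sig, S <= sig -> \int[nu]_t edge sig t <= Cm * sig `^ a) ->
     `|\int[nu]_t phi t - \int[nu]_t F t| <=
     (Cm * 2 `^ a + 2 * Cs * Cm / (1 - (l^-1) `^ (kap * r - a))) * S `^ a].
Proof.
move=> L1 kap1 N1 cphi phi01 l S.
have L0 : 0 < L by lra.
have l1 : 1 < l by rewrite ltrDl invr_gt0 mulr_gt0.
have l98 : l <= 9 / 8.
  have : (8 * L)^-1 <= 8^-1 by rewrite lef_pV2 ?posrE ?mulr_gt0//; lra.
  by rewrite /l; lra.
have l0 : 0 < l by lra.
have S0 : 0 < S by rewrite /S invr_gt0 exprn_gt0.
pose g := grid l N; pose tau i := grid_var l N i.+2.
have tau0 i : 0 < tau i by exact: grid_var_gt0.
have NE : N.*2.-1.+1 = (N + N)%N by rewrite prednK ?double_gt0 ?(ltn_trans _ N1)// addnn.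
have tl (i : 'I_N.*2.-1) : (i.+2 <= N + N)%N by rewrite -NE ltnS.
pose X := l^-1.
have X0 : 0 < X by rewrite invr_gt0.
have X1 : X < 1 by rewrite invf_lt1.
have St1 (i : 'I_N.*2.-1) : (i.+2 <= N)%N -> S / (8 * tau i) <= X ^+ i.+2.
  by move=> h; rewrite exprVn; exact: grid_var_low1.
have St2 (i : 'I_N.*2.-1) : (N <= i.+2)%N -> S / (8 * tau i) <= X ^+ (N + N - i.+2).
  by move=> h; rewrite exprVn; exact: grid_var_low2.
have St : forall i : 'I_N.*2.-1, 0 < S / (8 * tau i) <= 1.
  move=> i; apply/andP; split; first by apply: divr_gt0 => //; apply: mulr_gt0.
  have [h|/ltnW h] := leqP i.+2 N.
    by apply: (le_trans (St1 _ h)); rewrite exprn_ile1// ?(ltW X0)// ltW.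
  by apply: (le_trans (St2 _ h)); rewrite exprn_ile1// ?(ltW X0)// ltW.
have Stau : forall i : 'I_N.*2.-1, S <= 8 * tau i.
  by move=> i; case/andP: (St i) => _; rewrite ler_pdivrMr ?mul1r//; apply: mulr_gt0.
pose eps i := (S / (8 * tau i)) `^ kap.
have eps01 (i : 'I_N.*2.-1) : 0 < eps i <= 1.
  case/andP: (St i) => h1 h2; rewrite powR_gt0//=.
  rewrite [leRHS](_ : 1 = 1 `^ kap); last by rewrite powR1.
  apply: ge0_ler_powR; rewrite ?nnegrE//; last exact: ltW.
  by lra.
pose q i t := phi t * hat l N i t.
have q01 i t : 0 <= q i t <= 1.
  have /andP[a1 a2] := phi01 t; have /andP[b1 b2] := hat01 N l1 i t.
  by rewrite mulr_ge0//= mulr_ile1.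
have cq i : continuous (q i).
  by move=> t; apply: (@continuousM _ _ phi (hat l N i)); [exact: cphi|exact: continuous_hat].
have qs i t : t < g i.+1 \/ g i.+3 < t -> q i t = 0.
  by move=> h; rewrite /q hat_supp ?mulr0.
(* The reason for l = 1 + 1/(8L): the nodes next to the centre of a piece are within (l-1) tau of
   it, which is exactly the radius allowed by [smooth_piece]. *)
have dE (i : nat) : tau i / (8 * L) = (l - 1) * tau i by rewrite /l; field; rewrite gt_eqF.
pose e i := eps i * (tau i / (32 * L)).
have e0 (i : 'I_N.*2.-1) : 0 < e i.
  by case/andP: (eps01 i) => ? _; rewrite mulr_gt0// divr_gt0// mulr_gt0.
have piece (i : 'I_N.*2.-1) : exists p : (R -> R) * (R -> R),
  [/\ forall t : R, is_derive t 1 p.1 (p.2 t), continuous p.2,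
      forall t, 0 <= p.1 t <= 1, forall t, `|p.2 t| <= (e i)^-1 &
      forall t, t + e i < g i.+1 \/ g i.+3 < t -> p.1 t = 0 /\ p.2 t = 0] /\
  forall (nu : probability R R) (Cs r : R), 0 <= Cs -> local_smoothness nu Cs r L ->
   `|\int[nu]_t q i t - \int[nu]_t p.1 t| <= Cs * eps i `^ r * \int[nu]_t edge (8 * tau i) t.
  have y01 : 0 < g i.+2 < 1 by rewrite grid_gt0//= -subr_gt0 onem_grid_gt0.
  have h1 : g i.+2 - tau i / (8 * L) <= g i.+1.
    by rewrite dE; have := grid_gap' N l1 i.+1; rewrite -/g -/(tau i); lra.
  have h2 : g i.+3 <= g i.+2 + tau i / (8 * L).
    by rewrite dE; have := grid_gap N l1 i.+2; rewrite -/g -/(tau i); lra.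
  have [qe [dqe h]] := smooth_piece L1 y01 (eps01 i) h1 h2 (cq i) (q01 i) (qs i).
  by exists (qe, dqe).
have [p hp] := choice piece; move: piece => _.
(* H t i - H t (i+4) is the indicator of t lying between g i and g (i+4), where the i-th mollified
   piece lives; [sum_overlap] then bounds all sums over pieces. *)
pose H (t : R) i : R := (g i <= t)%R%:R.
have H01 t i : 0 <= H t i <= 1 by rewrite /H ler0n lern1 leq_b1.
have sup0 (i : 'I_N.*2.-1) t : t < g i -> (p i).1 t = 0 /\ (p i).2 t = 0.
  move=> h; have [[_ _ _ _ sp] _] := hp i; apply: sp; left.
  have := grid_var_gap N l1 l98 i; rewrite -/g -/(tau i).
  have -> : (l - 1) * tau i / 4 = tau i / (32 * L) by rewrite -dE; field; rewrite gt_eqF.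
  have : e i <= tau i / (32 * L).
    case/andP: (eps01 i) => _ h'; apply: ler_piMl => //.
    by rewrite divr_ge0 ?(ltW (tau0 _))// mulr_ge0// ltW.
  by lra.
have sup1 (i : 'I_N.*2.-1) t : g i.+4 <= t -> (p i).1 t = 0 /\ (p i).2 t = 0.
  move=> h; have [[_ _ _ _ sp] _] := hp i; apply: sp; right.
  by apply: lt_le_trans h; exact: grid_lt.
have Hle i t : H t i.+4 <= H t i.
  rewrite /H; have [h|_] := leP (g i.+4) t; last by rewrite ler0n.
  by rewrite (le_trans _ h)//; apply: grid_le => //; rewrite -addn4 leq_addr.
have HE i t : (t < g i \/ g i.+4 <= t) \/ H t i - H t i.+4 = 1 /\ g i <= t.
  rewrite /H; have [h|h] := ltP t (g i); first by left; left.
  have [h'|h'] := leP (g i.+4) t; first by left; right.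
  by right; rewrite /= subr0.
have H0 i t : 0 <= H t i - H t i.+4 by rewrite subr_ge0.
pose F t := \sum_(i < N.*2.-1) (p i).1 t; pose dF t := \sum_(i < N.*2.-1) (p i).2 t.
have F1 (t : R) : is_derive t 1 F (dF t).
  apply: (@is_derive_bigsum R _ _ (fun i => (p i).1) (fun i => (p i).2)) => i u.
  by have [[h _ _ _ _] _] := hp i; exact: h.
have dFM : exists M2, forall t, `|dF t| <= M2.
  exists (\sum_(i < N.*2.-1) (e i)^-1) => t; apply: (le_trans (ler_norm_sum _ _ _)).
  by apply: ler_sum => i _; have [[]] := hp i.
have FM t : `|F t| <= 4.
  apply: (le_trans (ler_norm_sum _ _ _)).
  apply: le_trans (sum_overlap N.*2.-1 (H01 t)); apply: ler_sum => i _.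
  have [[h|h]|[-> _]] := HE i t; [by rewrite (sup0 _ _ h).1 normr0 H0|
    by rewrite (sup1 _ _ h).1 normr0 H0|].
  by have [[_ _ h _ _] _] := hp i; case/andP: (h t) => *; rewrite ger0_norm.
exists F, dF; split; first by split=> //; apply: (@continuous_bigsum R _ _ (fun i => (p i).2)) => i; have [[]] := hp i.
split.
- move=> t t0; pose D := 32 * L * 8 `^ kap * 2 `^ (kap - 1) * S `^ (- kap) * t `^ (kap - 1).
  rewrite [leRHS](_ : _ = D * 4); last by rewrite /D; ring.
  have D0 : 0 <= D by rewrite /D !mulr_ge0 ?powR_ge0// ltW.
  apply: (@le_trans _ _ (D * \sum_(i < N.*2.-1) (H t i - H t i.+4))); last first.
    by apply: ler_wpM2l => //; exact: (sum_overlap N.*2.-1 (H01 t)).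
  rewrite mulr_sumr; apply: (le_trans (ler_norm_sum _ _ _)); apply: ler_sum => i _.
  have [[h|h]|[-> gt]] := HE i t; [by rewrite (sup0 _ _ h).2 normr0 mulr_ge0|
    by rewrite (sup1 _ _ h).2 normr0 mulr_ge0|].
  have [[_ _ _ h _] _] := hp i; apply: (le_trans (h t)); rewrite mulr1 {h}.
  have t2 : tau i <= 2 * t.
    have b1 := grid_step N l1 i; have b2 := grid_step N l1 i.+1.
    have b3 := grid_var_le N l1 i.+2; rewrite -/(tau i) -/g in b1 b2 b3.
    have b4 : l * g i.+1 <= l * (l * g i) by apply: ler_wpM2l => //; exact: ltW.
    have b5 : l * (l * g i) <= 2 * g i.
      rewrite mulrA; apply: ler_wpM2r; first by rewrite ltW// grid_gt0.
      by have : l * l <= 9 / 8 * (9 / 8) by [apply: ler_pM; rewrite ?(ltW l0)]; lra.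
    by lra.
  have t80 : 0 <= 8 * tau i by apply: mulr_ge0 => //; exact: ltW.
  have epsE : (eps i)^-1 = S `^ (- kap) * (8 `^ kap * tau i `^ kap).
    rewrite -[8 `^ kap * _]powRM ?(ltW (tau0 _))//.
    have hM : (S / (8 * tau i)) `^ (- kap) = S `^ (- kap) * (8 * tau i)^-1 `^ (- kap).
      by apply: powRM; [exact: ltW|rewrite invr_ge0].
    rewrite /eps -powRN hM; congr (_ * _).
    have -> : (8 * tau i)^-1 = (8 * tau i) `^ (-1) by rewrite powR_inv1.
    by rewrite -powRrM mulN1r opprK.
  have -> : (e i)^-1 = 32 * L * (eps i)^-1 / tau i.
    by rewrite /e; move: (eps i) (tau i) => A B; rewrite !invfM !invrK; ring.
  rewrite epsE /D.
  rewrite [leLHS](_ : _ = 32 * L * 8 `^ kap * S `^ (- kap) * (tau i `^ kap / tau i)); last by ring.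
  rewrite -[tau i `^ kap](mulr_powRB1 (ltW (tau0 _))); last by lra.
  rewrite [tau i * _]mulrC mulfK ?gt_eqF//.
  rewrite [leRHS](_ : _ = 32 * L * 8 `^ kap * S `^ (- kap) * (2 `^ (kap - 1) * t `^ (kap - 1))); last by ring.
  apply: ler_wpM2l; first by rewrite !mulr_ge0 ?powR_ge0// ltW.
  rewrite -powRM ?(ltW t0)//; apply: ge0_ler_powR; rewrite ?nnegrE ?(ltW (tau0 _))//.
    by rewrite subr_ge0 ltW.
  by rewrite mulr_ge0// ltW.
- move=> t tS; have tg i : t < g i.
    apply: (@lt_le_trans _ _ (g 0)); last exact: grid_le.
    by have := grid0_ge N l1; rewrite -/S -/g; lra.
  by split; rewrite /F /dF big1// => i _; have [] := sup0 i t (tg _).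
- move=> nu Cs r Cm a Cs0 Cm0 ls a0 ar hm.
  pose th := \sum_(i < N.*2.-1) \int[nu]_t q i t.
  have bq i : bounded_measurable (q i) by exact: continuous01_bm.
  have bp (i : 'I_N.*2.-1) : bounded_measurable (p i).1.
    have [[h1 _ h _ _] _] := hp i.
    by apply: continuous01_bm => //; exact: is_derive_continuous h1.
  have bphi := continuous01_bm cphi phi01.
  have E1 : `|\int[nu]_t phi t - th| <= Cm * 2 `^ a * S `^ a.
    rewrite /th -bm_int_sum// -bm_intB//; last exact: bm_sum.
    apply: (@le_trans _ _ (\int[nu]_t edge (2 * S) t)); last first.
      rewrite -mulrA -powRM ?(ltW S0)//; apply: hm.
      by rewrite ler_peMl ?(ltW S0)// ler1n.
    apply: bm_abs_le; [apply: bmB => //; exact: bm_sum|exact: bm_edge|].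
    move=> t; rewrite -mulr_sumr -{1}[phi t]mulr1 -mulrBr normrM.
    have /andP[h1 h2] := hat_sum_edge l1 l98 t N1; have /andP[f1 f2] := phi01 t.
    rewrite !ger0_norm//; apply: le_trans h2.
    by apply: ler_piMl.
  pose x := X `^ (kap * r - a); pose pw := kap * r - a.
  have pw0 : 0 < pw by rewrite subr_gt0.
  have x0 : 0 <= x by exact: powR_ge0.
  have x1 : x < 1.
    rewrite [ltRHS](_ : 1 = 1 `^ pw); last by rewrite powR1.
    by apply: gt0_ltr_powR; rewrite ?nnegrE ?(ltW X0).
  have E2 (i : 'I_N.*2.-1) : `|\int[nu]_t q i t - \int[nu]_t (p i).1 t| <=
      Cs * Cm * S `^ a * (x ^+ i + x ^+ (rev_ord i)).
    have [_ h] := hp i; apply: (le_trans (h _ _ _ Cs0 ls)) => {h}.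
    have t8 : 0 < 8 * tau i by apply: mulr_gt0.
    have S8 : 0 < S / (8 * tau i) by rewrite divr_gt0.
    apply: (@le_trans _ _ (Cs * eps i `^ r * (Cm * (8 * tau i) `^ a))).
      by apply: ler_wpM2l; [rewrite mulr_ge0// powR_ge0|exact: hm].
    have -> : Cs * eps i `^ r * (Cm * (8 * tau i) `^ a) =
        Cs * Cm * S `^ a * (S / (8 * tau i)) `^ pw.
      rewrite /eps -powRrM (_ : kap * r = pw + a); last by rewrite /pw; ring.
      rewrite powRD; last by rewrite (gt_eqF S8) implybT.
      have -> : S `^ a = (S / (8 * tau i)) `^ a * (8 * tau i) `^ a.
        by rewrite -powRM ?(ltW S8) ?(ltW t8)// divfK// gt_eqF.
      by ring.
    apply: ler_wpM2l; first by rewrite !mulr_ge0 ?powR_ge0.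
    have xp n : x ^+ n = (X ^+ n) `^ pw.
      rewrite /x -[X ^+ n]powR_mulrn; last exact: ltW.
      by rewrite -powRrM -powR_mulrn ?powR_ge0// -powRrM mulrC.
    have mono n : S / (8 * tau i) <= X ^+ n -> (S / (8 * tau i)) `^ pw <= x ^+ n.
      move=> h; rewrite xp; apply: ge0_ler_powR; rewrite ?nnegrE ?(ltW pw0) ?(ltW S8)//.
      by rewrite exprn_ge0// ltW.
    have dec m n : (m <= n)%N -> x ^+ n <= x ^+ m.
      by move=> h; apply: ler_wiXn2l => //; exact: ltW.
    (* Left of the middle the decay is counted from the first piece, right of it from the last,
       whence the index [rev_ord i]. *)
    have [h|/ltnW h] := leqP i.+2 N.
      apply: (le_trans (mono _ (St1 _ h))); apply: (le_trans (dec i _ _)); first by rewrite -addn2 leq_addr.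
      by rewrite lerDl exprn_ge0.
    apply: (le_trans (mono _ (St2 _ h))); apply: (le_trans (dec (rev_ord i) _ _)).
      by rewrite /= -NE subSS.
    by rewrite lerDr exprn_ge0.
  have E3 : `|th - \int[nu]_t F t| <= 2 * Cs * Cm / (1 - x) * S `^ a.
    rewrite /F bm_int_sum// /th -sumrB; apply: (le_trans (ler_norm_sum _ _ _)).
    apply: (@le_trans _ _ (\sum_(i < N.*2.-1) Cs * Cm * S `^ a * (x ^+ i + x ^+ (rev_ord i)))).
      by apply: ler_sum => i _; exact: E2.
    rewrite -mulr_sumr big_split/=.
    have -> : \sum_(i < N.*2.-1) x ^+ (N.*2.-1 - i.+1) = \sum_(i < N.*2.-1) x ^+ i.
      by rewrite [RHS](reindex_inj rev_ord_inj).
    have := sum_pow_le N.*2.-1 x0 x1 => h.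
    rewrite [leRHS](_ : _ = Cs * Cm * S `^ a * ((1 - x)^-1 + (1 - x)^-1)); last by ring.
    by apply: ler_wpM2l; [rewrite !mulr_ge0 ?powR_ge0|exact: lerD].
  rewrite mulrDl; have := ler_normD (\int[nu]_t phi t - th) (th - \int[nu]_t F t).
  by rewrite subrKA => h; apply: (le_trans h); exact: lerD.
Qed.

End smooth_approximation.

(** * Comparison of the two laws on continuous functions *)

Section main_estimate.
Variable R : realType.
Implicit Types (lam mu nu pi : probability R R).

(** The smoothed F depends on phi and S only, so replacing phi by F costs order S^a under each law,
    and the kernel makes F of Lipschitz constant Cl/S, so transport costs 4 (Cl/S) S^(a+1). *)
Lemma continuous_estimate lam (sg s K a Cs r L Cp : R) :
  kernel_bounds lam sg s K -> 0 < a -> 0 <= Cs -> 1 <= L -> 0 <= Cp ->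
  a < (1 - s)^-1 * r -> exists C : R, 0 <= C /\
  forall mu mu' pi N, (1 < N)%N ->
    local_smoothness mu' Cs r L -> local_smoothness pi Cs r L ->
    logistic_step lam mu mu' -> logistic_step lam pi pi ->
    (forall sig, 0 < sig -> \int[pi]_t edge sig t <= Cp * sig `^ a) ->
    let S := (1 + (8 * L)^-1) ^- N in
    lip01_close mu pi (S `^ (a + 1)) ->
    forall phi : R -> R, continuous phi -> (forall t, 0 <= phi t <= 1) ->
    `|\int[mu']_t phi t - \int[pi]_t phi t| <= C * S `^ a.
Proof.
move=> kb a0 Cs0 L1 Cp0 ar.
have s1 := kb_s1 kb; have s0 := kb_s0 kb.
set kap := (1 - s)^-1 in ar *.
have kap1 : 1 < kap by rewrite invf_gt1; lra.
pose M1 := 4 * (32 * L * 8 `^ kap * 2 `^ (kap - 1)).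
have M10 : 0 <= M1 by rewrite /M1 !mulr_ge0 ?powR_ge0//; lra.
have [Cl [Cl0 HCl]] := kernel_lipschitz kb (ler0n R 4) M10.
(* The constant of [edge_mass_transfer]; it also dominates Cp, so one constant serves both laws. *)
pose Cm := 2 `^ a * Cp + 4.
have Cm0 : 0 <= Cm by rewrite addr_ge0// mulr_ge0// powR_ge0.
pose l := 1 + (8 * L)^-1.
have l1 : 1 < l by rewrite ltrDl invr_gt0 mulr_gt0//; lra.
pose E := Cm * 2 `^ a + 2 * Cs * Cm / (1 - (l^-1) `^ (kap * r - a)).
have X1 : (l^-1) `^ (kap * r - a) < 1.
  rewrite [ltRHS](_ : 1 = 1 `^ (kap * r - a)); last by rewrite powR1.
  have l0 : 0 < l by lra.
  apply: gt0_ltr_powR; rewrite ?nnegrE ?invf_lt1 ?subr_gt0 ?invr_ge0 ?(ltW l0)//.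
have E0 : 0 <= E.
  rewrite addr_ge0 ?mulr_ge0 ?powR_ge0//.
  by rewrite invr_ge0 subr_ge0 ltW.
exists (E + E + 4 * Cl); split; first by lra.
move=> mu mu' pi N N1 lsm lsp st sp hp S cl phi cphi phi01.
have l0 : 0 < l by lra.
have S0 : 0 < S by rewrite invr_gt0 exprn_gt0.
have S1 : S <= 1 by rewrite invf_le1 ?exprn_gt0 ?exprn_ege1 ?(ltW l1).
have [F [dF [[F1 cF FM [M2 FM2]] [FM1 F0 HF]]]] := smooth_approx L1 kap1 N1 cphi phi01.
have bF : bounded_measurable F.
  by split; [exact: continuous_measurable_fun (is_derive_continuous F1)|exists 4].
have hm sig : S <= sig -> \int[mu']_t edge sig t <= Cm * sig `^ a.
  by move=> h; exact: (edge_mass_transfer kb st sp a0 S0 h hp cl).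
have hpm sig : S <= sig -> \int[pi]_t edge sig t <= Cm * sig `^ a.
  move=> h; apply: (le_trans (hp _ (lt_le_trans S0 h))).
  apply: ler_wpM2r; first exact: powR_ge0.
  have h2 : 1 <= 2 `^ a.
    by rewrite -[leLHS](powRr0 2); apply: ler_powR; [rewrite ler1n|exact: ltW].
  have : Cp <= 2 `^ a * Cp by apply: ler_peMl.
  by rewrite /Cm; lra.
have h1 := HF mu' Cs r Cm a Cs0 Cm0 lsm a0 ar hm.
have h2 := HF pi Cs r Cm a Cs0 Cm0 lsp a0 ar hpm.
have S01 : 0 < S <= 1 by rewrite S0.
have lip := HCl F dF S M2 S01 F1 cF FM FM2 FM1 F0.
have ClS : 0 <= Cl / S by rewrite divr_ge0// ltW.
have h3 := lip01_close_step kb st sp cl bF ClS lip.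
have h4 : 4 * (Cl / S) * S `^ (a + 1) = 4 * Cl * S `^ a.
  have a10 : a + 1 != 0 by lra.
  rewrite -(mulr_powRB1 (ltW S0)); last by lra.
  by rewrite addrK; field; rewrite gt_eqF.
rewrite h4 in h3; rewrite -/l -/E -/S in h1 h2.
have := ler_normD (\int[mu']_t phi t - \int[mu']_t F t) (\int[mu']_t F t - \int[pi]_t F t).
have := ler_normD (\int[mu']_t phi t - \int[pi]_t F t) (\int[pi]_t F t - \int[pi]_t phi t).
rewrite !subrKA (distrC (\int[pi]_t F t)) => g1 g2.
rewrite 2!mulrDl; lra.
Qed.

End main_estimate.

(** * From couplings and continuous functions to total variation *)

Section couplings.
Variable R : realType.
Implicit Types (lam mu nu pi : probability R R).

Lemma continuous_to_measurable mu nu (c : R) (A : set R) : measurable A ->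
  (forall phi : R -> R, continuous phi -> (forall t, 0 <= phi t <= 1) ->
    `|\int[mu]_t phi t - \int[nu]_t phi t| <= c) ->
  `|fine (mu A) - fine (nu A)| <= c.
Proof.
move=> mA h; apply/ler_addgt0Pr => e e0.
have e2 : 0 < e / 2 by rewrite divr_gt0.
have [phi [c1 c01 i1 i2]] := measurable_approximable mu nu mA e2.
have bphi := continuous01_bm c1 c01; have bA := bm_indic R mA.
have key (m : probability R R) : \int[m]_x `|phi x - \1_A x| <= e / 2 ->
    `|\int[m]_t phi t - fine (m A)| <= e / 2.
  by move=> i; rewrite -prob_indic// -bm_intB//; apply: le_trans i; apply: bm_abs; exact: bmB.
have := h phi c1 c01; have := key _ i1; have := key _ i2.
rewrite !ler_norml; lra.
Qed.

Lemma coupling_close mu nu (M : probability (R * R)%type R) (c : R) :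
  mu `[0, 1]%classic = 1%E -> nu `[0, 1]%classic = 1%E -> is_coupling mu nu M ->
  (\int[M]_z `|z.1 - z.2|%:E <= c%:E)%E -> lip01_close mu nu c.
Proof.
move=> mu1 nu1 [M1 M2] Mc f Lam bf L0 lip.
have mI : measurable `[(0 : R), 1]%classic by [].
pose D : set (R * R) := `[0, 1]%classic `*` `[0, 1]%classic.
have mD : measurable D by exact: measurableX.
have mf1 : measurable_fun [set: R * R] (fst : R * R -> R) by exact: measurable_fst.
have mf2 : measurable_fun [set: R * R] (snd : R * R -> R) by exact: measurable_snd.
have bf1 : bounded_measurable (fun z : R * R => f z.1) by exact: (bm_comp bf mf1).
have bf2 : bounded_measurable (fun z : R * R => f z.2) by exact: (bm_comp bf mf2).
have E1 : \int[mu]_x f x = \int[M]_z f z.1.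
  rewrite /Rintegral; congr fine.
  rewrite -[RHS](@integral_pushforward _ _ _ _ R _ mf1 M setT (EFin \o f))//.
  - by apply: eq_measure_integral => A mA _ /=; rewrite -M1.
  - by apply/measurable_EFinP; case: bf.
  - by rewrite preimage_setT; exact: (bm_integrable M measurableT bf1).
have E2 : \int[nu]_x f x = \int[M]_z f z.2.
  rewrite /Rintegral; congr fine.
  rewrite -[RHS](@integral_pushforward _ _ _ _ R _ mf2 M setT (EFin \o f))//.
  - by apply: eq_measure_integral => A mA _ /=; rewrite -M2.
  - by apply/measurable_EFinP; case: bf.
  - by rewrite preimage_setT; exact: (bm_integrable M measurableT bf2).
have MD : M (~` D) = 0%E.
  apply/eqP; rewrite eq_le measure_ge0 andbT.
  pose I := `[(0 : R), 1]%classic.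
  have m1 : measurable (fst @^-1` (~` I) : set (R * R)).
    by rewrite -[X in measurable X]setTI; apply: mf1 => //; exact: measurableC.
  have m2 : measurable (snd @^-1` (~` I) : set (R * R)).
    by rewrite -[X in measurable X]setTI; apply: mf2 => //; exact: measurableC.
  have z (m : probability R R) : m I = 1%E -> m (~` I) = 0%E.
    by move=> mI1; rewrite probability_setC// mI1 subee.
  apply: (@le_trans _ _ (M (fst @^-1` (~` I) `|` snd @^-1` (~` I)))).
    apply: le_measure; rewrite ?inE//; [exact: measurableC|exact: measurableU|].
    move=> x /=; have [h1|h1] := pselect (I x.1); last by left.
    have [h2|h2] := pselect (I x.2); last by right.
    by move=> h; exfalso; apply: h.
  apply: (le_trans (measureU2 M m1 m2)).
  have e1 := M1 _ (measurableC mI); have e2 := M2 _ (measurableC mI).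
  by rewrite [X in (X + _)%E]e1 [X in (_ + X)%E]e2 !z// adde0.
(* The cost is unbounded on the plane and f is Lipschitz only on [0,1]; restricting to the square
   changes nothing, as its complement is null for the coupling. *)
pose g (z : R * R) := \1_D z * `|z.1 - z.2|.
have mg : measurable_fun [set: R * R] (fun z : R * R => `|z.1 - z.2|).
  by apply: measurableT_comp => //; exact: measurable_funB.
have bg : bounded_measurable g.
  apply: (@bm_indic_mul _ _ _ _ _ 1 mD mg) => x [/=]; rewrite !in_itv/=.
  by move=> /andP[? ?] /andP[? ?]; rewrite normr_id ler_norml; lra.
have gc : \int[M]_z g z <= c.
  rewrite -lee_fin; apply: le_trans Mc; rewrite /Rintegral fineK; last first.
    by apply: integrable_fin_num => //; exact: bm_integrable.
  apply: ge0_le_integral => //.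
  - by move=> x _; rewrite lee_fin mulr_ge0// indicE.
  - by apply/measurable_EFinP; case: bg.
  - by apply/measurable_EFinP.
  - move=> x _; rewrite lee_fin /g indicE; case: (_ \in _); rewrite ?mul1r ?mul0r//.
rewrite E1 E2 -bm_intB//.
have bd : bounded_measurable (fun z : R * R => f z.1 - f z.2) by exact: bmB.
apply: (@le_trans _ _ (Lam * \int[M]_z g z)); last exact: ler_wpM2l.
have -> : \int[M]_z (f z.1 - f z.2) = \int[M]_z (\1_D z * (f z.1 - f z.2)).
  rewrite /Rintegral; congr fine; apply: ae_eq_integral => //.
  - by apply/measurable_EFinP; case: bd.
  - by apply/measurable_EFinP; case: (bmM (bm_indic R mD) bd).
  - exists (~` D); split => //; first exact: measurableC.
    move=> x /= h Dx; apply: h => _; rewrite indicE mem_set// mul1r.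
    by [].
rewrite -bm_intZ//; apply: bm_abs_le; [exact: bmM (bm_indic R mD) bd|exact: bmM (bm_cst _ _) bg|].
move=> x; rewrite /g indicE; have [/set_mem [/= h1 h2]|_] := boolP (x \in D).
  by rewrite !mul1r; apply: lip; move: h1 h2; rewrite !in_itv.
by rewrite !mul0r normr0 mulr0.
Qed.

Lemma d_W_ge0 mu nu : (0 <= d_W mu nu)%E.
Proof.
by apply: le_ereal_inf_tmp => _ [M _ <-]; apply: integral_ge0 => z _; rewrite lee_fin.
Qed.

Lemma d_W_close mu nu : mu `[0, 1]%classic = 1%E -> nu `[0, 1]%classic = 1%E ->
  d_W mu nu \is a fin_num -> lip01_close mu nu (fine (d_W mu nu)).
Proof.
move=> mu1 nu1 fW f Lam bf L0 lip; apply/ler_addgt0Pr => e e0.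
(* The infimum need not be attained; the denominator Lam + 1 also covers Lam = 0. *)
pose e' := e / (Lam + 1).
have L1 : 0 < Lam + 1 by lra.
have e'0 : 0 < e' by rewrite divr_gt0.
have : (ereal_inf [set (\int[M]_z `|z.1 - z.2|%:E)%E | M in is_coupling mu nu] <
    (fine (d_W mu nu) + e')%:E)%E.
  by rewrite EFinD fineK// -/(d_W mu nu) lteDl.
move=> /ereal_inf_lt[_ [M cM <-] /ltW Mc].
apply: (le_trans (coupling_close mu1 nu1 cM Mc bf L0 lip)).
rewrite mulrDr lerD2l /e' mulrA ler_pdivrMr// mulrC.
by apply: ler_wpM2l; [exact: ltW|lra].
Qed.

Lemma lip01_close_le mu nu (c c' : R) : c <= c' -> lip01_close mu nu c ->
  lip01_close mu nu c'.
Proof. by move=> cc h f Lam bf L0 lip; apply: (le_trans (h f Lam bf L0 lip)); exact: ler_wpM2l. Qed.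

(** The grid needs a scale that is an exact power of 1/l; rounding up costs a factor less than l. *)
Lemma geometric_scale (l delta : R) : 1 < l -> 0 < delta -> delta <= l ^- 2 ->
  exists2 N, (1 < N)%N & delta <= l ^- N < l * delta.
Proof.
move=> l1 d0 d2; have l0 : 0 < l by lra.
have [n hn] : exists n, l ^- n < delta.
  have h : (fun n => (l^-1) ^+ n) @ \oo --> (0 : R).
    by apply: cvg_expr; rewrite ger0_norm ?invr_ge0 ?(ltW l0)// invf_lt1.
  have [n _ hn] := @cvgr_lt _ _ _ _ _ _ h delta d0.
  by exists n; rewrite -exprVn; apply: hn => /=.
have ex : exists n, l ^- n < delta by exists n.
case: (ex_minnP ex) => m hm mmin.
have m2 : (2 < m)%N.
  rewrite ltnNge; apply/negP => h.
  have : l ^- 2 <= l ^- m by rewrite lef_pV2 ?posrE ?exprn_gt0// ler_weXn2l// ltW.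
  by move=> h'; have := le_lt_trans (le_trans d2 h') hm; rewrite ltxx.
exists m.-1; first by rewrite -ltnS prednK// (ltn_trans _ m2).
have hE : l ^- m.-1 = l * l ^- m.
  by rewrite -[m in RHS]prednK ?(ltn_trans _ m2)// exprS invfM mulrA mulfV ?mul1r// gt_eqF.
apply/andP; split; last by rewrite hE ltr_pM2l.
rewrite leNgt; apply/negP => /mmin.
by rewrite leqNgt prednK ?leqnn// (ltn_trans _ m2).
Qed.

Lemma tv_estimate lam (sg s K a Cs r L Cp : R) :
  kernel_bounds lam sg s K -> 0 < a -> 0 <= Cs -> 1 <= L -> 0 <= Cp ->
  a < (1 - s)^-1 * r -> exists C : R, 0 <= C /\
  forall mu mu' pi (delta : R), 0 <= delta ->
    local_smoothness mu' Cs r L -> local_smoothness pi Cs r L ->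
    logistic_step lam mu mu' -> logistic_step lam pi pi ->
    (forall sig, 0 < sig -> \int[pi]_t edge sig t <= Cp * sig `^ a) ->
    lip01_close mu pi (delta `^ (a + 1)) ->
    forall A, measurable A -> `|fine (mu' A) - fine (pi A)| <= C * delta `^ a.
Proof.
move=> kb a0 Cs0 L1 Cp0 ar.
have [C [C0 HC]] := continuous_estimate kb a0 Cs0 L1 Cp0 ar.
pose l := 1 + (8 * L)^-1.
have l1 : 1 < l by rewrite ltrDl invr_gt0 mulr_gt0//; lra.
have l0 : 0 < l by lra.
exists (C * l `^ a + (l ^+ 2) `^ a); split.
  by rewrite addr_ge0 ?mulr_ge0 ?powR_ge0.
move=> mu mu' pi delta dl0 lsm lsp st sp hp cl A mA.
(* Stated for every positive dl >= delta, so that a vanishing distance is reached as a limit. For dl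
   above l^(-2) the bound is trivial, thanks to the summand (l^2)^a of the constant. *)
have scale dl : delta <= dl -> 0 < dl ->
    `|fine (mu' A) - fine (pi A)| <= (C * l `^ a + (l ^+ 2) `^ a) * dl `^ a.
  move=> dd dl1; have [h|/ltW h] := leP dl (l ^- 2).
    have [N N1 /andP[h1 h2]] := geometric_scale l1 dl1 h.
    have clN : lip01_close mu pi ((l ^- N) `^ (a + 1)).
      apply: lip01_close_le cl; apply: ge0_ler_powR; rewrite ?nnegrE ?addr_ge0 ?(ltW a0)//.
        by rewrite invr_ge0 exprn_ge0// ltW.
      exact: le_trans h1.
    have := HC mu mu' pi N N1 lsm lsp st sp hp clN; rewrite -/l => g.
    apply: (le_trans (continuous_to_measurable mA g)).
    apply: (@le_trans _ _ (C * l `^ a * dl `^ a)); last first.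
      by rewrite mulrDl lerDl mulr_ge0 ?powR_ge0.
    rewrite -mulrA -powRM ?(ltW l0) ?(ltW dl1)//; apply: ler_wpM2l => //.
    apply: ge0_ler_powR; rewrite ?nnegrE ?(ltW a0) ?mulr_ge0 ?invr_ge0 ?exprn_ge0 ?(ltW l0) ?(ltW dl1)//.
    exact: ltW.
  apply: (@le_trans _ _ 1).
    have p (m : probability R R) : 0 <= fine (m A) <= 1.
      rewrite fine_ge0//= -lee_fin fineK; first exact: probability_le1.
      exact: fin_num_measure.
    by have := p mu'; have := p pi => /andP[? ?] /andP[? ?]; rewrite ler_norml; lra.
  apply: (@le_trans _ _ ((l ^+ 2) `^ a * dl `^ a)); last first.
    by rewrite mulrDl lerDr !mulr_ge0 ?powR_ge0.
  rewrite -powRM ?exprn_ge0 ?(ltW l0) ?(ltW dl1)//.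
  rewrite [leLHS](_ : 1 = 1 `^ a); last by rewrite powR1.
  apply: ge0_ler_powR; rewrite ?nnegrE ?(ltW a0) ?mulr_ge0 ?exprn_ge0 ?(ltW l0) ?(ltW dl1)//.
  by rewrite mulrC -ler_pdivrMr ?exprn_gt0// mul1r.
have [d0|] := ltP 0 delta; first exact: scale.
move=> d0; have -> : delta = 0 by apply/eqP; rewrite eq_le d0.
rewrite powR0 ?mulr0 ?gt_eqF//.
set C' := (C * l `^ a + (l ^+ 2) `^ a) in scale.
have C'0 : 0 <= C' by rewrite addr_ge0 ?mulr_ge0 ?powR_ge0.
(* When delta = 0 every positive scale is admissible; x is chosen so that the bound at scale x is
   below e. *)
apply/ler_addgt0Pr => e e0; rewrite add0r; pose x := (e / (C' + 1)) `^ a^-1.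
have x0 : 0 < x by rewrite powR_gt0// divr_gt0//; lra.
apply: (le_trans (scale x (le_trans d0 (ltW x0)) x0)).
rewrite /x -powRrM mulVf ?gt_eqF// powRr1; last by rewrite divr_ge0 ?(ltW e0)//; lra.
rewrite mulrA ler_pdivrMr; last by lra.
by rewrite mulrC; apply: ler_wpM2l; [exact: ltW|lra].
Qed.

End couplings.

(* [lebesgue_measure] lives on [measurableTypeR R] rather than on the canonical
   measurable structure of [R], so that the Radon-Nikodym theorem only applies to
   a copy of [m] there. *)
Section borel_copy.
Variables (R : realType) (m : probability R R).

Definition borel_copy : set (measurableTypeR R) -> \bar R := m.

Let copy0 : borel_copy set0 = 0%E. Proof. exact: (measure0 m). Qed.
Let copy_ge0 A : (0 <= borel_copy A)%E. Proof. exact: (measure_ge0 m). Qed.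
Let copy_additive : semi_sigma_additive borel_copy.
Proof. exact: (@measure_semi_sigma_additive _ _ _ m). Qed.

HB.instance Definition _ := isMeasure.Build _ (measurableTypeR R) R borel_copy
  copy0 copy_ge0 copy_additive.

Let copy_fin : fin_num_fun borel_copy.
Proof. by move=> A mA; exact: (@fin_num_measure _ _ _ m A mA). Qed.

HB.instance Definition _ :=
  @Measure_isFinite.Build _ (measurableTypeR R) R borel_copy copy_fin.

Let idR : R -> measurableTypeR R := idfun.

Let midR : measurable_fun setT idR.
Proof. by move=> _ A mA; rewrite setTI. Qed.

Lemma borel_copy_integrable (D : set R) (f : R -> R) : measurable D ->
  m.-integrable D (EFin \o f) -> borel_copy.-integrable D (EFin \o f).
Proof.
move=> mD /integrableP[mf fi]; apply/integrableP; split; first exact: mf.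
apply: le_lt_trans fi.
have mf' : measurable_fun D (fun x => `|(f x)%:E|)%E by exact: measurableT_comp.
rewrite -[leRHS](@ge0_integral_pushforward _ _ _ _ R _ midR m D (fun x => `|(f x)%:E|)%E)//.
Qed.

Lemma borel_copy_integral (D : set R) (f : R -> R) : measurable D ->
  measurable_fun setT f ->
  m.-integrable D (EFin \o f) ->
  (\int[m]_(x in D) (f x)%:E = \int[borel_copy]_(x in D) (f x)%:E)%E.
Proof.
move=> mD mf fi.
rewrite -[LHS](@integral_pushforward _ _ _ _ R _ midR m D (EFin \o f))//.
exact/measurable_EFinP.
Qed.

End borel_copy.

(** * Beta laws as weighted Lebesgue measures *)

Section beta_density.
Variable R : realType.
Implicit Types m : probability R R.
Local Notation leb := (@lebesgue_measure R).

Definition beta_law (p q : R) m := forall A : set R, measurable A ->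
  m A = (\int[leb]_(t in A) (Beta_density p q t)%:E)%E.

Lemma measurable_Beta_density (p q : R) : measurable_fun [set: R] (Beta_density p q).
Proof.
have -> : Beta_density p q = (fun t => \1_(`[(0 : R), 1]%classic) t *
    (Gamma (p + q) / (Gamma p * Gamma q) * t `^ (p - 1) * (1 - t) `^ (q - 1))).
  apply/funext => t; rewrite /Beta_density indicE mem_setE in_itv/=.
  by case: ifP => _; rewrite ?mul1r ?mul0r.
apply: measurable_funM; first exact: measurable_indic.
apply: measurable_funM; first apply: measurable_funM => //.
by apply: (measurableT_comp (measurable_powR (q - 1))); exact: measurable_funB.
Qed.

Lemma Gamma_ge0 (p : R) : 0 <= Gamma p.
Proof.
apply: Rintegral_ge0 => // t _; apply: mulr_ge0; first exact: powR_ge0.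
exact: expR_ge0.
Qed.

Lemma Beta_density_ge0 (p q t : R) : 0 <= Beta_density p q t.
Proof.
rewrite /Beta_density; case: ifP => // _.
by rewrite !mulr_ge0 ?powR_ge0 ?invr_ge0 ?mulr_ge0 ?Gamma_ge0.
Qed.

(** The law is dominated by Lebesgue measure, and its Radon-Nikodym derivative agrees almost
    everywhere on D with [Beta_density], both having the same integrals over measurable subsets. *)
Lemma beta_law_integral (p q : R) m (D : set R) (f : R -> R) :
  beta_law p q m -> measurable D -> bounded_measurable (fun x => \1_D x * f x) ->
  measurable_fun setT f ->
  \int[m]_(x in D) f x = \int[leb]_(x in D) (f x * Beta_density p q x).
Proof.
move=> h mD bf mf.
have dom : m `<< leb.
  apply/null_content_dominatesP => A mA A0.
  rewrite h//; apply: null_set_integral => //.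
  by apply/measurable_EFinP/measurable_funTS; exact: measurable_Beta_density.
have iD : m.-integrable D (EFin \o f).
  have : m.-integrable D (EFin \o (fun x => \1_D x * f x)) by exact: bm_integrable.
  by apply: eq_integrable => // x xD /=; rewrite indicE xD mul1r.
rewrite /Rintegral; congr fine.
have domn : borel_copy m `<< leb by [].
rewrite borel_copy_integral// -[LHS](Radon_Nikodym_change_of_variables domn)//; last first.
  exact: borel_copy_integrable.
under [RHS]eq_integral do rewrite EFinM.
apply: ae_eq_integral => //.
- apply: emeasurable_funM; first by apply/measurable_EFinP; exact: measurable_funTS.
  apply: (measurable_int leb).
  apply: (integrableS _ _ (@subsetT _ _)) => //=.
  exact: Radon_Nikodym_integrable.
- apply: emeasurable_funM; apply/measurable_EFinP; apply: measurable_funTS => //.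
  exact: measurable_Beta_density.
- apply: ae_eqe_mul2l => /=.
  rewrite Radon_NikodymE//=.
  case: cid => /= g [h1 h2 h3].
  apply: integral_ae_eq => //=.
  + exact: integrableS h2.
  + by apply/measurable_funTS/measurableT_comp => //; exact: measurable_Beta_density.
  + by move=> A AD mA; rewrite -h3//=; exact: h.
Qed.

End beta_density.

Section interval_integrals.
Variable R : realType.
Local Notation leb := (@lebesgue_measure R).

Lemma continuous_within_itv (f : R -> R) (x y : R) :
  (forall t, x <= t <= y -> {for t, continuous f}) -> {within `[x, y], continuous f}.
Proof.
move=> h; apply: continuous_in_subspaceT => t; rewrite inE/= in_itv/=; exact: h.
Qed.

Lemma FTC_interval (F f : R -> R) (x y : R) : x < y ->
  (forall t, x <= t <= y -> is_derive t 1 F (f t)) ->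
  (forall t, x <= t <= y -> {for t, continuous f}) ->
  \int[leb]_(t in `[x, y]) f t = F y - F x.
Proof.
move=> xy dF cf; have cF t : x <= t <= y -> {for t, continuous F}.
  move=> /dF dt; apply: differentiable_continuous; apply/derivable1_diffP.
  exact: (@ex_derive _ _ _ _ _ _ _ dt).
have lxx : x <= x <= y by rewrite lexx ltW.
have lyy : x <= y <= y by rewrite lexx ltW.
rewrite /Rintegral (continuous_FTC2 xy (continuous_within_itv cf) (F := F))//.
  split.
  - move=> t; rewrite in_itv/= => /andP[/ltW h1 /ltW h2].
    have := dF t; rewrite h1 h2 => /(_ isT) dt; exact: (@ex_derive _ _ _ _ _ _ _ dt).
  - by apply: cvg_at_right_filter; exact: cF.
  - by apply: cvg_at_left_filter; exact: cF.
move=> t; rewrite in_itv/= => /andP[/ltW h1 /ltW h2].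
rewrite derive1E; have := dF t; rewrite h1 h2 => /(_ isT) dt.
exact: (@derive_val _ _ _ _ _ _ _ dt).
Qed.

Lemma bm_itv_continuous (f : R -> R) (x y : R) : x <= y ->
  (forall t, x <= t <= y -> {for t, continuous f}) -> measurable_fun setT f ->
  bounded_measurable (fun t => \1_(`[x, y]%classic) t * f t).
Proof.
move=> xy cf mf.
have cn t : x <= t <= y -> {for t, continuous (fun t => `|f t|)}.
  by move=> h; apply: (@cvg_norm _ R^o); exact: cf.
have [c _ hc] := EVT_max xy (continuous_within_itv cn).
apply: (@bm_indic_mul _ _ _ _ _ (`|f c|)) => // t /= h; exact: hc.
Qed.

End interval_integrals.

(** * The Beta weight and integration by parts inside ]0,1[ *)

Section beta_weight.
Variable R : realType.
Implicit Types m : probability R R.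
Local Notation leb := (@lebesgue_measure R).

Definition beta_const (p q : R) := Gamma (p + q) / (Gamma p * Gamma q).

Definition beta_weight (p q t : R) := beta_const p q * t `^ (p - 1) * (1 - t) `^ (q - 1).

Definition beta_dlog (p q t : R) := (p - 1) / t - (q - 1) / (1 - t).

Lemma beta_const_ge0 p q : 0 <= beta_const p q.
Proof. by apply: divr_ge0; [|apply: mulr_ge0]; exact: Gamma_ge0. Qed.

Lemma beta_weight_ge0 p q t : 0 <= beta_weight p q t.
Proof. by do 2 ?[apply: mulr_ge0]; rewrite ?powR_ge0// beta_const_ge0. Qed.

Lemma is_derive_beta_weight (p q t : R) : 0 < t -> t < 1 ->
  is_derive t 1 (beta_weight p q) (beta_weight p q t * beta_dlog p q t).
Proof.
move=> t0 t1; have u0 : 0 < 1 - t by rewrite subr_gt0.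
have h1 := is_derive1_powR (p - 1) t0.
have h2 : is_derive t 1 (fun t : R => (1 - t) `^ (q - 1)) (- ((q - 1) * (1 - t) `^ (q - 1 - 1))).
  have ho : is_derive t 1 (fun x : R => 1 - x) (-1).
    by have := is_derive_onemr 1 t; under eq_fun do rewrite mul1r.
  have := @is_derive1_comp R (fun x : R => x `^ (q - 1)) (fun x : R => 1 - x) t _ _
    (is_derive1_powR (q - 1) u0) ho.
  by rewrite mulrN1.
have h3 := is_derive_mul (is_derive_mul (is_derive_cst (beta_const p q) t 1) h1) h2.
apply: (is_derive_eq h3); rewrite mul0r add0r /beta_weight /beta_dlog.
have e1 : t `^ (p - 1 - 1) = t `^ (p - 1) / t.
  by rewrite powRB ?powRr1 ?(ltW t0)// (gt_eqF t0) implybT.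
have e2 : (1 - t) `^ (q - 1 - 1) = (1 - t) `^ (q - 1) / (1 - t).
  by rewrite powRB ?powRr1 ?(ltW u0)// (gt_eqF u0) implybT.
by rewrite e1 e2 /=; field; rewrite !gt_eqF.
Qed.

Lemma continuous_beta_dlog (p q t : R) : 0 < t -> t < 1 ->
  {for t, continuous (beta_dlog p q)}.
Proof.
move=> t0 t1; apply: (@cvgB _ R^o).
  by apply: cvgM; [exact: cvg_cst|apply: cvgV; [rewrite gt_eqF|exact: cvg_id]].
apply: cvgM; first exact: cvg_cst.
apply: cvgV; first by rewrite gt_eqF// subr_gt0.
by apply: (@cvgB _ R^o); [exact: cvg_cst|exact: cvg_id].
Qed.

Lemma measurable_beta_dlog (p q : R) : measurable_fun setT (beta_dlog p q).
Proof.
apply: measurable_funB; apply: measurable_funM => //; apply: measurable_funV => //.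
exact: measurable_funB.
Qed.

(** The fundamental theorem for h times the weight, read as an expectation. Mass bounds, moment
    recursions and [kb_ibp] all come from this identity with suitable h, which keeps the Gamma
    factors inside one constant. *)
Lemma beta_interval_ibp p q m (h dh : R -> R) x y : beta_law p q m ->
  0 < x -> x < y -> y < 1 -> (forall t : R, is_derive t 1 h (dh t)) -> continuous dh ->
  \int[m]_(t in `[x, y]) (dh t + h t * beta_dlog p q t) =
  h y * beta_weight p q y - h x * beta_weight p q x.
Proof.
move=> bl x0 xy y1 hh cdh; have ch := is_derive_continuous hh.
have i01 t : x <= t <= y -> 0 < t /\ t < 1.
  by move=> /andP[h1 h2]; split; [exact: lt_le_trans h1|exact: le_lt_trans y1].
have cf t : x <= t <= y -> {for t, continuous (fun t => dh t + h t * beta_dlog p q t)}.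
  move=> /i01[t0 t1]; apply: (@cvgD _ R^o); first exact: cdh.
  by apply: cvgM; [exact: ch|exact: continuous_beta_dlog].
have mf : measurable_fun setT (fun t => dh t + h t * beta_dlog p q t).
  apply: measurable_funD; first exact: continuous_measurable_fun.
  by apply: measurable_funM; [exact: continuous_measurable_fun|exact: measurable_beta_dlog].
rewrite (beta_law_integral bl)//; last exact: bm_itv_continuous (ltW xy) cf mf.
have -> : \int[leb]_(t in `[x, y]) ((dh t + h t * beta_dlog p q t) * Beta_density p q t) =
    \int[leb]_(t in `[x, y]) ((dh t + h t * beta_dlog p q t) * beta_weight p q t).
  apply: eq_Rintegral => t; rewrite inE/= in_itv/= => /i01[t0 t1].
  by rewrite /Beta_density !ltW.
apply: (@FTC_interval _ (fun t => h t * beta_weight p q t) _ _ _ xy) => t ht.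
  have [t0 t1] := i01 t ht.
  apply: (is_derive_eq (is_derive_mul (hh t) (is_derive_beta_weight p q t0 t1))).
  by ring.
have [t0 t1] := i01 t ht; apply: cvgM; first exact: cf.
have dw := is_derive_beta_weight p q t0 t1.
apply: differentiable_continuous; apply/derivable1_diffP.
exact: (@ex_derive _ _ _ _ _ _ _ dw).
Qed.

Lemma beta_law_itv01 p q m : beta_law p q m -> m `[0, 1]%classic = 1%E.
Proof.
move=> bl; rewrite bl// -(_ : m setT = 1%E); last exact: probability_setT.
rewrite bl// integral_mkcond; apply: eq_integral => t _.
rewrite patchE mem_setE in_itv/= /Beta_density.
by case: (0 <= t <= 1).
Qed.

Lemma beta_law_set1 p q m x : beta_law p q m -> m [set x] = 0%E.
Proof.
move=> bl; rewrite bl//; apply: null_set_integral => //.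
  by apply/measurable_EFinP/measurable_funTS; exact: measurable_Beta_density.
exact: lebesgue_measure_set1.
Qed.

(** Positivity follows from the total mass being 1, with no evaluation of the Gamma integrals. *)
Lemma beta_const_gt0 p q m : beta_law p q m -> 0 < beta_const p q.
Proof.
move=> bl; rewrite lt_neqAle beta_const_ge0 andbT; apply/eqP => c0.
have := probability_setT m; rewrite bl// integral0_eq => [/eqP|t _].
  by rewrite eq_sym onee_eq0.
by rewrite /Beta_density -/(beta_const p q) -c0 !mul0r if_same.
Qed.

End beta_weight.

(** * Integration by parts on the whole of [0,1] *)

Section beta_moments.
Variable R : realType.
Implicit Types m : probability R R.

Lemma beta_weight_right p q (y : R) : 0 <= y -> y < 1 ->
  (1 - y) * beta_weight p q y = beta_const p q * y `^ (p - 1) * (1 - y) `^ q.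
Proof.
move=> y0 y1; have u0 : 0 < 1 - y by rewrite subr_gt0.
rewrite /beta_weight; have -> : (1 - y) `^ (q - 1) = (1 - y) `^ q / (1 - y).
  by rewrite powRB ?powRr1 ?(ltW u0)// (gt_eqF u0) implybT.
by field; rewrite gt_eqF.
Qed.

Lemma beta_weight_left p q (y : R) : 0 < y -> y <= 1 ->
  y * beta_weight p q y = beta_const p q * y `^ p * (1 - y) `^ (q - 1).
Proof.
move=> y0 y1.
rewrite /beta_weight; have -> : y `^ (p - 1) = y `^ p / y.
  by rewrite powRB ?powRr1 ?(ltW y0)// (gt_eqF y0) implybT.
by field; rewrite gt_eqF.
Qed.

Lemma powR_cvg0 (u_ : nat -> R) (q : R) : 0 < q -> (forall n, 0 <= u_ n) ->
  u_ @ \oo --> (0 : R) -> (fun n => u_ n `^ q) @ \oo --> (0 : R).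
Proof.
move=> q0 u0 cu; apply/cvgrPdist_lt => e e0.
have e'0 : 0 < e `^ q^-1 by exact: powR_gt0.
have [N _ h] := @cvgr_lt _ _ _ _ _ _ cu _ e'0.
exists N => // n /= Nn; rewrite sub0r normrN ger0_norm ?powR_ge0//.
have -> : e = (e `^ q^-1) `^ q by rewrite -powRrM mulVf ?gt_eqF// powRr1// ltW.
by apply: gt0_ltr_powR; rewrite ?nnegrE ?powR_ge0// h.
Qed.

Lemma cvg_harmonic0 : (fun n => (n.+3%:R)^-1) @ \oo --> (0 : R).
Proof. have := @cvg_harmonic R.
by rewrite -(cvg_shiftS (@harmonic R)) -(cvg_shiftS (fun n => @harmonic R n.+1)). Qed.

Lemma beta_law_ends p q m : beta_law p q m -> m (~` `]0, 1[%classic) = 0%E.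
Proof.
move=> bl; have mC : measurable (~` `[0, 1]%classic : set R) by exact: measurableC.
have mU : measurable (~` `[0, 1]%classic `|` [set 0] : set R) by exact: measurableU.
have m01 : m (~` `[0, 1]%classic) = 0%E.
  by rewrite probability_setC// (beta_law_itv01 bl) subee.
apply/eqP; rewrite eq_le measure_ge0 andbT.
apply: (@le_trans _ _ (m ((~` `[0, 1]%classic `|` [set 0]) `|` [set 1]))).
  apply: le_measure; rewrite ?inE//; [exact: measurableC|exact: measurableU|].
  move=> t /=; rewrite !in_itv/= => h; have [->|t0] := eqVneq t 0; first by left; right.
  have [->|t1] := eqVneq t 1; first by right.
  left; left => /andP[h1 h2]; apply: h.
  by rewrite !lt_neqAle eq_sym t0 h1 t1 h2.
apply: (le_trans (measureU2 m mU (measurable_set1 _))).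
have e1 := beta_law_set1 1 bl; rewrite [X in (_ + X)%E]e1 adde0.
apply: (le_trans (measureU2 m mC (measurable_set1 _))).
have e2 := beta_law_set1 0 bl; by rewrite [X in (_ + X)%E]e2 adde0 [X in (X <= _)%E]m01.
Qed.

(** A Beta law gives no mass to the endpoints or outside, so interior intervals exhaust it; the
    shift by 3 keeps 1/(n+3) below 1/2 and the interval nondegenerate. *)
Lemma bm_int_exhaust p q m (f : R -> R) : beta_law p q m -> bounded_measurable f ->
  (fun n => \int[m]_(t in `[n.+3%:R^-1, 1 - n.+3%:R^-1]) f t) @ \oo --> \int[m]_t f t.
Proof.
move=> bl bf; have mI : measurable (`]0, 1[%classic : set R) by [].
have bI := bm_indic R mI; have [mf [M fM]] := bf.
have M0 : 0 <= M by exact: le_trans (fM 0).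
have -> : \int[m]_t f t = \int[m]_t (\1_(`]0, 1[%classic) t * f t).
  apply/eqP; rewrite -subr_eq0 -normr_le0 -bm_intB//; last exact: bmM.
  have mC : measurable (~` `]0, 1[%classic : set R) by exact: measurableC.
  rewrite [leRHS](_ : 0 = M * fine (m (~` `]0, 1[%classic))); last first.
    by have e0 := beta_law_ends bl; rewrite [X in fine X]e0 mulr0.
  rewrite -prob_indic// -bm_intZ//; last exact: bm_indic.
  apply: bm_abs_le; [by apply: bmB => //; exact: bmM|exact: bmM (bm_cst _ _) (bm_indic _ _)|].
  move=> t; rewrite !indicE in_setC; case: (t \in _) => /=.
    by rewrite mul1r subrr normr0 mulr0.
  by rewrite mul0r subr0 mulr1.
under eq_fun do rewrite bm_int_mkcond.
apply: (@bm_dominated_cvg _ _ _ _ _ _ M).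
- by move=> n; case: (bmM (bm_indic R (measurable_itv `[n.+3%:R^-1, 1 - n.+3%:R^-1])) bf).
- move=> n t; rewrite indicE; case: (_ \in _) => /=; first by rewrite mul1r.
  by rewrite mul0r normr0.
- move=> t; have [ht|ht] := boolP (t \in `]0, 1[%classic); last first.
    apply: (@cvg_near_cst _ _ _ _ _ _ _); exists 0%N => // n _.
    rewrite !indicE (negbTE ht) (_ : t \in _ = false) ?mul0r//.
    apply/negbTE; apply: contra ht; rewrite !inE/= !in_itv/= => /andP[h1 h2].
    have n0 : 0 < (n.+3%:R : R)^-1 by rewrite invr_gt0.
    by rewrite (lt_le_trans n0 h1)/= (le_lt_trans h2)// ltrBlDr ltrDl.
  move: (ht); rewrite inE/= in_itv/= => /andP[t0 t1].
  have e0 : 0 < Num.min t (1 - t) by rewrite lt_min t0 subr_gt0.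
  have [N _ hN] := @cvgr_lt _ _ _ _ _ _ cvg_harmonic0 _ e0.
  apply: (@cvg_near_cst _ _ _ _ _ _ _); exists N => // n /= Nn.
  have := hN n Nn; rewrite /= lt_min => /andP[h1 h2].
  have hi : t \in `[n.+3%:R^-1, 1 - n.+3%:R^-1]%classic.
    by rewrite inE/= in_itv/= ltW//= lerBrDr -lerBrDl ltW.
  by rewrite !indicE ht hi.
Qed.

(** The interval identity applied to h t(1-t): the boundary terms are O(y^p (1-y)^q), which tends to
    0 at both ends as p, q > 0, and the factor t(1-t) cancels the poles of the logarithmic
    derivative. *)
Lemma beta_ibp p q m (h dh : R -> R) : 0 < p -> 0 < q -> beta_law p q m ->
  (forall t : R, is_derive t 1 h (dh t)) -> continuous dh ->
  (exists M, forall t, 0 <= t <= 1 -> `|h t| <= M) -> 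
  bounded_measurable (fun t : R => \1_(`[0, 1]%classic) t *
    (dh t * (t * (1 - t)) + h t * (p - (p + q) * t))) ->
  \int[m]_(t in `[0, 1]) (dh t * (t * (1 - t)) + h t * (p - (p + q) * t)) = 0.
Proof.
move=> p0 q0 bl hh cdh [M hM] bf.
pose w (t : R) := t * (1 - t).
have dw (t : R) : is_derive t 1 w (1 - 2 * t).
  have ho : is_derive t 1 (fun x : R => 1 - x) (-1).
    by have := is_derive_onemr 1 t; under eq_fun do rewrite mul1r.
  by apply: (is_derive_eq (is_derive_mul (is_derive_id t 1) ho)); ring.
have cw := is_derive_continuous dw; have ch := is_derive_continuous hh.
pose k t := h t * w t; pose dk t := dh t * w t + h t * (1 - 2 * t).
have dkP (t : R) : is_derive t 1 k (dk t) by exact: is_derive_mul.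
have cdk : continuous dk.
  move=> t; apply: (@cvgD _ R^o).
    by apply: cvgM; [exact: cdh|exact: cw].
  apply: cvgM; first exact: ch.
  apply: (@cvgB _ R^o); first exact: cvg_cst.
  by apply: cvgM; [exact: cvg_cst|exact: cvg_id].
have cv := bm_int_exhaust bl bf.
pose e n : R := n.+3%:R^-1.
have e0 n : 0 < e n by rewrite invr_gt0.
have e2 n : e n <= 3^-1 by rewrite lef_pV2 ?posrE// ler_nat.
have E n : \int[m]_(t in `[e n, 1 - e n]) (\1_(`[0, 1]%classic) t *
    (dh t * (t * (1 - t)) + h t * (p - (p + q) * t))) =
    \int[m]_(t in `[e n, 1 - e n]) (dk t + k t * beta_dlog p q t).
  apply: eq_Rintegral => t; rewrite inE/= in_itv/= => /andP[t1 t2].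
  have a0 : 0 < t by exact: lt_le_trans t1.
  have a1 : t < 1 by have := e0 n; lra.
  rewrite indicE mem_set ?mul1r/=; last by rewrite in_itv/= !ltW.
  rewrite /dk /k /w /beta_dlog; field.
  by rewrite !gt_eqF// subr_gt0.
have {}cv : (fun n => \int[m]_(t in `[e n, 1 - e n]) (dk t + k t * beta_dlog p q t))
    @ \oo --> \int[m]_t (\1_(`[0, 1]%classic) t *
    (dh t * (t * (1 - t)) + h t * (p - (p + q) * t))).
  by rewrite -(funext E).
rewrite bm_int_mkcond; apply: (cvg_unique _ cv) => // {cv}.
pose c := beta_const p q; have c0 : 0 <= c := beta_const_ge0 p q.
have M0 : 0 <= M by apply: le_trans (hM 0 _); rewrite ?lexx ?ler01.
have wW y : 0 < y -> y < 1 -> `|k y * beta_weight p q y| <= M * c * (y `^ p * (1 - y) `^ q).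
  move=> y0 y1; have u0 : 0 < 1 - y by rewrite subr_gt0.
  have -> : k y * beta_weight p q y = h y * (c * (y `^ p * (1 - y) `^ q)).
    have eq1 := beta_weight_right p q (ltW y0) y1.
    rewrite [LHS](_ : _ = h y * (y * ((1 - y) * beta_weight p q y))); last by rewrite /k /w; ring.
    by rewrite eq1 -(mulr_powRB1 (ltW y0) p0) /c; ring.
  rewrite normrM -[leRHS]mulrA; apply: ler_pM => //; first by apply: hM; rewrite !ltW.
  have g0 : 0 <= c * (y `^ p * (1 - y) `^ q) by apply: mulr_ge0 => //; apply: mulr_ge0; exact: powR_ge0.
  by rewrite ger0_norm.
have p1 (y r : R) : 0 <= y <= 1 -> 0 < r -> y `^ r <= 1.
  move=> /andP[y0 y1] r0; rewrite [leRHS](_ : 1 = 1 `^ r); last by rewrite powR1.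
  by apply: ge0_ler_powR; rewrite ?nnegrE// ltW.
have B n : `|\int[m]_(t in `[e n, 1 - e n]) (dk t + k t * beta_dlog p q t)| <=
    M * c * (e n `^ q + e n `^ p).
  have n0 := e0 n; have n2 := e2 n.
  have lt : e n < 1 - e n by lra.
  have ee1 : e n < 1 by lra.
  have ee0 : 0 < 1 - e n by lra.
  have ee2 : 1 - e n < 1 by lra.
  rewrite (beta_interval_ibp bl (e0 n) lt _ dkP cdk)//.
  apply: (le_trans (ler_normB _ _)); rewrite mulrDr; apply: lerD.
    apply: (le_trans (wW _ ee0 ee2)); rewrite subKr.
    apply: ler_wpM2l; first exact: mulr_ge0.
    by apply: ler_piMl; [exact: powR_ge0|apply: p1 => //; rewrite !ltW].
  apply: (le_trans (wW _ n0 ee1)).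
  apply: ler_wpM2l; first exact: mulr_ge0.
  by apply: ler_piMr; [exact: powR_ge0|apply: p1 => //; rewrite !ltW].
apply: norm_cvg0; apply: (@squeeze_cvgr _ _ _ _ (fun=> 0) (fun n => M * c * (e n `^ q + e n `^ p))).
- by apply: nearW => n; rewrite normr_ge0 B.
- exact: cvg_cst.
- rewrite -[X in _ --> X](mulr0 (M * c)); apply: cvgM; first exact: cvg_cst.
  rewrite -[X in _ --> X](addr0 0); apply: cvgD;
    by apply: powR_cvg0 => //; [move=> n; exact: ltW|exact: cvg_harmonic0].
Qed.

End beta_moments.

(** * Masses of Beta laws near the endpoints *)

Section beta_kernel.
Variable R : realType.
Implicit Types m : probability R R.
Local Notation leb := (@lebesgue_measure R).

Lemma prob_fine01 m (A : set R) : measurable A -> 0 <= fine (m A) <= 1.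
Proof.
move=> mA; rewrite fine_ge0//= -lee_fin fineK; first exact: probability_le1.
exact: fin_num_measure.
Qed.

Lemma prob_fine_le m (A B : set R) : measurable A -> measurable B -> A `<=` B ->
  fine (m A) <= fine (m B).
Proof.
move=> mA mB AB; apply: fine_le; rewrite ?fin_num_measure//.
by apply: le_measure; rewrite ?inE.
Qed.

Lemma powR_itv01 (t r : R) : 0 <= t <= 1 -> 0 <= r -> t `^ r <= 1.
Proof.
move=> /andP[t0 t1] r0; rewrite [leRHS](_ : 1 = 1 `^ r); last by rewrite powR1.
by apply: ge0_ler_powR; rewrite ?nnegrE.
Qed.

Lemma powR_le2 (p t : R) : 0 < p -> 1 / 2 <= t -> t <= 1 -> t `^ (p - 1) <= 2.
Proof.
move=> p0 t2 t1; have t0 : 0 < t by lra.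
have -> : t `^ (p - 1) = t `^ p / t.
  by rewrite powRB ?powRr1 ?(ltW t0)// (gt_eqF t0) implybT.
rewrite ler_pdivrMr//; apply: (@le_trans _ _ 1); last lra.
by apply: powR_itv01; rewrite ?(ltW t0)// ltW.
Qed.

Lemma beta_exhaust_le p q m (A : set R) (w : R) : beta_law p q m -> measurable A ->
  (forall u v, 0 < u -> u < v -> v < 1 -> fine (m (A `&` `[u, v]%classic)) <= w) ->
  fine (m A) <= w.
Proof.
move=> bl mA h; rewrite -prob_indic//.
have cv := bm_int_exhaust bl (bm_indic R mA).
apply: (cvgr_to_le cv); apply: nearW => n.
have n0 : 0 < (n.+3%:R : R)^-1 by rewrite invr_gt0.
have n3 : (n.+3%:R : R)^-1 <= 3^-1 by rewrite lef_pV2 ?posrE// ler_nat.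
move: n0 n3; set e := (_^-1) => n0 n3.
have -> : \int[m]_(t in `[e, 1 - e]) \1_A t = fine (m (A `&` `[e, 1 - e]%classic)).
  rewrite bm_int_mkcond -prob_indic; last exact: measurableI.
  by apply: eq_Rintegral => t _; rewrite indicI mulrC.
by apply: h => //; lra.
Qed.

Lemma int_ge_cst m (x y c : R) (f : R -> R) :
  bounded_measurable (fun t => \1_(`[x, y]%classic) t * f t) ->
  (forall t, x <= t <= y -> c <= f t) ->
  c * fine (m `[x, y]%classic) <= \int[m]_(t in `[x, y]) f t.
Proof.
move=> bf h; rewrite -prob_indic// -bm_intZ; last exact: bm_indic.
rewrite (bm_int_mkcond m `[x, y]%classic); apply: bm_le => //.
  by apply: bmM; [exact: bm_cst|exact: bm_indic].
move=> t; rewrite indicE; have [/set_mem/=|_] := boolP (t \in _); last by rewrite mulr0 mul0r.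
by rewrite in_itv/= mulr1 mul1r; exact: h.
Qed.

Lemma int_le_cst m (x y c : R) (f : R -> R) :
  bounded_measurable (fun t => \1_(`[x, y]%classic) t * f t) ->
  (forall t, x <= t <= y -> f t <= c) ->
  \int[m]_(t in `[x, y]) f t <= c * fine (m `[x, y]%classic).
Proof.
move=> bf h; rewrite -prob_indic// -bm_intZ; last exact: bm_indic.
rewrite (bm_int_mkcond m `[x, y]%classic); apply: bm_le => //.
  by apply: bmM; [exact: bm_cst|exact: bm_indic].
move=> t; rewrite indicE; have [/set_mem/=|_] := boolP (t \in _); last by rewrite mulr0 mul0r.
by rewrite in_itv/= mulr1 mul1r; exact: h.
Qed.

Lemma bm_beta_test p q (h dh : R -> R) (x y : R) : 0 < x -> x <= y -> y < 1 ->
  (forall t : R, is_derive t 1 h (dh t)) -> continuous dh ->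
  bounded_measurable (fun t => \1_(`[x, y]%classic) t * (dh t + h t * beta_dlog p q t)).
Proof.
move=> x0 xy y1 hh cdh; have ch := is_derive_continuous hh.
apply: bm_itv_continuous => //.
  move=> t /andP[h1 h2]; apply: (@cvgD _ R^o); first exact: cdh.
  apply: cvgM; [exact: ch|apply: continuous_beta_dlog].
    exact: lt_le_trans h1.
  exact: le_lt_trans y1.
apply: measurable_funD; first exact: continuous_measurable_fun.
by apply: measurable_funM; [exact: continuous_measurable_fun|exact: measurable_beta_dlog].
Qed.

Lemma beta_dlog_right p q (t : R) : 0 < t -> t < 1 ->
  1 + (t - 1) * beta_dlog p q t = q - (p - 1) * ((1 - t) / t).
Proof.
move=> t0 t1; have u0 : 1 - t != 0 by rewrite subr_eq0 gt_eqF.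
by rewrite /beta_dlog; field; rewrite u0 gt_eqF.
Qed.

Lemma beta_dlog_left p q (t : R) : 0 < t -> t < 1 ->
  1 + t * beta_dlog p q t = p - (q - 1) * (t / (1 - t)).
Proof.
move=> t0 t1; have u0 : 1 - t != 0 by rewrite subr_eq0 gt_eqF.
by rewrite /beta_dlog; field; rewrite u0 gt_eqF.
Qed.

(** With the test function t - 1 the integrand is q - (p-1)(1-t)/t, at least q/2 near 1, so the mass
    is at most 2/q times a boundary term of order h^q. The mass near 0 is treated in the same way
    with the test function t. *)
Lemma beta_mass_right p q : 0 < p -> 0 < q -> exists C : R, 0 <= C /\ forall m,
  beta_law p q m -> forall h, 0 < h <= 1 -> fine (m `[1 - h, 1]%classic) <= C * h `^ q.
Proof.
move=> p0 q0; pose P := `|p - 1| + 1; pose c := beta_const p q.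
have P1 : 1 <= P by rewrite lerDr.
have c0 : 0 <= c := beta_const_ge0 p q.
(* Small enough for |p-1|(1-t)/t <= q/2 when 1-t <= h0; larger h are covered by the summand h0^(-q)
   of the constant. *)
pose h0 := Num.min (2^-1 : R) (q / (4 * P)).
have h00 : 0 < h0 by rewrite lt_min invr_gt0 ltr0n/= divr_gt0// mulr_gt0//; lra.
have h02 : h0 <= 2^-1 by rewrite ge_min lexx.
have h0q : h0 * (4 * P) <= q.
  by rewrite -ler_pdivlMr ?ge_min ?lexx ?orbT//; apply: mulr_gt0 => //; lra.
exists (4 * c / q + h0 `^ (- q)).
have t1 : 0 <= 4 * c / q by apply: divr_ge0; [exact: mulr_ge0|exact: ltW].
split; first by apply: addr_ge0 => //; exact: powR_ge0.
move=> m bl h /andP[hp h1]; have hq : 0 <= h `^ q by exact: powR_ge0.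
rewrite mulrDl; have [hh|hh] := leP h h0; last first.
  apply: (@le_trans _ _ 1); first by case/andP: (prob_fine01 m (measurable_itv `[1 - h, 1])).
  have : 1 <= h0 `^ (- q) * h `^ q.
    rewrite powRN mulrC ler_pdivlMr ?powR_gt0// mul1r.
    by apply: ge0_ler_powR; rewrite ?nnegrE ?(ltW q0) ?(ltW h00) ?(ltW hp)// ltW.
  have : 0 <= 4 * c / q * h `^ q by exact: mulr_ge0.
  by lra.
apply: (@le_trans _ _ (4 * c / q * h `^ q)); last first.
  by rewrite lerDl; apply: mulr_ge0 => //; exact: powR_ge0.
apply: (beta_exhaust_le bl) => // u v u0 uv v1.
(* The exhausting endpoint v may lie to the left of x; the maximum keeps x < y. *)
pose x := 1 - h; pose y := Num.max v (1 - h / 2).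
have xy : x < y by rewrite lt_max /x; apply/orP; right; lra.
have y1 : y < 1 by rewrite gt_max v1 /=; lra.
have x2 : 1 / 2 <= x by rewrite /x; lra.
have x0 : 0 < x by lra.
apply: (@le_trans _ _ (fine (m `[x, y]%classic))).
  apply: prob_fine_le => //; first exact: measurableI.
  move=> t [/=]; rewrite !in_itv/= => /andP[-> _] /andP[_ tv] /=.
  by rewrite le_max tv.
have dh (t : R) : is_derive t 1 (fun t => t - 1 : R) 1.
  have := is_derive_add (is_derive_id t 1) (is_derive_cst (-1 : R) t 1).
  by rewrite addr0.
have cd : continuous (fun _ : R => (1 : R)) by move=> t; exact: cvg_cst.
have bt := @bm_beta_test p q _ _ x y x0 (ltW xy) y1 dh cd.
have I := beta_interval_ibp bl x0 xy y1 dh cd.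
have low t : x <= t <= y -> q / 2 <= 1 + (t - 1) * beta_dlog p q t.
  move=> /andP[xt ty]; have t2 : 1 / 2 <= t by lra.
  have tt1 : t < 1 by exact: le_lt_trans y1.
  rewrite beta_dlog_right//; last by lra.
  have tt0 : 0 < t by lra.
  have r1 : (1 - t) / t <= 2 * h0 by rewrite ler_pdivrMr//; rewrite /x in xt; nra.
  have r0 : 0 <= (1 - t) / t by rewrite divr_ge0//; lra.
  have : (p - 1) * ((1 - t) / t) <= P * (2 * h0).
    apply: (@le_trans _ _ (P * ((1 - t) / t))).
      by apply: ler_wpM2r => //; rewrite /P; have := ler_norm (p - 1); lra.
    by apply: ler_wpM2l => //; lra.
  by lra.
have h3 := int_ge_cst m bt low; rewrite I in h3.
have W0 : 0 <= (1 - y) * beta_weight p q y.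
  by apply: mulr_ge0; [lra|exact: beta_weight_ge0].
have Wx : (1 - x) * beta_weight p q x <= 2 * c * h `^ q.
  rewrite beta_weight_right ?(ltW x0)//; last by rewrite /x; lra.
  rewrite -/c (_ : 1 - x = h); last by rewrite /x; lra.
  apply: ler_wpM2r => //; rewrite mulrC; apply: ler_wpM2r => //.
  by apply: powR_le2 => //; rewrite /x; lra.
rewrite -(ler_pM2l (x := q / 2)); last by rewrite divr_gt0.
apply: (le_trans h3).
have -> : q / 2 * (4 * c / q * h `^ q) = 2 * c * h `^ q by field; rewrite gt_eqF.
by lra.
Qed.

Lemma beta_mass_left p q : 0 < p -> 0 < q -> exists C : R, 0 <= C /\ forall m,
  beta_law p q m -> forall h, 0 < h <= 1 -> fine (m `[0, h]%classic) <= C * h `^ p.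
Proof.
move=> p0 q0; pose P := `|q - 1| + 1; pose c := beta_const p q.
have P1 : 1 <= P by rewrite lerDr.
have c0 : 0 <= c := beta_const_ge0 p q.
pose h0 := Num.min (2^-1 : R) (p / (4 * P)).
have h00 : 0 < h0 by rewrite lt_min invr_gt0 ltr0n/= divr_gt0// mulr_gt0//; lra.
have h02 : h0 <= 2^-1 by rewrite ge_min lexx.
have h0q : h0 * (4 * P) <= p.
  by rewrite -ler_pdivlMr ?ge_min ?lexx ?orbT//; apply: mulr_gt0 => //; lra.
exists (4 * c / p + h0 `^ (- p)).
have t1 : 0 <= 4 * c / p by apply: divr_ge0; [exact: mulr_ge0|exact: ltW].
split; first by apply: addr_ge0 => //; exact: powR_ge0.
move=> m bl h /andP[hp h1]; have hq : 0 <= h `^ p by exact: powR_ge0.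
rewrite mulrDl; have [hh|hh] := leP h h0; last first.
  apply: (@le_trans _ _ 1); first by case/andP: (prob_fine01 m (measurable_itv `[0, h])).
  have : 1 <= h0 `^ (- p) * h `^ p.
    rewrite powRN mulrC ler_pdivlMr ?powR_gt0// mul1r.
    by apply: ge0_ler_powR; rewrite ?nnegrE ?(ltW p0) ?(ltW h00) ?(ltW hp)// ltW.
  have : 0 <= 4 * c / p * h `^ p by exact: mulr_ge0.
  by lra.
apply: (@le_trans _ _ (4 * c / p * h `^ p)); last first.
  by rewrite lerDl; apply: mulr_ge0 => //; exact: powR_ge0.
apply: (beta_exhaust_le bl) => // u v u0 uv v1.
pose x := Num.min u (h / 2); pose y := h.
have xy : x < y by rewrite gt_min /y; apply/orP; right; lra.
have x0 : 0 < x by rewrite lt_min u0/=; lra.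
have y1 : y < 1 by rewrite /y; lra.
apply: (@le_trans _ _ (fine (m `[x, y]%classic))).
  apply: prob_fine_le => //; first exact: measurableI.
  move=> t [/=]; rewrite !in_itv/= => /andP[_ ->] /andP[ut _] /=.
  by rewrite andbT ge_min ut.
have dh (t : R) : is_derive t 1 (fun t => t : R) 1 by exact: is_derive_id.
have cd : continuous (fun _ : R => (1 : R)) by move=> t; exact: cvg_cst.
have bt := @bm_beta_test p q _ _ x y x0 (ltW xy) y1 dh cd.
have I := beta_interval_ibp bl x0 xy y1 dh cd.
have low t : x <= t <= y -> p / 2 <= 1 + t * beta_dlog p q t.
  move=> /andP[xt ty].
  have tt0 : 0 < t by exact: lt_le_trans xt.
  have tt1 : t < 1 by exact: le_lt_trans y1.
  rewrite beta_dlog_left//.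
  have r1 : t / (1 - t) <= 2 * h0 by rewrite ler_pdivrMr ?subr_gt0//; rewrite /y in ty; nra.
  have r0 : 0 <= t / (1 - t) by rewrite divr_ge0//; lra.
  have : (q - 1) * (t / (1 - t)) <= P * (2 * h0).
    apply: (@le_trans _ _ (P * (t / (1 - t)))).
      by apply: ler_wpM2r => //; rewrite /P; have := ler_norm (q - 1); lra.
    by apply: ler_wpM2l => //; lra.
  by lra.
have h3 := int_ge_cst m bt low; rewrite I in h3.
have W0 : 0 <= x * beta_weight p q x.
  by apply: mulr_ge0; [lra|exact: beta_weight_ge0].
have Wx : y * beta_weight p q y <= 2 * c * h `^ p.
  have y0 : 0 < y := hp.
  rewrite (beta_weight_left p q y0 (ltW y1)).
  rewrite -/c /y mulrAC; apply: ler_wpM2r => //; rewrite mulrC; apply: ler_wpM2r => //.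
  by apply: powR_le2 => //; lra.
rewrite -(ler_pM2l (x := p / 2)); last by rewrite divr_gt0.
apply: (le_trans h3).
have -> : p / 2 * (4 * c / p * h `^ p) = 2 * c * h `^ p by field; rewrite gt_eqF.
by lra.
Qed.

(** For p >= 1 the same integrand is at most q, so q times the mass dominates the difference of the
    two boundary terms; the outer end is placed so close to 1 that its term is at most half of the
    inner one. *)
Lemma beta_mass_right_lower p q : 1 <= p -> 0 < q -> exists C : R, 0 <= C /\ forall m,
  beta_law p q m -> forall h, 0 < h <= 1 -> h `^ q <= C * fine (m `[1 - h, 1]%classic).
Proof.
move=> p1 q0; pose c := beta_const p q.
have c0 : 0 <= c := beta_const_ge0 p q.
(* Normalized by th^q = 2^(-p): the boundary term at 1 - th k is then at most c 2^(-p) k^q, while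
   the one at 1 - k is at least twice that because k <= 1/2. *)
pose th := (2^-1 `^ p : R) `^ q^-1.
have hp : 0 < (2^-1 `^ p : R) < 1.
  rewrite powR_gt0 ?invr_gt0//=.
  rewrite [ltRHS](_ : 1 = 1 `^ p); last by rewrite powR1.
  by apply: gt0_ltr_powR; rewrite ?nnegrE ?invr_ge0//; lra.
case/andP: hp => hp0 hp1.
have th0 : 0 < th by exact: powR_gt0.
have th1 : th < 1.
  rewrite /th [ltRHS](_ : 1 = 1 `^ q^-1); last by rewrite powR1.
  by apply: gt0_ltr_powR; rewrite ?nnegrE ?invr_gt0// ltW.
have thq : th `^ q = 2^-1 `^ p by rewrite /th -powRrM mulVf ?gt_eqF// powRr1// ltW.
pose D := c * 2^-1 `^ p * 2^-1 `^ q / q.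
have D0 : 0 <= D by rewrite /D; do 3 ?[apply: mulr_ge0] => //; rewrite ?powR_ge0 ?invr_ge0 ?(ltW q0).
exists D^-1; split; first by rewrite invr_ge0.
move=> m bl h /andP[h0 h1]; have Dp : 0 < D.
  have cp : 0 < c := beta_const_gt0 bl.
  apply: divr_gt0 => //; apply: mulr_gt0; last by rewrite powR_gt0 ?invr_gt0.
  by apply: mulr_gt0 => //; rewrite powR_gt0 ?invr_gt0.
rewrite mulrC ler_pdivlMr//.
pose k := h / 2; have k0 : 0 < k by rewrite divr_gt0.
have k2 : k <= 2^-1 by rewrite /k; lra.
have kq : k `^ q = h `^ q * 2^-1 `^ q by rewrite powRM ?(ltW h0)// invr_ge0.
pose x := 1 - k; pose y := 1 - th * k.
have thk : th * k < k by rewrite -[ltRHS]mul1r ltr_pM2r.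
have thk0 : 0 < th * k by rewrite mulr_gt0.
have xy : x < y by rewrite /x /y; lra.
have x0 : 0 < x by rewrite /x; lra.
have y1 : y < 1 by rewrite /y; lra.
have dh (t : R) : is_derive t 1 (fun t => t - 1 : R) 1.
  have := is_derive_add (is_derive_id t 1) (is_derive_cst (-1 : R) t 1).
  by rewrite addr0.
have cd : continuous (fun _ : R => (1 : R)) by move=> t; exact: cvg_cst.
have bt := @bm_beta_test p q _ _ x y x0 (ltW xy) y1 dh cd.
have I := beta_interval_ibp bl x0 xy y1 dh cd.
have up t : x <= t <= y -> 1 + (t - 1) * beta_dlog p q t <= q.
  move=> /andP[xt ty]; have tt0 : 0 < t by lra.
  have tt1 : t < 1 by exact: le_lt_trans y1.
  rewrite beta_dlog_right//.
  have r1 : 0 <= (p - 1) * ((1 - t) / t).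
    by apply: mulr_ge0; [|apply: divr_ge0; [|exact: ltW]]; rewrite subr_ge0// ltW.
  by rewrite gerBl.
have h3 := int_le_cst m bt up; rewrite I in h3.
have Wx : 2 * c * 2^-1 `^ p * k `^ q <= (1 - x) * beta_weight p q x.
  rewrite beta_weight_right ?(ltW x0)//; last by rewrite /x; lra.
  rewrite -/c (_ : 1 - x = k); last by rewrite /x; lra.
  apply: ler_wpM2r; first exact: powR_ge0.
  rewrite [2 * c]mulrC -mulrA; apply: ler_wpM2l => //.
  have p0 : 0 < p by lra.
  rewrite -(mulr_powRB1 (x := 2^-1) _ p0) ?invr_ge0// mulrA mulfV// mul1r.
  by apply: ge0_ler_powR; rewrite ?nnegrE ?subr_ge0 ?invr_ge0 ?(ltW x0)//; rewrite /x; lra.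
have Wy : (1 - y) * beta_weight p q y <= c * 2^-1 `^ p * k `^ q.
  rewrite beta_weight_right ?(ltW (lt_trans x0 xy))//.
  rewrite -/c (_ : 1 - y = th * k); last by rewrite /y; lra.
  rewrite powRM ?(ltW th0) ?(ltW k0)// thq mulrA; apply: ler_wpM2r; first exact: powR_ge0.
  apply: ler_wpM2r; first exact: powR_ge0.
  by apply: ler_piMr => //; apply: powR_itv01; [rewrite (ltW y1) (ltW (lt_trans x0 xy))|rewrite subr_ge0].
have mono : fine (m `[x, y]%classic) <= fine (m `[1 - h, 1]%classic).
  apply: prob_fine_le => // t /=; rewrite !in_itv/= => /andP[a1 a2].
  have xE : x = 1 - h / 2 by []; have yE : y = 1 - th * k by [].
  by apply/andP; split; [clear -a1 xE h0|clear -a2 yE thk0]; lra.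
have -> : h `^ q * D = c * 2^-1 `^ p * k `^ q / q by rewrite /D kq; ring.
rewrite ler_pdivrMr// [leRHS]mulrC; apply: (@le_trans _ _ (q * fine (m `[x, y]%classic))).
  apply: le_trans h3; have key (X Y z u v : R) : 2 * z <= (1 - X) * u ->
      (1 - Y) * v <= z -> z <= (Y - 1) * v - (X - 1) * u by clear; move=> *; lra.
  apply: (key x y _ (beta_weight p q x) (beta_weight p q y) _ Wy); apply: le_trans Wx.
  by rewrite !mulrA.
by apply: ler_wpM2l; [exact: ltW|].
Qed.

End beta_kernel.

(** * Beta laws satisfy the kernel bounds *)

Section beta_kernel_bounds.
Variable R : realType.
Implicit Types m : probability R R.
Local Notation leb := (@lebesgue_measure R).

Lemma beta_kernel_ibp p q m (F f : R -> R) (b0 b1 : R) : 1 <= p -> beta_law p q m ->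
  0 < b0 -> b0 < b1 -> b1 < 1 -> (forall t : R, is_derive t 1 F (f t)) ->
  continuous f -> F b0 = 0 ->
  `|\int[m]_(b in `[b0, b1]) f b| <=
  (beta_const p q + (`|p - 1| + `|q - 1|)) * (`|F b1| * (1 - b1) `^ (q - 1) +
    \int[m]_(b in `[b0, b1]) (`|F b| / (b * (1 - b)))).
Proof.
move=> p1 bl x0 xy y1 hF cf F0; have cF := is_derive_continuous hF.
have I := beta_interval_ibp bl x0 xy y1 hF cf.
set c := beta_const p q; have c0 : 0 <= c := beta_const_ge0 p q.
set P := `|p - 1| + `|q - 1|; have P0 : 0 <= P by rewrite addr_ge0.
have i01 t : b0 <= t <= b1 -> 0 < t /\ t < 1.
  by move=> /andP[h1 h2]; split; [exact: lt_le_trans h1|exact: le_lt_trans y1].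
have bI := bm_beta_test p q x0 (ltW xy) y1 hF cf.
have bf : bounded_measurable (fun t => \1_(`[b0, b1]%classic) t * f t).
  by apply: (bm_itv_continuous (ltW xy)) => [t _|]; [exact: cf|exact: continuous_measurable_fun].
have bg : bounded_measurable (fun t => \1_(`[b0, b1]%classic) t * (F t * beta_dlog p q t)).
  apply: (bm_itv_continuous (ltW xy)) => [t /i01[t0 t1]|].
    by apply: cvgM; [exact: cF|exact: continuous_beta_dlog].
  by apply: measurable_funM; [exact: continuous_measurable_fun|exact: measurable_beta_dlog].
have bh : bounded_measurable (fun t => \1_(`[b0, b1]%classic) t * (`|F t| / (t * (1 - t)))).
  apply: (bm_itv_continuous (ltW xy)) => [t /i01[t0 t1]|].
    apply: cvgM; first by apply: (@cvg_norm _ R^o); exact: cF.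
    apply: cvgV; first by rewrite gt_eqF// mulr_gt0// subr_gt0.
    by apply: cvgM; [exact: cvg_id|apply: (@cvgB _ R^o); [exact: cvg_cst|exact: cvg_id]].
  apply: measurable_funM; first by apply: measurableT_comp => //; exact: continuous_measurable_fun.
  by apply: measurable_funV; apply: measurable_funM => //; exact: measurable_funB.
have E : \int[m]_(b in `[b0, b1]) f b =
    F b1 * beta_weight p q b1 - \int[m]_(b in `[b0, b1]) (F b * beta_dlog p q b).
  move: I; rewrite F0 mul0r subr0 => <-.
  rewrite !(bm_int_mkcond m `[b0, b1]%classic) -bm_intB//.
  by apply: eq_Rintegral => t _; rewrite -mulrBr addrK.
rewrite E; apply: (le_trans (ler_normB _ _)).
have h1 : `|F b1 * beta_weight p q b1| <= c * (`|F b1| * (1 - b1) `^ (q - 1)).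
  rewrite normrM mulrCA; apply: ler_wpM2l => //.
  rewrite ger0_norm ?beta_weight_ge0// /beta_weight -/c.
  apply: ler_wpM2r; first exact: powR_ge0.
  apply: ler_piMr => //; apply: powR_itv01; last by rewrite subr_ge0.
  by rewrite (ltW y1) (ltW (lt_trans x0 xy)).
have h2 : `|\int[m]_(b in `[b0, b1]) (F b * beta_dlog p q b)| <=
    P * \int[m]_(b in `[b0, b1]) (`|F b| / (b * (1 - b))).
  rewrite !(bm_int_mkcond m `[b0, b1]%classic) -bm_intZ//.
  apply: bm_abs_le => //; first exact: bmM (bm_cst _ _) bh.
  move=> t; rewrite indicE; have [/set_mem/=|_] := boolP (t \in _); last first.
    by rewrite !mul0r normr0 mulr0.
  rewrite in_itv/= => /i01[t0 t1]; rewrite !mul1r normrM mulrCA.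
  apply: ler_wpM2l => //; have u0 : 0 < 1 - t by rewrite subr_gt0.
  have w0 : 0 < t * (1 - t) by rewrite mulr_gt0.
  rewrite ler_pdivlMr// -[X in _ * X](ger0_norm (ltW w0)) -normrM.
  have -> : beta_dlog p q t * (t * (1 - t)) = (p - 1) * (1 - t) - (q - 1) * t.
    by rewrite /beta_dlog; field; rewrite !gt_eqF.
  apply: (le_trans (ler_normB _ _)); rewrite /P !normrM (gtr0_norm t0) (gtr0_norm u0).
  by apply: lerD; apply: ler_piMr => //; lra.
set X := `|F b1| * _ in h1 *; set Y := Rintegral _ _ (fun b => `|F b| / _) in h2 *.
have X0 : 0 <= X by rewrite mulr_ge0// powR_ge0.
have Y0 : 0 <= Y.
  apply: Rintegral_ge0 => t /=; rewrite in_itv/= => /i01[t0 t1].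
  by rewrite divr_ge0// mulr_ge0// ltW// subr_gt0.
have cY := mulr_ge0 c0 Y0; have PX := mulr_ge0 P0 X0.
apply: (le_trans (lerD h1 h2)).
have -> : (c + P) * (X + Y) = (c * X + P * Y) + (c * Y + P * X) by ring.
by rewrite lerDl; exact: addr_ge0.
Qed.

(** On the range 1-t <= H one has (1-t)^(q-2) <= H^(q-s) (1-t)^(s-2), and the right side has an
    explicit primitive because s < 1. *)
Lemma beta_inverse_moment p q s m (h H : R) : 1 <= p -> s < 1 -> s <= q -> beta_law p q m ->
  0 < h -> h < H -> H <= 1 ->
  \int[m]_(t in `[1 - H, 1 - h]) (1 - t)^-1 <=
  beta_const p q / (1 - s) * H `^ (q - s) * h `^ (s - 1).
Proof.
move=> p1 s1 sq bl h0 hH H1; set c := beta_const p q.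
have c0 : 0 <= c := beta_const_ge0 p q.
have H0 : 0 < H by exact: lt_trans hH.
have s10 : 0 < 1 - s by rewrite subr_gt0.
have xy : 1 - H < 1 - h by lra.
have itv t : 1 - H <= t <= 1 - h -> [/\ 0 <= t, t <= 1, h <= 1 - t & 1 - t <= H].
  by move=> /andP[a b]; split; lra.
pose G (t : R) := c * H `^ (q - s) * (1 - t) `^ (s - 2).
have G0 t : 0 <= G t.
  by apply: mulr_ge0; [apply: mulr_ge0 => //|]; exact: powR_ge0.
have dG t : 1 - H <= t <= 1 - h -> is_derive t 1
    (fun t => (c / (1 - s) * H `^ (q - s)) * (1 - t) `^ (s - 1)) (G t).
  move=> /itv[t0 t1 th tH].
  have u0 : 0 < 1 - t by lra.
  have ho : is_derive t 1 (fun x : R => 1 - x) (-1).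
    by have := is_derive_onemr 1 t; under eq_fun do rewrite mul1r.
  have d1 := @is_derive1_comp R (fun x : R => x `^ (s - 1)) (fun x : R => 1 - x) t _ _
    (is_derive1_powR (s - 1) u0) ho.
  apply: (is_derive_eq (is_derive_mul (is_derive_cst (c / (1 - s) * H `^ (q - s)) t 1) d1)).
  rewrite mul0r add0r /G /= (_ : s - 1 - 1 = s - 2); last by ring.
  by field; rewrite gt_eqF.
have cG t : 1 - H <= t <= 1 - h -> {for t, continuous G}.
  move=> /itv[t0 t1 th tH]; have u0 : 0 < 1 - t by lra.
  have ho : is_derive t 1 (fun x : R => 1 - x) (-1).
    by have := is_derive_onemr 1 t; under eq_fun do rewrite mul1r.
  have d1 := @is_derive1_comp R (fun x : R => x `^ (s - 2)) (fun x : R => 1 - x) t _ _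
    (is_derive1_powR (s - 2) u0) ho.
  have ct : {for t, continuous (fun x : R => (1 - x) `^ (s - 2))}.
    apply: differentiable_continuous; apply/derivable1_diffP.
    exact: (@ex_derive _ _ _ _ _ _ _ d1).
  by apply: cvgM; [exact: cvg_cst|exact: ct].
have I := FTC_interval xy dG cG.
have mI : measurable_fun setT (fun t : R => (1 - t)^-1).
  by apply: measurable_funV; exact: measurable_funB.
have bI : bounded_measurable (fun t => \1_(`[1 - H, 1 - h]%classic) t * (1 - t)^-1).
  apply: (@bm_indic_mul _ _ _ _ _ h^-1) => // t /=; rewrite in_itv/= => /itv[t0 t1 th tH].
  rewrite ger0_norm ?invr_ge0 ?subr_ge0// lef_pV2 ?posrE//.
  exact: lt_le_trans th.
rewrite (beta_law_integral bl)//.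
apply: (@le_trans _ _ (\int[leb]_(t in `[1 - H, 1 - h]) G t)); last first.
  rewrite I !subKr lerBlDr lerDl mulr_ge0 ?powR_ge0//.
  by apply: mulr_ge0; [apply: divr_ge0 => //; exact: ltW|exact: powR_ge0].
have mG : measurable_fun `[1 - H, 1 - h]%classic G.
  apply: measurable_funTS; apply: measurable_funM => //.
  by apply: (measurableT_comp (measurable_powR (s - 2))); exact: measurable_funB.
pose D := `[1 - H, 1 - h]%classic.
have mD : measurable D by exact: measurable_itv.
have fG : (\int[leb]_(t in D) (G t)%:E < +oo)%E.
  have cw := continuous_within_itv cG.
  have /integrableP[_] := continuous_compact_integrable (@segment_compact R (1 - H)%R (1 - h)%R) cw.
  apply: le_lt_trans; apply: ge0_le_integral => //.
  - by move=> t _; rewrite lee_fin.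
  - by apply/measurable_EFinP.
  - by do 2 apply: measurableT_comp => //.
  - by move=> t _ /=; rewrite lee_fin ler_norm.
rewrite /Rintegral; set A := (X in fine X <= _); set B := (X in _ <= fine X).
have AB : (A <= B)%E.
  apply: ge0_le_integral => //.
  - move=> t /=; rewrite in_itv/= => /itv[t0 t1 _ _].
    by rewrite lee_fin mulr_ge0 ?Beta_density_ge0// invr_ge0 subr_ge0.
  - apply/measurable_EFinP; apply: measurable_funTS; apply: measurable_funM => //.
    exact: measurable_Beta_density.
  - by apply/measurable_EFinP.
  - move=> t /=; rewrite in_itv/= => /itv[t0 t1 th tH]; rewrite lee_fin.
    have u0 : 0 < 1 - t by exact: lt_le_trans th.
    rewrite /Beta_density t0 t1 /= -/(beta_const p q) -/c.
    have -> : (1 - t)^-1 * (c * t `^ (p - 1) * (1 - t) `^ (q - 1)) =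
        c * (t `^ (p - 1) * ((1 - t) `^ (q - s) * (1 - t) `^ (s - 2))).
      rewrite -powRD; last by rewrite (gt_eqF u0) implybT.
      rewrite (_ : q - s + (s - 2) = (q - 1) - 1); last by ring.
      have -> : (1 - t) `^ (q - 1 - 1) = (1 - t) `^ (q - 1) / (1 - t).
        by rewrite powRB ?powRr1 ?(ltW u0)// (gt_eqF u0) implybT.
      by ring.
    rewrite /G -[leRHS]mulrA; apply: ler_wpM2l => //.
    apply: (@le_trans _ _ ((1 - t) `^ (q - s) * (1 - t) `^ (s - 2))).
      apply: ler_piMl; first by rewrite mulr_ge0 ?powR_ge0.
      by apply: powR_itv01; [rewrite t0 t1|rewrite subr_ge0].
    apply: ler_wpM2r; first exact: powR_ge0.
    by apply: ge0_ler_powR; rewrite ?nnegrE ?subr_ge0 ?(ltW H0)//.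
have A0 : (0 <= A)%E.
  apply: integral_ge0 => t /=; rewrite in_itv/= => /itv[t0 t1 _ _].
  by rewrite lee_fin mulr_ge0 ?Beta_density_ge0// invr_ge0 subr_ge0.
apply: fine_le => //; rewrite ge0_fin_numE// ?(le_lt_trans AB)//.
exact: le_trans AB.
Qed.

Lemma beta_kernel_bounds p q s : 1 <= p -> 0 < s -> s < 1 -> s <= q -> exists K : R,
  forall m, beta_law p q m -> kernel_bounds m q s K.
Proof.
move=> p1 s0 s1 sq; have q0 : 0 < q by exact: lt_le_trans sq.
have p0 : 0 < p by lra.
have [C1 [C10 H1]] := beta_mass_right p0 q0.
have [C2 [C20 H2]] := beta_mass_right_lower p1 q0.
pose c := beta_const p q; have c0 : 0 <= c := beta_const_ge0 p q.
pose P := `|p - 1| + `|q - 1|; have P0 : 0 <= P by rewrite addr_ge0.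
have c30 : 0 <= c / (1 - s) by apply: divr_ge0 => //; lra.
pose K := 1 + C1 + C2 + (c + P) + c / (1 - s).
exists K => m bl; split => //.
- by rewrite /K; lra.
- exact: beta_law_itv01 bl.
- move=> F f b0 b1 h0 h1 h2 hF cf F0.
  apply: (le_trans (beta_kernel_ibp p1 bl h0 h1 h2 hF cf F0)).
  apply: ler_wpM2r; last by rewrite -/c -/P /K; lra.
  apply: addr_ge0; first by rewrite mulr_ge0// powR_ge0.
  apply: Rintegral_ge0 => t /=; rewrite in_itv/= => /andP[t0 t1].
  by rewrite divr_ge0// mulr_ge0//; lra.
- move=> h h01; apply: (le_trans (H1 m bl h h01)).
  by apply: ler_wpM2r; [exact: powR_ge0|rewrite /K; lra].
- move=> h h01; apply: (le_trans (H2 m bl h h01)).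
  by apply: ler_wpM2r; [case/andP: (prob_fine01 m (measurable_itv `[1 - h, 1]))|rewrite /K; lra].
(* When h = H the interval is one point and the fundamental theorem does not apply; the mass bound
   is used instead. *)
- move=> h H h0 hH HL; have [e|ne] := eqVneq h H; last first.
    have lt : h < H by rewrite lt_neqAle ne.
    apply: (le_trans (beta_inverse_moment p1 s1 sq bl h0 lt HL)).
    do 2 (apply: ler_wpM2r; first exact: powR_ge0).
    by rewrite -/c /K; lra.
  subst H; have -> : \int[m]_(b in `[1 - h, 1 - h]) (1 - b)^-1 =
      h^-1 * fine (m `[1 - h, 1 - h]%classic).
    rewrite -Rintegral_cst//; apply: eq_Rintegral => t.
    rewrite inE/= in_itv/= => /andP[a b]; congr (_^-1); lra.
  apply: (@le_trans _ _ (h^-1 * (C1 * h `^ q))).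
    apply: ler_wpM2l; first by rewrite invr_ge0 ltW.
    apply: le_trans (H1 m bl h _); last by rewrite h0.
    apply: prob_fine_le => // t /=; rewrite !in_itv/= => /andP[-> b] /=; lra.
  have -> : K * h `^ (q - s) * h `^ (s - 1) = K * (h^-1 * h `^ q).
    rewrite -mulrA -powRD; last by rewrite (gt_eqF h0) implybT.
    rewrite (_ : q - s + (s - 1) = q - 1); last by ring.
    rewrite powRB; last by rewrite (gt_eqF h0) implybT.
    by rewrite powRr1 ?(ltW h0)//; ring.
  rewrite mulrCA; apply: ler_wpM2r; last by rewrite /K; lra.
  by rewrite mulr_ge0 ?invr_ge0 ?powR_ge0// ltW.
Qed.

End beta_kernel_bounds.

(** * Moments determine a law on [0,1] *)

Section moment_problem.
Variable R : realType.
Implicit Types mu nu pi lam : probability R R.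

Lemma cdf_determined mu nu :
  (forall c, mu `]-oo, c[%classic = nu `]-oo, c[%classic) ->
  forall A, measurable A -> mu A = nu A.
Proof.
move=> h A mA.
have GE : <<s @RGenInftyO.G R >> A.
  have E : (@ocitv R).-sigma.-measurable A = (@RGenInftyO.G R).-sigma.-measurable A.
    by rewrite RGenInftyO.measurableE.
  have : (@ocitv R).-sigma.-measurable A by exact: mA.
  by rewrite E.
apply: (g_sigma_algebra_measure_unique (@RGenInftyO.G R) _ (fun n => `]-oo, n%:R[%classic)) => //.
- by move=> _ [x ->]; exact: measurable_itv.
- by move=> n; exists n%:R.
- apply/seteqP; split => // t _; exists (Num.Def.trunc t).+1 => //=.
  by rewrite in_itv/= truncnS_gt.
- move=> _ _ [x ->] [y ->]; exists (Num.min x y).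
  by apply/seteqP; split => t /=; rewrite !in_itv/= lt_min; [case=> -> ->|case/andP].
- by move=> _ [x ->]; exact: h.
- by move=> n; rewrite (le_lt_trans (probability_le1 _ _))// ltry.
Qed.

Lemma bm01_continuous (f : R -> R) : continuous f ->
  bounded_measurable (fun t : R => \1_(`[0, 1]%classic) t * f t).
Proof.
move=> cf; apply: bm_itv_continuous => //; first by move=> t _; exact: cf.
exact: continuous_measurable_fun.
Qed.

Lemma poly_int_eq mu nu (p : {poly R}) :
  (forall j, \int[mu]_(t in `[0, 1]) t ^+ j = \int[nu]_(t in `[0, 1]) t ^+ j) ->
  \int[mu]_(t in `[0, 1]) p.[t] = \int[nu]_(t in `[0, 1]) p.[t].
Proof.
move=> h.
have b j : bounded_measurable (fun t : R => \1_(`[0, 1]%classic) t * t ^+ j).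
  by apply: bm01_continuous => t; exact: exprn_continuous.
have E (m : probability R R) : \int[m]_(t in `[0, 1]) p.[t] =
    \sum_(i < size p) p`_i * \int[m]_(t in `[0, 1]) t ^+ i.
  rewrite bm_int_mkcond.
  transitivity (\int[m]_t \sum_(i < size p) p`_i * (\1_(`[0, 1]%classic) t * t ^+ i)).
    apply: eq_Rintegral => t _; rewrite horner_coef mulr_sumr.
    by apply: eq_bigr => i _; rewrite mulrCA.
  rewrite (@bm_int_sum _ _ _ m _ _ (fun (i : 'I_(size p)) (t : R) =>
    p`_i * (\1_(`[0, 1]%classic) t * t ^+ i))).
    by apply: eq_bigr => i _; rewrite bm_intZ// (bm_int_mkcond m `[0, 1]%classic).
  by move=> i; apply: bmM => //; exact: bm_cst.
by rewrite !E; apply: eq_bigr => i _; rewrite h.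
Qed.

Lemma bernoulli_lower (x : R) N : 0 <= x <= 1 -> 1 - N%:R * x <= (1 - x) ^+ N.
Proof.
move=> /andP[x0 x1]; elim: N => [|N IH]; first by rewrite mul0r subr0 expr0.
have u0 : 0 <= 1 - x by rewrite subr_ge0.
rewrite exprS; apply: le_trans (ler_wpM2l u0 IH).
rewrite -natr1; have : 0 <= N%:R * x * x :> R by rewrite !mulr_ge0.
by move: (N%:R : R) => n; nra.
Qed.

Lemma bernoulli_upper (x : R) N : 0 <= x <= 1 -> (1 - x) ^+ N * (1 + N%:R * x) <= 1.
Proof.
move=> /andP[x0 x1]; elim: N => [|N IH]; first by rewrite expr0 mul0r addr0 mulr1.
have u0 : 0 <= 1 - x by rewrite subr_ge0.
apply: le_trans IH; rewrite exprS [(1 - x) * _]mulrC -mulrA.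
apply: ler_wpM2l; first exact: exprn_ge0.
rewrite -natr1; have : 0 <= N%:R * x * x :> R by rewrite !mulr_ge0.
have : 0 <= x * x by rewrite mulr_ge0.
by move: (N%:R : R) => n; nra.
Qed.

(** With y the square root of x, the product n y^n is bounded by the geometric series, and another
    factor y^n remains. *)
Lemma natr_geometric_cvg0 (x : R) : 0 <= x -> x < 1 ->
  (fun n : nat => n%:R * x ^+ n) @ \oo --> (0 : R).
Proof.
move=> x0 x1; pose y := Num.sqrt x.
have y0 : 0 <= y by exact: sqrtr_ge0.
have y1 : y < 1 by rewrite -sqrtr1 ltr_sqrt.
have yx n : x ^+ n = y ^+ n * y ^+ n by rewrite -exprMn -expr2 sqr_sqrtr.
have b n : n%:R * y ^+ n <= (1 - y)^-1.
  apply: le_trans (sum_pow_le n y0 y1).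
  have -> : n%:R * y ^+ n = \sum_(i < n) y ^+ n by rewrite sumr_const card_ord mulr_natl.
  by apply: ler_sum => i _; apply: ler_wiXn2l; [|exact: ltW|exact: ltnW].
apply: (@squeeze_cvgr _ _ _ _ (fun=> 0) (fun n => (1 - y)^-1 * y ^+ n)).
- apply: nearW => n; rewrite mulr_ge0 ?exprn_ge0//= yx mulrA.
  by apply: ler_wpM2r; rewrite ?exprn_ge0.
- exact: cvg_cst.
- rewrite -[X in _ --> X](mulr0 (1 - y)^-1); apply: cvgM; first exact: cvg_cst.
  by apply: cvg_expr; rewrite ger0_norm.
Qed.

(* [(1 - t^n)^N] with [N] slightly larger than [n / c^n] tends to the indicator
   of [t < c], also at [t = c]. *)
Lemma indicator_limit (c t : R) : 0 < c <= 1 -> 0 <= t <= 1 ->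
  (fun n : nat => (1 - t ^+ n) ^+ (Num.Def.trunc (n%:R / c ^+ n)).+1) @ \oo -->
  (if t < c then 1 else 0 : R).
Proof.
move=> /andP[c0 c1] /andP[t0 t1]; pose N n := (Num.Def.trunc (n%:R / c ^+ n)).+1.
have tn n : 0 <= t ^+ n <= 1 by rewrite exprn_ge0//= exprn_ile1.
have cn n : 0 < c ^+ n by rewrite exprn_gt0.
have N1 n : n%:R / c ^+ n <= (N n)%:R by rewrite ltW// truncnS_gt.
have N2 n : (N n)%:R <= n%:R / c ^+ n + 1.
  by rewrite -natr1 lerD2r truncn_le divr_ge0// ltW.
have [tc|ct] := ltP t c.
- have tc1 : t / c < 1 by rewrite ltr_pdivrMr// mul1r.
  have tc0 : 0 <= t / c by rewrite divr_ge0// ltW.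
  apply: (@squeeze_cvgr _ _ _ _ (fun n => 1 - (n%:R * (t / c) ^+ n + t ^+ n)) (fun=> 1)).
  + apply: nearW => n; rewrite exprn_ile1 ?andbT; last 2 first.
    * by case/andP: (tn n); rewrite subr_ge0.
    * by case/andP: (tn n) => h _; rewrite gerBl.
    apply: le_trans (bernoulli_lower (N n) (tn n)); rewrite lerD2l lerN2.
    have h := ler_wpM2r (proj1 (andP (tn n))) (N2 n); apply: (le_trans h).
    by rewrite mulrDl mul1r expr_div_n mulrAC mulrA.
  + rewrite -[X in _ --> X]subr0; apply: cvgB; first exact: cvg_cst.
    rewrite -[X in _ --> X]addr0; apply: cvgD; first exact: natr_geometric_cvg0.
    by apply: cvg_expr; rewrite ger0_norm// (lt_le_trans tc).
  + exact: cvg_cst.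
- apply: (@squeeze_cvgr _ _ _ _ (fun=> 0) (fun n => n.+1%:R^-1)).
  + apply: nearW => n; have u0 : 0 <= 1 - t ^+ n by case/andP: (tn n); rewrite subr_ge0.
    rewrite exprn_ge0//= -[leRHS]mul1r ler_pdivlMr//.
    apply: le_trans (bernoulli_upper (N n) (tn n)).
    apply: ler_wpM2l; first exact: exprn_ge0.
    rewrite -natr1 addrC lerD2l.
    have h := ler_wpM2r (proj1 (andP (tn n))) (N1 n); apply: le_trans h.
    rewrite mulrAC ler_pdivlMr//; apply: ler_wpM2l => //.
    by rewrite lerXn2r ?nnegrE// ltW.
  + exact: cvg_cst.
  + exact: cvg_harmonic.
Qed.

(** By dominated convergence the polynomials of [indicator_limit] recover the mass of
    [0,c[ from the moments; values of c outside ]0,1] are immediate. *)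
Lemma moment_determined mu nu :
  mu `[0, 1]%classic = 1%E -> nu `[0, 1]%classic = 1%E ->
  (forall j, \int[mu]_(t in `[0, 1]) t ^+ j = \int[nu]_(t in `[0, 1]) t ^+ j) ->
  forall A, measurable A -> mu A = nu A.
Proof.
move=> mu1 nu1 h; apply: cdf_determined => c.
have fin (m m' : probability R R) (A : set R) : measurable A ->
    fine (m A) = fine (m' A) -> m A = m' A.
  by move=> mA e; rewrite -[LHS]fineK ?fin_num_measure// -[RHS]fineK ?fin_num_measure// e.
apply: fin => //.
have E (m : probability R R) : m `[0, 1]%classic = 1%E -> fine (m `]-oo, c[%classic) =
    \int[m]_t (\1_(`[0, 1]%classic) t * (if t < c then 1 else 0)).
  move=> m1; rewrite -prob_indic// (supp01_int m1); last exact: bm_indic.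
  rewrite bm_int_mkcond; apply: eq_Rintegral => t _; congr (_ * _).
  by rewrite indicE mem_setE in_itv/=; case: (t < c).
rewrite (E mu mu1) (E nu nu1).
have in01 t : t \in `[(0 : R), 1]%classic -> 0 <= t <= 1 by rewrite inE/= in_itv.
have [c0|c0] := leP c 0.
  have Z (m : probability R R) :
      \int[m]_t (\1_(`[0, 1]%classic) t * (if t < c then 1 else 0)) = \int[m]_t 0.
    apply: eq_Rintegral => t _; rewrite indicE; case: (boolP (t \in _)) => [/in01/andP[t0 _]|_].
      by rewrite ltNge (le_trans c0)//= mulr0.
    by rewrite mul0r.
  by rewrite !Z !prob_intc.
have [c1|c1] := ltP 1 c.
  have Z (m : probability R R) : m `[0, 1]%classic = 1%E ->
      \int[m]_t (\1_(`[0, 1]%classic) t * (if t < c then 1 else 0)) = 1.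
    move=> m1; transitivity (\int[m]_t (\1_(`[0, 1]%classic) t : R)).
      apply: eq_Rintegral => t _; rewrite indicE; case: (boolP (t \in _)) => [/in01/andP[_ t1]|_].
        by rewrite (le_lt_trans t1)//= mulr1.
      by rewrite mul0r.
    by rewrite prob_indic// m1.
  by rewrite !Z.
have c01 : 0 < c <= 1 by rewrite c0.
pose f n (t : R) := \1_(`[0, 1]%classic) t *
  (1 - t ^+ n) ^+ (Num.Def.trunc (n%:R / c ^+ n)).+1.
have cv (m : probability R R) : (fun n => \int[m]_t f n t) @ \oo -->
    \int[m]_t (\1_(`[0, 1]%classic) t * (if t < c then 1 else 0)).
  apply: (@bm_dominated_cvg _ _ _ _ _ _ 1).
  - move=> n; have : bounded_measurable (f n); last by case.
    apply: bm01_continuous => t.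
    have h1 : {for t, continuous (fun t : R => 1 - t ^+ n)}.
      by apply: (@cvgB _ R^o); [exact: cvg_cst|exact: exprn_continuous].
    exact: (continuous_comp h1 (@exprn_continuous _ _ _)).
  - move=> n t; rewrite /f indicE; case: (boolP (t \in _)) => [/in01/andP[t0 t1]|_]; last first.
      by rewrite mul0r normr0.
    have u0 : 0 <= 1 - t ^+ n by rewrite subr_ge0 exprn_ile1.
    by rewrite mul1r ger0_norm ?exprn_ge0// exprn_ile1// gerBl exprn_ge0.
  - move=> t; rewrite /f indicE; case: (boolP (t \in _)) => [/in01 t01|_].
      by under eq_fun do rewrite mul1r; rewrite mul1r; exact: indicator_limit.
    by under eq_fun do rewrite mul0r; rewrite mul0r; exact: cvg_cst.
apply: (cvg_unique _ (cv mu)) => //.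
have -> : (fun n => \int[mu]_t f n t) = (fun n => \int[nu]_t f n t); last exact: cv.
apply/funext => n; pose p : {poly R} := (1 - 'X^n) ^+ (Num.Def.trunc (n%:R / c ^+ n)).+1.
have H (m : probability R R) : \int[m]_t f n t = \int[m]_(t in `[0, 1]) p.[t].
  rewrite (bm_int_mkcond m `[0, 1]%classic); apply: eq_Rintegral => t _; rewrite /f; congr (_ * _).
  by rewrite /p horner_exp !hornerE.
by rewrite !H; exact: poly_int_eq.
Qed.

End moment_problem.

(** * Invariance of Beta(a,a) *)

Section invariance.
Variable R : realType.
Implicit Types lam pi nu : probability R R.

Lemma is_derive_pow (f : R -> R) (df t : R) (n : nat) : is_derive t 1 f df ->
  is_derive t 1 (fun x : R => f x ^+ n) (n%:R * f t ^+ n.-1 * df).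
Proof.
move=> hf; have := @is_deriveX R _ f n t 1 df hf.
rewrite (_ : f ^+ n = (fun x => f x ^+ n)); last first.
  apply/funext => x; elim: n => [|n IH]; first by rewrite !expr0.
  by rewrite !exprS -IH.
by move=> /is_derive_eq; apply.
Qed.

Lemma beta_moment_step p q lam j : 0 < p -> 0 < q -> beta_law p q lam ->
  (p + q + j%:R) * \int[lam]_(t in `[0, 1]) t ^+ j.+1 =
  (p + j%:R) * \int[lam]_(t in `[0, 1]) t ^+ j.
Proof.
move=> p0 q0 bl.
have cX i : continuous (fun t : R => t ^+ i) by move=> t; exact: exprn_continuous.
have bX i : bounded_measurable (fun t : R => \1_(`[0, 1]%classic) t * t ^+ i).
  exact: bm01_continuous.
have hd (t : R) : is_derive t 1 (fun t : R => t ^+ j) (j%:R * t ^+ j.-1 * 1).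
  by apply: is_derive_pow; exact: is_derive_id.
have E (t : R) : j%:R * t ^+ j.-1 * 1 * (t * (1 - t)) + t ^+ j * (p - (p + q) * t) =
    (p + j%:R) * t ^+ j - (p + q + j%:R) * t ^+ j.+1.
  by case: j {hd} => [|j]; rewrite ?expr0 ?exprS /=; ring.
have := @beta_ibp R p q lam _ _ p0 q0 bl hd.
under eq_Rintegral do rewrite E.
move=> I; apply/eqP; rewrite eq_sym -subr_eq0; apply/eqP.
rewrite -[RHS]I => {I}.
- rewrite !(bm_int_mkcond lam `[0, 1]%classic) -!bm_intZ// -bm_intB; last 2 first.
  + by apply: bmM => //; exact: bm_cst.
  + by apply: bmM => //; exact: bm_cst.
  by apply: eq_Rintegral => t _; ring.
- move=> t; apply: cvgM; last exact: cvg_cst.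
  by apply: cvgM; [exact: cvg_cst|exact: cX].
- by exists 1 => t /andP[t0 t1]; rewrite ger0_norm ?exprn_ge0// exprn_ile1.
- under eq_fun do rewrite E.
  apply: bm01_continuous => t; apply: (@cvgB _ R^o);
    by apply: cvgM; [exact: cvg_cst|exact: cX].
Qed.

(** Tested against (t - 1/2) w^j with w = t(1-t), the integration by parts closes up on powers of w,
    because (1-2t)^2 = 1 - 4w. *)
Lemma beta_var_moment_step a pi j : 0 < a -> beta_law a a pi ->
  (1 + 2 * (a + j%:R)) * \int[pi]_(t in `[0, 1]) (t * (1 - t)) ^+ j.+1 =
  (a + j%:R) / 2 * \int[pi]_(t in `[0, 1]) (t * (1 - t)) ^+ j.
Proof.
move=> a0 bl; pose w (t : R) := t * (1 - t).
have dw (t : R) : is_derive t 1 w (1 - 2 * t).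
  have ho : is_derive t 1 (fun x : R => 1 - x) (-1).
    by have := is_derive_onemr 1 t; under eq_fun do rewrite mul1r.
  by apply: (is_derive_eq (is_derive_mul (is_derive_id t 1) ho)); ring.
have cw := is_derive_continuous dw.
have cX i : continuous (fun t : R => w t ^+ i).
  by move=> t; exact: (continuous_comp (cw t) (@exprn_continuous _ _ _)).
have bX i : bounded_measurable (fun t : R => \1_(`[0, 1]%classic) t * w t ^+ i).
  exact: bm01_continuous.
have hid (t : R) : is_derive t 1 (fun t : R => t - 2^-1) 1.
  have := is_derive_add (is_derive_id t 1) (is_derive_cst (- 2^-1 : R) t 1).
  by rewrite addr0.
have hd (t : R) : is_derive t 1 (fun t : R => (t - 2^-1) * w t ^+ j)
    (1 * w t ^+ j + (t - 2^-1) * (j%:R * w t ^+ j.-1 * (1 - 2 * t))).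
  exact: is_derive_mul (hid t) (is_derive_pow j (dw t)).
have E (t : R) : (1 * w t ^+ j + (t - 2^-1) * (j%:R * w t ^+ j.-1 * (1 - 2 * t))) *
    (t * (1 - t)) + (t - 2^-1) * w t ^+ j * (a - (a + a) * t) =
    (1 + 2 * (a + j%:R)) * w t ^+ j.+1 - (a + j%:R) / 2 * w t ^+ j.
  by case: j {hd} => [|j]; rewrite ?expr0 ?exprS /= /w; field.
have := @beta_ibp R a a pi _ _ a0 a0 bl hd.
under eq_Rintegral do rewrite E.
move=> I; apply/eqP; rewrite -subr_eq0; apply/eqP.
have cid : continuous (fun t : R => t - 2^-1) := is_derive_continuous hid.
rewrite -[RHS]I => {I}.
- rewrite !(bm_int_mkcond pi `[0, 1]%classic) -!bm_intZ//.
  rewrite -bm_intB; last 2 first.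
  + by apply: bmM; [exact: bm_cst|exact: bX j.+1].
  + by apply: bmM; [exact: bm_cst|exact: bX j].
  by apply: eq_Rintegral => t _; rewrite /w; ring.
- move=> t; apply: (@cvgD _ R^o).
    by apply: cvgM; [exact: cvg_cst|exact: cX].
  apply: cvgM; first exact: cid.
  apply: cvgM; first by apply: cvgM; [exact: cvg_cst|exact: cX].
  by apply: (@cvgB _ R^o); [exact: cvg_cst|apply: cvgM; [exact: cvg_cst|exact: cvg_id]].
- exists 1 => t /andP[t0 t1].
  have w0 : 0 <= w t by rewrite mulr_ge0// subr_ge0.
  have w1 : w t <= 1 by rewrite mulr_ile1// ?subr_ge0// gerBl.
  rewrite normrM -[leRHS]mulr1; apply: ler_pM => //.
    by rewrite ler_norml; lra.
  by rewrite ger0_norm ?exprn_ge0// exprn_ile1.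
- under eq_fun do rewrite E.
  apply: bm01_continuous => t; apply: (@cvgB _ R^o);
    by apply: cvgM; [exact: cvg_cst|exact: cX].
Qed.

(** The j-th moment after one step is 4^j E[b^j] E[(t(1-t))^j]. Passing from j to j+1 multiplies it
    by 4 (a+1/2+j)/(2a+j) times (a+j)/(2(1+2a+2j)), which is (a+j)/(2a+j), the ratio of consecutive
    moments of Beta(a,a). *)
Lemma beta_invariant a lam pi : 1 / 2 < a -> beta_law (a + 1 / 2) (a - 1 / 2) lam ->
  beta_law a a pi -> logistic_step lam pi pi.
Proof.
move=> ha bl bp; have a0 : 0 < a by lra.
have p0 : 0 < a + 1 / 2 by lra.
have q0 : 0 < a - 1 / 2 by lra.
have l1 := beta_law_itv01 bl; have p1 := beta_law_itv01 bp.
pose prodP : probability (R * R)%type R := (lam \x pi)%E.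
pose X : {RV prodP >-> R} := mfun_Sub (mem_set (@measurable_logistic_map R)).
pose nu : probability R R := distribution prodP X.
have st : logistic_step lam pi nu by move=> A mA.
have in01 t : t \in `[(0 : R), 1]%classic -> 0 <= t <= 1 by rewrite inE/= in_itv.
have mI : measurable (`[(0 : R), 1]%classic) by [].
have E j : \int[nu]_(t in `[0, 1]) t ^+ j =
    4 ^+ j * (\int[lam]_(t in `[0, 1]) t ^+ j * \int[pi]_(t in `[0, 1]) (t * (1 - t)) ^+ j).
  have cX i : continuous (fun t : R => t ^+ i) by move=> t; exact: exprn_continuous.
  have bX i : bounded_measurable (fun t : R => \1_(`[0, 1]%classic) t * t ^+ i).
    exact: bm01_continuous.
  rewrite (bm_int_mkcond nu) (logistic_step_int st (bX j)).
  have bG := bm_kernel lam (bX j).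
  rewrite (supp01_int p1 bG) (bm_int_mkcond pi) (bm_int_mkcond pi `[0, 1]%classic).
  pose L := \int[lam]_(t in `[0, 1]) t ^+ j.
  transitivity (\int[pi]_x (4 ^+ j * L * (\1_(`[0, 1]%classic) x * (x * (1 - x)) ^+ j))); last first.
    rewrite bm_intZ ?mulrA//; apply: bm01_continuous => t.
    have h1 : {for t, continuous (fun t : R => t * (1 - t))}.
      by apply: cvgM; [exact: cvg_id|apply: (@cvgB _ R^o); [exact: cvg_cst|exact: cvg_id]].
    exact: (continuous_comp h1 (@exprn_continuous _ _ _)).
  apply: eq_Rintegral => x _; rewrite indicE.
  case: (boolP (x \in _)) => [/in01 x01|_]; last by rewrite !mul0r mulr0.
  rewrite !mul1r (supp01_int l1); last first.
    exact: (bm_mulr (f := fun t => \1_(`[0, 1]%classic) t * t ^+ j) (hump x) (bX j)).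
  have /andP[h0 h1] := hump01 x01.
  rewrite (bm_int_mkcond lam).
  transitivity (\int[lam]_b (hump x ^+ j * (\1_(`[0, 1]%classic) b * b ^+ j))).
    apply: eq_Rintegral => b _; rewrite indicE.
    case: (boolP (b \in _)) => [/in01/andP[b0 b1]|_]; last by rewrite !mul0r mulr0.
    rewrite indicE mem_set/=; last by rewrite in_itv/= mulr_ge0//= mulr_ile1.
    by rewrite !mul1r exprMn mulrC.
  rewrite bm_intZ// -(bm_int_mkcond lam `[0, 1]%classic (fun t => t ^+ j)) -/L.
  by rewrite /hump -mulrA exprMn; ring.
have M0 (m : probability R R) (f : R -> R) : m `[0, 1]%classic = 1%E ->
    \int[m]_(t in `[0, 1]) (f t) ^+ 0 = 1.
  move=> m1; rewrite (_ : \int[m]_(t in `[0, 1]) (f t) ^+ 0 = \int[m]_(t in `[0, 1]) 1).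
    by rewrite Rintegral_cst// [X in _ * fine X]m1 mulr1.
  by apply: eq_Rintegral => t _; rewrite expr0.
have key j : \int[nu]_(t in `[0, 1]) t ^+ j = \int[pi]_(t in `[0, 1]) t ^+ j.
  rewrite E; elim: j => [|j IH]; first by rewrite !M0// expr0 !mulr1.
  have e1 := beta_moment_step j p0 q0 bl; have e2 := beta_moment_step j a0 a0 bp.
  have e3 := beta_var_moment_step j a0 bp.
  move: e1 e2 e3 IH.
  set L1 := Rintegral lam _ _; set L0 := Rintegral lam _ _.
  set M1 := Rintegral pi _ _; set N0 := Rintegral pi _ _.
  set W1 := Rintegral pi _ _; set W0 := Rintegral pi _ _.
  have j0 : 0 <= j%:R :> R by [].
  move: (j%:R) j0 => n n0 e1 e2 e3 IH.
  have n1 : a + 1 / 2 + (a - 1 / 2) + n != 0 by rewrite gt_eqF//; lra.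
  have n2 : a + a + n != 0 by rewrite gt_eqF//; lra.
  have n3 : 1 + 2 * (a + n) != 0 by rewrite gt_eqF//; lra.
  have f1 : L1 = (a + 1 / 2 + n) * L0 / (a + a + n).
    by rewrite -[LHS](mulKf n1) e1 (_ : a + 1 / 2 + (a - 1 / 2) = a + a); [rewrite mulrC|ring].
  have f2 : M1 = (a + n) * N0 / (a + a + n) by rewrite -[LHS](mulKf n2) e2 mulrC.
  have f3 : W1 = (a + n) / 2 * W0 / (1 + 2 * (a + n)) by rewrite -[LHS](mulKf n3) e3 mulrC.
  rewrite f2 -IH f1 f3 exprS; field.
  by rewrite n2 n3.
have nu1 : nu `[0, 1]%classic = 1%E.
  rewrite -[LHS]fineK ?fin_num_measure//; congr (_%:E).
  rewrite -[LHS]mul1r -Rintegral_cst//.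
  transitivity (\int[nu]_(t in `[0, 1]) t ^+ 0).
    by apply: eq_Rintegral => t _; rewrite expr0.
  by rewrite E (M0 lam id l1) (M0 pi (fun t : R => t * (1 - t)) p1) expr0 !mulr1.
move=> A mA; rewrite -(st A mA); apply/esym.
exact: (moment_determined nu1 p1 key).
Qed.

End invariance.

(** * The chain property from mutual independence *)

Section independence.
Variables (d : measure_display) (T : measurableType d) (R : realType).
Variable P : probability T R.

Lemma bigcap_fset0 (A : nat -> set T) : \bigcap_(j in [set` (fset0 : {fset nat})]) A j = setT.
Proof. by apply/seteqP; split => // w _ j; rewrite /= inE. Qed.

(** Uniqueness of product measures is applied to P restricted to E, so an event depending on the
    remaining variables can be carried along. *)
Lemma joint_law (l p : probability R R) (U V : T -> R) (E : set T) (c : {nonneg R}) :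
  measurable_fun setT U -> measurable_fun setT V -> measurable E ->
  (forall A B : set R, measurable A -> measurable B ->
    P (U @^-1` A `&` V @^-1` B `&` E) = (c%:num%:E * (l A * p B))%E) ->
  forall C : set (R * R), measurable C ->
  P ((fun w => (U w, V w)) @^-1` C `&` E) = (c%:num%:E * (l \x p) C)%E.
Proof.
move=> mU mV mE h C mC.
have mX : measurable_fun setT (fun w => (U w, V w)) by exact: measurable_fun_pair.
have e1 : (mscale c l \x p)%E C = mscale c (l \x p)%E C.
  apply: product_measure_unique => // A B mA mB.
  have e := product_measure1E l p mA mB.
  by rewrite /mscale -muleA; congr (_ * _)%E; exact: e.
have e2 : (mscale c l \x p)%E C =
    pushforward (mrestr P mE) (fun w => (U w, V w)) C.
  apply: (@product_measure_unique _ _ _ _ _ (mscale c l) p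
    (pushforward (mrestr P mE) (fun w => (U w, V w)))) => // A B mA mB.
  by rewrite /pushforward /mrestr /mscale -muleA -h.
by move: e2; rewrite e1.
Qed.

Variables (B : nat -> {RV P >-> R}) (x : R).
Hypothesis indB : mutually_independent B.

Let F m := forward_iterate B x m.
Let mF m : measurable_fun setT (F m) := measurable_forward_iterate B x m.

(** The m-th iterate involves only the variables of index below m; this is its independence from the
    others, in the form propagated by induction. *)
Let independent_at m := forall (J : {fset nat}) (A : nat -> set R) (D : set R),
  (forall j, measurable (A j)) -> measurable D -> (forall j, j \in J -> (m <= j)%N) ->
  P (F m @^-1` D `&` \bigcap_(j in [set` J]) (B j @^-1` A j)) =
  (P (F m @^-1` D) * \prod_(j <- J) P (B j @^-1` A j))%E.

Let mpre (f : T -> R) (A : set R) : measurable_fun setT f -> measurable A ->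
  measurable (f @^-1` A).
Proof. by move=> mf mA; rewrite -[X in measurable X]setTI; exact: mf. Qed.

Let logistic_joint m (J : {fset nat}) (A : nat -> set R) (D : set R) :
  independent_at m ->
  (forall j, measurable (A j)) -> measurable D -> (forall j, j \in J -> (m < j)%N) ->
  P (F m.+1 @^-1` D `&` \bigcap_(j in [set` J]) (B j @^-1` A j)) =
  (\prod_(j <- J) P (B j @^-1` A j) *
   (distribution P (B m) \x distribution P (forward_RV B x m))
     ((fun z => logistic_map z.1 z.2) @^-1` D))%E.
Proof.
move=> IH mA mD Jm; set E := \bigcap_(j in _) _; set Pi := (X in (X * _)%E).
have mE : measurable E.
  by apply: fin_bigcap_measurable => [|j _]; [exact: finite_fset|apply: mpre].
have Pi0 : (0 <= Pi)%E by apply: prode_ge0 => j _; exact: measure_ge0.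
have Pifin : Pi \is a fin_num.
  rewrite /Pi; elim/big_ind: _ => //; first by move=> ? ?; exact: fin_numM.
  by move=> j _; apply: fin_num_measure; exact: mpre.
have c0 : 0 <= fine Pi by rewrite fine_ge0.
pose c : {nonneg R} := NngNum c0.
have PiE : Pi = c%:num%:E by rewrite /= fineK.
rewrite PiE.
have mC : measurable ((fun z : R * R => logistic_map z.1 z.2) @^-1` D).
  by rewrite -[X in measurable X]setTI; apply: measurable_logistic_map.
have mB : measurable_fun setT (B m) by [].
rewrite -(joint_law mB (mF m) mE _ mC)//.
move=> A0 D0 mA0 mD0; rewrite -PiE.
(* To use the induction hypothesis, the constraint on the variable of index m is added to the family
   indexed by J. *)
pose A' j := if j == m then A0 else A j.
have mA' j : measurable (A' j) by rewrite /A'; case: ifP.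
have mJ : m \notin J by apply/negP => /Jm; rewrite ltnn.
have Jm' j : j \in (m |` J)%fset -> (m <= j)%N.
  by rewrite in_fset1U => /orP[/eqP ->|/Jm /ltnW].
have := IH (m |` J)%fset A' D0 mA' mD0 Jm'.
rewrite big_fsetU1//= {2}/A' eqxx.
have -> : (\prod_(j <- J) P (B j @^-1` A' j))%E = Pi.
  apply: eq_big_seq => j jJ; rewrite /A' ifF//; apply/negbTE.
  by apply: contra mJ => /eqP <-.
have -> : \bigcap_(j in [set` (m |` J)%fset]) (B j @^-1` A' j) = B m @^-1` A0 `&` E.
  apply/seteqP; split => w /= h.
    split; first by have := h m; rewrite /= /A' eqxx; apply; rewrite /= in_fset1U eqxx.
    move=> j /= jJ; have := h j; rewrite /= /A' ifF; first by apply; rewrite /= in_fset1U jJ orbT.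
    by apply/negbTE; apply: contra mJ => /eqP <-.
  move=> j /=; rewrite in_fset1U /A'; case: eqP => [-> _|_ /= jJ]; first exact: h.1.
  exact: h.2.
rewrite setIA [X in X `&` E]setIC => ->.
by rewrite muleCA [in RHS]muleC -!muleA; congr (_ * _)%E; rewrite muleC.
Qed.

Let independent_all m : independent_at m.
Proof.
elim: m => [|m IH] J A D mA mD Jm.
  have [xD|xD] := pselect (D x).
    have -> : F 0 @^-1` D = setT by apply/seteqP; split.
    rewrite setTI [X in (X * _)%E](_ : _ = 1%E) ?mul1e; last exact: probability_setT.
    exact: indB.
  have -> : F 0 @^-1` D = set0 by apply/seteqP; split.
  by rewrite set0I measure0 mul0e.
have step := logistic_joint IH mA mD Jm; rewrite step muleC; congr (_ * _)%E.
have := @logistic_joint m fset0 A D IH mA mD.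
rewrite big_seq_fset0 mul1e => <-; last by move=> j; rewrite inE.
by rewrite bigcap_fset0 setIT.
Qed.

Lemma forward_logistic_step (lam : probability R R) m :
  (forall A, measurable A -> distribution P (B m) A = lam A) ->
  logistic_step lam (distribution P (forward_RV B x m))
    (distribution P (forward_RV B x m.+1)).
Proof.
move=> hl A mA.
have := @logistic_joint m fset0 (fun=> setT) A (@independent_all m) (fun=> measurableT) mA.
rewrite big_seq_fset0 mul1e => h.
transitivity ((distribution P (B m) \x distribution P (forward_RV B x m))%E
     ((fun z => logistic_map z.1 z.2) @^-1` A)).
  rewrite -h; last by move=> j; rewrite inE.
  by rewrite bigcap_fset0 setIT.
apply: product_measure_unique; last first.
  by rewrite -[X in measurable X]setTI; apply: measurable_logistic_map.
move=> A1 A2 m1 m2; have e := product_measure1E lam (distribution P (forward_RV B x m)) m1 m2.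
apply: (eq_trans e); congr (_ * _)%E; exact/esym/hl.
Qed.

End independence.

(** * Concentration of the chain near a deterministic orbit *)

Section early_steps.
Variable R : realType.
Implicit Types lam mu nu pi : probability R R.

(** Fixes a radius at which a mass of order rho^e1 beats a Beta mass of order rho^e2; each
    separation below reduces to such a comparison. *)
Lemma small_power (c C e1 e2 r0 : R) : 0 < c -> 0 <= C -> e1 < e2 -> 0 < r0 ->
  exists rho, [/\ 0 < rho, rho <= r0 & C * rho `^ e2 <= c * rho `^ e1].
Proof.
move=> c0 C0 e12 r00; have d0 : 0 < e2 - e1 by rewrite subr_gt0.
have q0 : 0 < c / (C + 1) by apply: divr_gt0 => //; lra.
pose z := (c / (C + 1)) `^ (e2 - e1)^-1.
have z0 : 0 < z by exact: powR_gt0.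
exists (Num.min r0 z); have m0 : 0 < Num.min r0 z by rewrite lt_min r00.
split => //; first by rewrite ge_min lexx.
have -> : e2 = e1 + (e2 - e1) by ring.
rewrite powRD; last by rewrite (gt_eqF m0) implybT.
rewrite mulrCA mulrC; apply: ler_wpM2r; first exact: powR_ge0.
have h : (Num.min r0 z) `^ (e2 - e1) <= c / (C + 1).
  rewrite [leRHS](_ : _ = z `^ (e2 - e1)); last first.
    by rewrite /z -powRrM mulVf ?gt_eqF// powRr1// ltW.
  by apply: ge0_ler_powR; rewrite ?nnegrE ?(ltW d0) ?(ltW m0) ?(ltW z0)// ge_min lexx orbT.
apply: (le_trans (ler_wpM2l C0 h)); rewrite mulrA ler_pdivrMr; last by lra.
by rewrite mulrC; apply: ler_wpM2l; [exact: ltW|lra].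
Qed.

Lemma edge_gap mu pi w tau : 0 < tau -> lip01_close mu pi w ->
  \int[mu]_t edge tau t <= \int[pi]_t edge (2 * tau) t + w / tau.
Proof.
move=> t0 cl; have [chi [bc e1 e2 lip]] := edge_test t0.
have ti0 : 0 <= tau^-1 by rewrite invr_ge0 ltW.
have := cl chi tau^-1 bc ti0 lip; rewrite ler_norml mulrC => /andP[_ h].
have h1 : \int[mu]_t edge tau t <= \int[mu]_t chi t by apply: bm_le => //; exact: bm_edge.
have h2 : \int[pi]_t chi t <= \int[pi]_t edge (2 * tau) t by apply: bm_le => //; exact: bm_edge.
by lra.
Qed.

Lemma ball_gap mu pi w y rho : 0 < rho -> lip01_close mu pi w ->
  \int[mu]_t ind_ball y rho t <= \int[pi]_t ind_ball y (2 * rho) t + w / rho.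
Proof.
move=> t0 cl; pose chi (t : R) := clamp (2 - `|t - y| / rho).
have lip u v : `|chi u - chi v| <= rho^-1 * `|u - v|.
  apply: (le_trans (clamp_lip _ _)).
  rewrite [X in `|X|](_ : _ = rho^-1 * (`|v - y| - `|u - y|)); last by ring.
  rewrite normrM (ger0_norm (x := rho^-1)) ?invr_ge0 ?(ltW t0)//.
  apply: ler_wpM2l; first by rewrite invr_ge0 ltW.
  apply: (le_trans (ler_dist_dist _ _)); rewrite distrC.
  by rewrite (_ : u - y - (v - y) = u - v)//; ring.
have cc : continuous chi.
  move=> t; have h : {for t, continuous (fun t : R => 2 - `|t - y| / rho)}.
    apply: (@cvgB _ R^o); first exact: cvg_cst.
    apply: cvgM; last exact: cvg_cst.
    by apply: (@cvg_norm _ R^o); apply: (@cvgB _ R^o); [exact: cvg_id|exact: cvg_cst].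
  exact: (continuous_comp h (@continuous_clamp R _)).
have c01 t : 0 <= chi t <= 1 := clamp01 _.
have bc : bounded_measurable chi by exact: continuous01_bm.
have e1 t : ind_ball y rho t <= chi t.
  have [h|h] := leP `|t - y| rho; last first.
    by rewrite ind_ball_eq0//; case/andP: (c01 t).
  rewrite ind_ball_in// /chi clamp_ge1//.
  have : `|t - y| / rho <= 1 by rewrite ler_pdivrMr// mul1r.
  by lra.
have e2 t : chi t <= ind_ball y (2 * rho) t.
  have [h|h] := leP `|t - y| (2 * rho).
    by rewrite ind_ball_in//; case/andP: (c01 t).
  rewrite /chi clamp_le0 ?ind_ball_ge0//.
  by rewrite subr_le0 ler_pdivlMr// ltW.
have ti0 : 0 <= rho^-1 by rewrite invr_ge0 ltW.
have := cl chi rho^-1 bc ti0 (fun u v _ _ => lip u v); rewrite ler_norml mulrC => /andP[_ h].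
have h1 : \int[mu]_t ind_ball y rho t <= \int[mu]_t chi t by apply: bm_le => //; exact: bm_ind_ball.
have h2 : \int[pi]_t chi t <= \int[pi]_t ind_ball y (2 * rho) t by apply: bm_le => //; exact: bm_ind_ball.
by lra.
Qed.

(* The interval integration by parts tested against [t - u] bounds the mass of
   [[u, v]] by [2 (v - u)] times the density at [v]. *)
Lemma beta_ball_mass a delta : 0 < a -> 0 < delta -> delta <= 1 / 2 ->
  exists C r0 : R, [/\ 0 <= C, 0 < r0 & forall pi, beta_law a a pi ->
  forall y rho, delta <= y -> y <= 1 - delta -> 0 < rho -> rho <= r0 ->
  \int[pi]_t ind_ball y rho t <= C * rho].
Proof.
move=> a0 d0 d2; pose P := `|a - 1| + 1; pose c := beta_const a a.
have P1 : 1 <= P by rewrite lerDr.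
have c0 : 0 <= c := beta_const_ge0 a a.
pose r0 := Num.min (delta / 2) (delta / (16 * P)).
have P0 : 0 < 16 * P by lra.
have r00 : 0 < r0 by rewrite lt_min; apply/andP; split; exact: divr_gt0.
exists (4 * (c * (2 / delta) * (2 / delta))), r0; split => //.
  have dd : 0 <= 2 / delta by rewrite divr_ge0// ltW.
  by apply: mulr_ge0 => //; apply: mulr_ge0 => //; exact: mulr_ge0.
move=> pi bl y rho yd yd' rho0 rr.
have r1 : rho <= delta / 2 by rewrite (le_trans rr)// ge_min lexx.
have r2 : rho * (16 * P) <= delta.
  by rewrite -ler_pdivlMr// (le_trans rr)// ge_min lexx orbT.
pose u := y - rho; pose v := y + rho.
have uE : u = y - rho by []; have vE : v = y + rho by [].
have u0 : 0 < u by lra.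
have uv : u < v by lra.
have v1 : v < 1 by lra.
have -> : \int[pi]_t ind_ball y rho t = fine (pi `[u, v]%classic) by rewrite prob_indic.
have dh (t : R) : is_derive t 1 (fun t => t - u : R) 1.
  have := is_derive_add (is_derive_id t 1) (is_derive_cst (- u) t 1).
  by rewrite addr0.
have cd : continuous (fun _ : R => (1 : R)) by move=> t; exact: cvg_cst.
have bt := @bm_beta_test R a a _ _ u v u0 (ltW uv) v1 dh cd.
have I := beta_interval_ibp bl u0 uv v1 dh cd.
have low t : u <= t <= v -> 1 / 2 <= 1 + (t - u) * beta_dlog a a t.
  move=> /andP[ut tv].
  have t0 : delta / 2 <= t by lra.
  have t1 : delta / 2 <= 1 - t by lra.
  have d20 : 0 < delta / 2 by rewrite divr_gt0.
  have i1 : t^-1 <= 2 / delta.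
    by rewrite -[2 / delta]invrK invf_div lef_pV2 ?posrE//; exact: lt_le_trans t0.
  have i2 : (1 - t)^-1 <= 2 / delta.
    by rewrite -[2 / delta]invrK invf_div lef_pV2 ?posrE//; exact: lt_le_trans t1.
  have i10 : 0 <= t^-1 by rewrite invr_ge0; lra.
  have i20 : 0 <= (1 - t)^-1 by rewrite invr_ge0; lra.
  have D : `|beta_dlog a a t| <= P * (4 / delta).
    rewrite /beta_dlog -mulrBr normrM; apply: ler_pM => //; first by rewrite /P; lra.
    rewrite (_ : 4 / delta = 2 / delta + 2 / delta); last by ring.
    by rewrite ler_norml; lra.
  have tu : 0 <= t - u <= 2 * rho by lra.
  have : `|(t - u) * beta_dlog a a t| <= 1 / 2.
    rewrite normrM; case/andP: tu => tu0 tu1.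
    apply: (@le_trans _ _ (2 * rho * (P * (4 / delta)))).
      by apply: ler_pM => //; rewrite ger0_norm.
    rewrite (_ : 2 * rho * (P * (4 / delta)) = (rho * (16 * P)) / delta / 2); last by field; rewrite gt_eqF.
    by rewrite ler_pM2r ?invr_gt0// ler_pdivrMr// mul1r.
  by rewrite ler_norml; lra.
have h3 := int_ge_cst pi bt low; rewrite I subrr mul0r subr0 in h3.
have vd : delta / 2 <= v by lra.
have vd' : delta / 2 <= 1 - v by lra.
have pw (z : R) : delta / 2 <= z -> z <= 1 -> z `^ (a - 1) <= 2 / delta.
  move=> z1 z2; have z0 : 0 < z by lra.
  have -> : z `^ (a - 1) = z `^ a / z.
    by rewrite powRB ?powRr1 ?(ltW z0)// (gt_eqF z0) implybT.
  rewrite ler_pdivrMr//; apply: (@le_trans _ _ 1).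
    by apply: powR_itv01; [rewrite (ltW z0)|exact: ltW].
  by rewrite mulrAC ler_pdivlMr// mul1r; lra.
have W : beta_weight a a v <= c * (2 / delta) * (2 / delta).
  rewrite /beta_weight -/c; apply: ler_pM; rewrite ?powR_ge0//.
  - by apply: mulr_ge0 => //; exact: powR_ge0.
  - by apply: ler_wpM2l => //; apply: pw; lra.
  - by apply: pw; lra.
rewrite (_ : v - u = 2 * rho) in h3; last by lra.
have h4 : 2 * rho * beta_weight a a v <= 2 * rho * (c * (2 / delta) * (2 / delta)).
  by apply: ler_wpM2l => //; rewrite mulr_ge0// ltW.
have h5 := le_trans h3 h4; move: h5; move: (c * _ * _) => w.
by rewrite (_ : 4 * w * rho = 2 * (2 * rho * w)); [lra|ring].
Qed.

Section chain.
Variables (lam : probability R R) (sg s K : R).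
Hypothesis kb : kernel_bounds lam sg s K.

(** Since hump x = 4x(1-x), a point of the edge region lands within 4 tau of 0, or below 0, whatever
    b in [0,1]. *)
Lemma edge_push nu nu' tau : logistic_step lam nu nu' -> 0 <= tau ->
  \int[nu]_t edge tau t <= \int[nu']_t edge (4 * tau) t.
Proof.
move=> st t0; rewrite (logistic_step_int st (bm_edge _)).
have bG := bm_kernel lam (bm_edge (4 * tau)).
apply: bm_le => //; first exact: bm_edge.
move=> x; have [h|h] := leP (x * (1 - x)) tau; last first.
  by rewrite (edge_eq0 h); apply: Rintegral_ge0 => b _; exact: edge_ge0.
rewrite (edge_in h) (kernel_int01 kb); last exact: bm_mulr (bm_edge _).
rewrite [leLHS](_ : 1 = \int[lam]_(b in `[0, 1]) (1 : R)); last first.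
  by rewrite Rintegral_cst// [X in _ * fine X](kb_supp kb) mulr1.
rewrite !(bm_int_mkcond lam `[0, 1]%classic); apply: bm_le.
- by apply: bmM; [exact: bm_indic|exact: bm_cst].
- by apply: bmM; [exact: bm_indic|exact: bm_mulr (bm_edge _)].
move=> b; rewrite indicE; have [/set_mem/=|_] := boolP (b \in _); last by rewrite !mul0r.
rewrite in_itv/= => /andP[b0 b1]; rewrite !mul1r edge_in//.
have hx : hump x <= 4 * tau by rewrite /hump; lra.
have [hx0|hx0] := leP 0 (hump x).
  have b2 : 0 <= b * hump x by rewrite mulr_ge0.
  have b3 : b * hump x <= hump x by apply: ler_piMl.
  by nra.
have : b * hump x <= 0 by rewrite mulr_ge0_le0// ltW.
by move: (b * hump x) => z; nra.
Qed.

(** Near x = 1/2 the hump is flat: hump x >= 1 - 4 rho^2, and b within rho^2 of 1 leaves b hump x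
    within 5 rho^2 of 1. Such b have mass at least rho^(2 sg) / K. *)
Lemma half_to_edge nu nu' rho : logistic_step lam nu nu' -> 0 < rho -> rho <= 1 / 4 ->
  (rho ^+ 2) `^ sg / K * \int[nu]_t ind_ball (1 / 2) rho t <=
  \int[nu']_t edge (5 * rho ^+ 2) t.
Proof.
move=> st r0 r4; rewrite (logistic_step_int st (bm_edge _)).
have K0 : 0 < K by apply: lt_le_trans (kb_K kb).
have bG := bm_kernel lam (bm_edge (5 * rho ^+ 2)).
rewrite -bm_intZ; last exact: bm_ind_ball.
apply: bm_le => //; first by apply: bmM; [exact: bm_cst|exact: bm_ind_ball].
move=> x; have [h|h] := leP `|x - 1 / 2| rho; last first.
  by rewrite (ind_ball_eq0 h) mulr0; apply: Rintegral_ge0 => b _; exact: edge_ge0.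
rewrite (ind_ball_in h) mulr1 ler_pdivrMr// mulrC.
have q1 : rho ^+ 2 <= 1 by rewrite expr_le1// ?(ltW r0)//; lra.
have q0 : 0 < rho ^+ 2 by rewrite exprn_gt0.
have q01 : 0 < rho ^+ 2 <= 1 by rewrite q0.
apply: (le_trans (kb_lo kb q01)); apply: ler_wpM2l; first exact: ltW.
rewrite -prob_indic//; apply: bm_le; [exact: bm_indic|exact: bm_mulr (bm_edge _)|].
move=> b; rewrite indicE; have [/set_mem/=|_] := boolP (b \in _); last exact: edge_ge0.
rewrite in_itv/= => /andP[b0 b1]; rewrite edge_in//.
have hE : hump x = 1 - 4 * (x - 1 / 2) ^+ 2 by rewrite /hump; field.
have h2 : (x - 1 / 2) ^+ 2 <= rho ^+ 2.
  by rewrite -(real_normK (num_real (x - 1 / 2))) lerXn2r ?nnegrE ?(ltW r0).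
have hx1 := hump_le1 x.
have hx0 : 1 - 4 * rho ^+ 2 <= hump x by rewrite hE; lra.
have q16 : rho ^+ 2 <= 1 / 16.
  have : rho * rho <= 1 / 4 * (1 / 4) by apply: ler_pM; rewrite ?(ltW r0).
  by rewrite -expr2; lra.
move: (rho ^+ 2) q0 q16 hx0 b0 {q1 q01 h2} => q q0 q16 hx0 b0.
have b2 : (1 - q) * (1 - 4 * q) <= b * hump x by apply: ler_pM; lra.
have b3 : b * hump x <= 1 by apply: mulr_ile1 => //; lra.
have b4 : 0 <= b * hump x by apply: mulr_ge0; lra.
by move: (b * hump x) b2 b3 b4 => z b2 b3 b4; nra.
Qed.

(** The orbit with b = 1 throughout, around which the lower mass bounds are proved. *)
Fixpoint hump_orbit (x : R) (l : nat) : R :=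
  if l is l'.+1 then hump (hump_orbit x l') else x.

Lemma hump_orbit01 x l : 0 <= x <= 1 -> 0 <= hump_orbit x l <= 1.
Proof. by move=> x01; elim: l => [//|l IH] /=; exact: hump01. Qed.

(** A point of [delta, 1-delta] is not sent below delta, as 4 delta (1-delta) >= 2 delta. So an
    orbit near an end either started there or came near 1, hence near the critical point just
    before. *)
Lemma hump_orbit_back x delta m : 0 <= x <= 1 -> delta <= 1 / 2 ->
  hump_orbit x m < delta \/ 1 - delta < hump_orbit x m ->
  (x < delta \/ 1 - delta < x) \/ exists2 l, (l < m)%N & 1 - delta < hump_orbit x l.+1.
Proof.
move=> x01 d2; elim: m => [|m IH] /=; first by left.
case=> h; last by right; exists m.
have : hump_orbit x m < delta \/ 1 - delta < hump_orbit x m.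
  have /andP[y0 y1] := hump_orbit01 m x01.
  move: (hump_orbit x m) y0 y1 h => y y0 y1; rewrite /hump => h.
  have [?|yd] := ltP y delta; first by left.
  by right; rewrite ltNge; apply/negP => yd'; nra.
by move=> /IH[?|[l lm hl]]; [left|right; exists l => //; exact: ltnW].
Qed.

Definition chain_from (mu : nat -> probability R R) (x : R) :=
  (forall f : R -> R, bounded_measurable f -> \int[mu 0]_t f t = f x) /\
  forall i, logistic_step lam (mu i) (mu i.+1).

Lemma step_supp01 nu nu' : logistic_step lam nu nu' -> nu `[0, 1]%classic = 1%E ->
  nu' `[0, 1]%classic = 1%E.
Proof.
move=> st nu1; have mI : measurable (`[(0 : R), 1]%classic) by [].
rewrite -[LHS]fineK ?fin_num_measure//; congr (_%:E).
have bI := bm_indic R mI.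
rewrite -prob_indic// (logistic_step_int st bI).
have bG := bm_kernel lam bI.
rewrite (supp01_int nu1 bG).
transitivity (\int[nu]_(t in `[0, 1]) (1 : R)); last first.
  by rewrite Rintegral_cst// [X in _ * fine X]nu1 mulr1.
apply: eq_Rintegral => z; rewrite inE/= in_itv/= => /hump01/andP[h0 h1].
rewrite (kernel_int01 kb); last exact: bm_mulr.
transitivity (\int[lam]_(t in `[0, 1]) (1 : R)); last first.
  by rewrite Rintegral_cst// [X in _ * fine X](kb_supp kb) mulr1.
apply: eq_Rintegral => b; rewrite inE/= in_itv/= => /andP[b0 b1].
by rewrite indicE mem_set//= in_itv/= mulr_ge0//= mulr_ile1.
Qed.

Lemma chain_supp01 (mu : nat -> probability R R) (x : R) l : 0 <= x <= 1 -> chain_from mu x -> mu l `[0, 1]%classic = 1%E.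
Proof.
move=> x01 [mu0 st]; elim: l => [|l IH]; last exact: step_supp01 (st l) IH.
rewrite -[LHS]fineK ?fin_num_measure//; congr (_%:E).
rewrite -prob_indic// mu0; last exact: bm_indic.
by rewrite indicE mem_set//= in_itv.
Qed.

(** Each step costs a factor rho^sg, the mass of b within rho/2 of 1; the other half of the radius
    absorbs an error rho/8 at the previous time, [hump] being 4-Lipschitz. *)
Lemma ball_lower l : 0 <= sg -> exists c : R, 0 < c /\ forall (mu : nat -> probability R R) (x : R), 0 <= x <= 1 -> chain_from mu x ->
  forall rho, 0 < rho <= 1 ->
  c * rho `^ (l%:R * sg) <= \int[mu l]_t ind_ball (hump_orbit x l) rho t.
Proof.
move=> sg0; have K0 : 0 < K by apply: lt_le_trans (kb_K kb).
elim: l => [|l [c [c0 IH]]].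
  exists 1; split => // mu x x01 [mu0 _] rho /andP[r0 r1].
  rewrite mu0/=; last exact: bm_ind_ball.
  by rewrite ind_ball_in ?subrr ?normr0 ?(ltW r0)// mul0r powRr0 mulr1.
exists (c * 8^-1 `^ (l%:R * sg) * (2^-1 `^ sg / K)); split.
  by rewrite !mulr_gt0 ?powR_gt0 ?invr_gt0.
move=> mu x x01 ch rho /andP[r0 r1]; have [_ st] := ch.
have /andP[y0 y1] := hump_orbit01 l x01.
set y := hump_orbit x l in y0 y1 *.
rewrite (logistic_step_int (st l) (bm_ind_ball _ _)) /= -/y.
have r8 : 0 < rho / 8 <= 1 by lra.
have := IH mu x x01 ch _ r8; rewrite -/y => h.
apply: (@le_trans _ _ ((rho / 2) `^ sg / K * \int[mu l]_t ind_ball y (rho / 8) t)).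
  apply: (@le_trans _ _ ((rho / 2) `^ sg / K * (c * (rho / 8) `^ (l%:R * sg)))); last first.
    by apply: ler_wpM2l => //; rewrite divr_ge0 ?powR_ge0// ltW.
  have e : l.+1%:R * sg = l%:R * sg + sg by rewrite -natr1 mulrDl mul1r.
  rewrite e powRD; last by rewrite (gt_eqF r0) implybT.
  have p8 : (rho / 8) `^ (l%:R * sg) = rho `^ (l%:R * sg) * 8^-1 `^ (l%:R * sg).
    by rewrite powRM ?(ltW r0)// invr_ge0.
  have p2 : (rho / 2) `^ sg = rho `^ sg * 2^-1 `^ sg by rewrite powRM ?(ltW r0)// invr_ge0.
  by rewrite p8 p2 le_eqVlt; apply/orP; left; apply/eqP; ring.
have bG := bm_kernel lam (bm_ind_ball (hump y) rho).
have bi : bounded_measurable (ind_ball y (rho / 8)) by exact: bm_ind_ball.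
have supp := chain_supp01 l x01 ch.
rewrite (supp01_int supp bi) (supp01_int supp bG) !(bm_int_mkcond (mu l) `[0, 1]%classic).
rewrite -bm_intZ; last by apply: bmM => //; exact: bm_indic.
apply: bm_le.
- by apply: bmM; [exact: bm_cst|apply: bmM => //; exact: bm_indic].
- by apply: bmM => //; exact: bm_indic.
move=> z; rewrite indicE; have [/set_mem/=|_] := boolP (z \in _); last by rewrite !mul0r mulr0.
rewrite in_itv/= => z01; rewrite !mul1r.
have [hz|hz] := leP `|z - y| (rho / 8); last first.
  by rewrite (ind_ball_eq0 hz) mulr0; apply: Rintegral_ge0 => b _; exact: ind_ball_ge0.
rewrite (ind_ball_in hz) mulr1 ler_pdivrMr// [leRHS]mulrC.
have /andP[hz0 hz1] := hump01 z01.
apply: (kernel_lo_ball kb) => //; first by lra.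
have y01 : 0 <= y <= 1 by rewrite y0.
have := hump_lip z01 y01; move: (hump z) hz0 hz1 => hz' *; nra.
Qed.

End chain.

End early_steps.

(** * Separation at early times, and smoothness after enough steps *)

Section separation.
Variable R : realType.
Implicit Types lam mu nu pi : probability R R.

Lemma edge_le (t tau tau' : R) : tau <= tau' -> edge tau t <= edge tau' t.
Proof.
move=> h; have [h1|h1] := leP (t * (1 - t)) tau.
  by rewrite !edge_in// (le_trans h1).
by rewrite (edge_eq0 h1) edge_ge0.
Qed.

Lemma beta_edge_mass (a : R) : 0 < a -> exists C : R, 0 <= C /\ forall pi,
  beta_law a a pi -> forall sig, 0 < sig -> \int[pi]_t edge sig t <= C * sig `^ a.
Proof.
move=> a0; have [C1 [C10 H1]] := beta_mass_right a0 a0.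
have [C2 [C20 H2]] := beta_mass_left a0 a0.
have p2 : 0 <= (2 : R) `^ a by exact: powR_ge0.
exists ((1 + C1 + C2) * 2 `^ a); split; first by rewrite mulr_ge0//; lra.
move=> pi bl sig s0; rewrite -mulrA -powRM ?(ltW s0)//.
have [h|h] := leP (2 * sig) 1; last first.
  apply: (@le_trans _ _ 1).
    have := bm_int_bound pi (M := 1) (bm_edge sig); rewrite ler_norml => /(_ _)/andP[|//].
    by move=> t; rewrite /edge indicE; case: (_ \in _); rewrite ?normr1 ?normr0.
  have : 1 <= (2 * sig) `^ a.
    rewrite [leLHS](_ : 1 = 1 `^ a); last by rewrite powR1.
    by apply: ge0_ler_powR; rewrite ?nnegrE ?(ltW a0)// ltW// mulr_gt0.
  move: (_ `^ a) => z z1; have : 0 <= (C1 + C2) * z by apply: mulr_ge0; lra.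
  by move=> h'; clear -z1 h'; lra.
have z0 : 0 < 2 * sig <= 1 by rewrite mulr_gt0.
apply: (@le_trans _ _ (fine (pi `[0, 2 * sig]%classic) + fine (pi `[1 - 2 * sig, 1]%classic))).
  rewrite (supp01_int (beta_law_itv01 bl) (bm_edge _)) (bm_int_mkcond pi `[0, 1]%classic).
  rewrite -!prob_indic// -bm_intD; [|exact: bm_indic..].
  apply: bm_le; first by apply: bmM; [exact: bm_indic|exact: bm_edge].
    by apply: bmD; exact: bm_indic.
  move=> t; have i0 (A : set R) : 0 <= \1_A t :> R by rewrite indicE.
  rewrite indicE; have [/set_mem/=|_] := boolP (t \in _); last first.
    by rewrite mul0r addr_ge0.
  rewrite in_itv/= mul1r => /andP[t0 t1].
  have [h1|h1] := leP (t * (1 - t)) sig; last by rewrite edge_eq0// addr_ge0.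
  rewrite edge_in//; have [t2|t2] := leP t (1 / 2).
    rewrite [X in X + _]indicE mem_set/=; last by rewrite in_itv/= t0/=; nra.
    by rewrite lerDl.
  rewrite [X in _ + X]indicE mem_set/=; last by rewrite in_itv/= t1 andbT; nra.
  by rewrite lerDr.
have := H1 pi bl _ z0; have := H2 pi bl _ z0.
have : 0 <= (2 * sig) `^ a by exact: powR_ge0.
by move: (_ `^ a) (fine _) (fine _) => z u v; lra.
Qed.

Variables (lam : probability R R) (sg s K : R).
Hypothesis kb : kernel_bounds lam sg s K.

Lemma edge_push_iter (mu : nat -> probability R R) tau k i :
  (forall i, logistic_step lam (mu i) (mu i.+1)) -> 0 <= tau ->
  \int[mu k]_t edge tau t <= \int[mu (i + k)%N]_t edge (4 ^+ i * tau) t.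
Proof.
move=> st t0; elim: i => [|i IH]; first by rewrite add0n expr0 mul1r.
apply: (le_trans IH); rewrite addSn exprS -mulrA.
by apply: (edge_push kb) => //; rewrite mulr_ge0 ?exprn_ge0.
Qed.

Lemma all_ball_lower m : 0 <= sg -> exists c : R, 0 < c /\
  forall (mu : nat -> probability R R) (x : R) l, 0 <= x <= 1 -> chain_from lam mu x ->
  (l <= m)%N -> forall rho, 0 < rho <= 1 ->
  c * rho `^ (m%:R * sg) <= \int[mu l]_t ind_ball (hump_orbit x l) rho t.
Proof.
move=> sg0.
suff [c [c0 H]] : exists c : R, 0 < c /\
    forall (mu : nat -> probability R R) (x : R) l, 0 <= x <= 1 -> chain_from lam mu x ->
    (l <= m)%N -> forall rho, 0 < rho <= 1 ->
    c * rho `^ (l%:R * sg) <= \int[mu l]_t ind_ball (hump_orbit x l) rho t.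
  exists c; split => // mu x l x01 ch lm rho /andP[r0 r1].
  apply: le_trans (H mu x l x01 ch lm rho _); last by rewrite r0.
  apply: ler_wpM2l; first exact: ltW.
  apply: ger_powR; first by rewrite r0.
  by apply: ler_wpM2r => //; rewrite ler_nat.
elim: m => [|m [c [c0 IH]]].
  have [c [c0 H]] := ball_lower kb 0 sg0.
  exists c; split => // mu x l x01 ch; rewrite leqn0 => /eqP ->; exact: H.
have [c' [c'0 H]] := ball_lower kb m.+1 sg0.
exists (Num.min c c'); split; first by rewrite lt_min c0.
move=> mu x l x01 ch; rewrite leq_eqVlt => /orP[/eqP ->|lm] rho r01.
  apply: le_trans (H mu x x01 ch rho r01).
  by apply: ler_wpM2r; rewrite ?powR_ge0// ge_min lexx orbT.
apply: le_trans (IH mu x l x01 ch lm rho r01).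
by apply: ler_wpM2r; rewrite ?powR_ge0// ge_min lexx.
Qed.

(** Three situations. Orbit in the bulk at time m: a ball carries mass rho^(m sg) against O(rho) for
    Beta(a,a). Orbit previously near 1: the edge at height rho^2 carries rho^(2 sg + m sg) against
    rho^(2a) = rho^(2 sg + 1). Orbit started near an end: all the mass is in a small edge. The first
    two use m sg < 1; the constants involve neither x nor the chain. *)
Lemma early_separation (a : R) m : 0 < sg -> a = sg + 1 / 2 -> m%:R * sg < 1 ->
  exists c : R, 0 < c /\
  forall (mu : nat -> probability R R) (x : R) pi w, 0 <= x <= 1 -> chain_from lam mu x ->
  beta_law a a pi -> lip01_close (mu m) pi w -> c <= w.
Proof.
move=> sg0 aE ms; have a0 : 0 < a by lra.
have K0 : 0 < K by apply: lt_le_trans (kb_K kb).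
have [Cp [Cp0 Hp]] := beta_edge_mass a0.
have [c0 [c00 Hb]] := all_ball_lower m (ltW sg0).
pose kap := c0 * 2^-1 `^ (m%:R * sg) / K.
have kap0 : 0 < kap by rewrite divr_gt0// mulr_gt0// powR_gt0 ?invr_gt0.
pose e1 := 2 * sg + m%:R * sg; pose e2 := 2 * sg + 1.
have e12 : e1 < e2 by rewrite ltrD2l.
pose T := 4 ^+ m : R; have T0 : 0 < T by rewrite exprn_gt0.
pose D := (2 * (T * 5)) `^ a.
have CD : 0 <= Cp * D by rewrite mulr_ge0// powR_ge0.
have k20 : 0 < kap / 2 by rewrite divr_gt0.
have q4 : 0 < 1 / 4 :> R by [].
have [rho [r0 r4 hr]] := small_power k20 CD e12 q4.
pose tau := T * (5 * rho ^+ 2).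
have rr0 : 0 < rho ^+ 2 by rewrite exprn_gt0.
have tau0 : 0 < tau by apply: mulr_gt0 => //; apply: mulr_gt0.
pose w1 := tau * (kap / 2 * rho `^ e1).
have w10 : 0 < w1 by apply: mulr_gt0 => //; apply: mulr_gt0 => //; exact: powR_gt0.
have CT : 0 <= Cp * (2 * T) `^ a by rewrite mulr_ge0// powR_ge0.
have h20 : 0 < 1 / 2 :> R by [].
have [d2 [d20 d21 hd]] := small_power h20 CT a0 h20.
(* The entry rho^2 ensures that an orbit point above 1 - delta came from within rho/2 of 1/2; the
   entry d2 makes the Beta(a,a) mass of the enlarged edge at most 1/2. The bulk radius [rho3] is
   chosen last, as it depends on delta. *)
pose delta := Num.min d2 (rho ^+ 2).
have dl0 : 0 < delta by rewrite lt_min d20.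
have dl2 : delta <= d2 by rewrite ge_min lexx.
have dlr : delta <= rho ^+ 2 by rewrite ge_min lexx orbT.
have dlh : delta <= 1 / 2 by exact: le_trans d21.
pose w2 := T * delta / 2.
have w20 : 0 < w2 by rewrite divr_gt0// mulr_gt0.
have [Cb [rb [Cb0 rb0 Hball]]] := beta_ball_mass a0 dl0 dlh.
have c20 : 0 < c0 / 2 by rewrite divr_gt0.
have Cb2 : 0 <= 2 * Cb by rewrite mulr_ge0.
have rm0 : 0 < Num.min 1 (rb / 2) by rewrite lt_min ltr01 divr_gt0.
have [rho3 [r30 r31 hr3]] := small_power c20 Cb2 ms rm0.
rewrite powRr1 ?(ltW r30)// in hr3.
pose w3 := rho3 * (c0 / 2 * rho3 `^ (m%:R * sg)).
have w30 : 0 < w3 by apply: mulr_gt0 => //; apply: mulr_gt0 => //; exact: powR_gt0.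
exists (Num.min w1 (Num.min w2 w3)); split; first by rewrite !lt_min w10 w20.
move=> mu x pi w x01 ch bl cl; have [_ st] := ch.
have caseE : hump_orbit x m < delta \/ 1 - delta < hump_orbit x m ->
    w1 <= w \/ w2 <= w.
  move=> /(hump_orbit_back x01 dlh)[hx|[l lm hl]].
    right; have xe : edge delta x = 1.
      rewrite edge_in//; case/andP: x01 => x0 x1; case: hx => hx; nra.
    have h1 : 1 <= \int[mu m]_t edge (T * delta) t.
      have := edge_push_iter 0 m st (ltW dl0); rewrite addn0 (proj1 ch) ?xe//.
      exact: bm_edge.
    have Td : 0 < T * delta by rewrite mulr_gt0.
    have h2 := edge_gap Td cl.
    have Td2 : 0 < 2 * (T * delta) by rewrite mulr_gt0.
    have h3 := Hp pi bl _ Td2.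
    have h4 : Cp * (2 * (T * delta)) `^ a <= 1 / 2.
      apply: (@le_trans _ _ (Cp * (2 * T) `^ a * d2 `^ a)); last first.
        by move: hd; rewrite powRr0 mulr1.
      rewrite -mulrA -powRM ?(ltW d20) ?mulr_ge0 ?(ltW T0)//; apply: ler_wpM2l => //.
      rewrite mulrA; apply: ge0_ler_powR; rewrite ?nnegrE ?(ltW a0) ?mulr_ge0 ?(ltW T0) ?(ltW d20) ?(ltW dl0)//.
      by apply: ler_wpM2l => //; rewrite mulr_ge0// ltW.
    have h5 : 1 / 2 <= w / (T * delta) by lra.
    by move: h5; rewrite ler_pdivlMr// /w2; lra.
  left; have hl2 : `|hump_orbit x l - 1 / 2| <= rho / 2.
    have e : hump_orbit x l.+1 = 1 - 4 * (hump_orbit x l - 1 / 2) ^+ 2.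
      by rewrite /= /hump; field.
    have q : (hump_orbit x l - 1 / 2) ^+ 2 <= (rho / 2) ^+ 2.
      by rewrite e in hl; rewrite expr_div_n; move: hl dlr; rewrite -(natrX _ 2 2) /=; lra.
    rewrite -(ler_pXn2r (n := 2)) ?nnegrE ?divr_ge0 ?(ltW r0)//.
    by rewrite real_normK ?num_real.
  have g1 : kap * rho `^ e1 <= \int[mu l.+1]_t edge (5 * rho ^+ 2) t.
    apply: le_trans (half_to_edge kb (st l) r0 r4).
    have r21 : 0 < rho / 2 <= 1 by rewrite divr_gt0//=; lra.
    have hb := Hb mu x l x01 ch (ltnW lm) _ r21.
    apply: (@le_trans _ _ ((rho ^+ 2) `^ sg / K * (c0 * (rho / 2) `^ (m%:R * sg)))).
      have p2 : (rho / 2) `^ (m%:R * sg) = rho `^ (m%:R * sg) * 2^-1 `^ (m%:R * sg).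
        by rewrite powRM ?(ltW r0)// invr_ge0.
      have p3 : (rho ^+ 2) `^ sg = rho `^ (2 * sg).
        by rewrite -(powR_mulrn 2 (ltW r0)) -powRrM.
      rewrite p2 p3 /e1 powRD; last by rewrite (gt_eqF r0) implybT.
      by rewrite /kap le_eqVlt; apply/orP; left; apply/eqP; ring.
    apply: ler_wpM2l; first by rewrite divr_ge0 ?powR_ge0// ltW.
    apply: (le_trans hb); apply: bm_le; [exact: bm_ind_ball|exact: bm_ind_ball|].
    move=> t; apply: ind_ball_le => ht.
    have := ler_normD (t - hump_orbit x l) (hump_orbit x l - 1 / 2); rewrite subrKA.
    by lra.
  have g2 : \int[mu l.+1]_t edge (5 * rho ^+ 2) t <= \int[mu m]_t edge tau t.
    have t5 : 0 <= 5 * rho ^+ 2 by rewrite mulr_ge0// ltW.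
    have := edge_push_iter l.+1 (m - l.+1) st t5; rewrite subnK// => h.
    apply: (le_trans h); apply: bm_le; [exact: bm_edge|exact: bm_edge|].
    move=> t; apply: edge_le; rewrite /tau; apply: ler_wpM2r => //.
    by apply: ler_weXn2l; [rewrite ler1n|exact: leq_subr].
  have g3 := edge_gap tau0 cl.
  have tau20 : 0 < 2 * tau by rewrite mulr_gt0.
  have g4 := Hp pi bl _ tau20.
  have g5 : Cp * (2 * tau) `^ a = Cp * D * rho `^ e2.
    have -> : 2 * tau = 2 * (T * 5) * rho ^+ 2 by rewrite /tau; ring.
    have T5 : 0 <= 2 * (T * 5) by rewrite !mulr_ge0// ltW.
    rewrite powRM ?(ltW rr0)// -/D mulrA; congr (_ * _).
    rewrite -(powR_mulrn 2 (ltW r0)) -powRrM; congr (_ `^ _).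
    by rewrite /e2 aE; field.
  have g6 : kap / 2 * rho `^ e1 <= w / tau.
    rewrite g5 in g4; have g7 := le_trans g1 (le_trans g2 g3).
    move: g4 g7 hr; move: (rho `^ e1) (_ * rho `^ e2) (Rintegral pi _ _) (w / tau) => A B C E.
    by rewrite (_ : kap / 2 * A = kap * A / 2); [lra|ring].
  by move: g6; rewrite ler_pdivlMr// mulrC.
have [hx|hx] := ltP (hump_orbit x m) delta.
  by rewrite !ge_min; case: caseE => [|->|->]; rewrite ?orbT//; left.
have [hx'|hx'] := ltP (1 - delta) (hump_orbit x m).
  by rewrite !ge_min; case: caseE => [|->|->]; rewrite ?orbT//; right.
rewrite !ge_min; apply/orP; right; apply/orP; right.
have r3m : rho3 <= 1 by rewrite (le_trans r31)// ge_min lexx.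
have r3b : 2 * rho3 <= rb.
  have : rho3 <= rb / 2 by rewrite (le_trans r31)// ge_min lexx orbT.
  by lra.
have r301 : 0 < rho3 <= 1 by rewrite r30.
have f1 := Hb mu x m x01 ch (leqnn m) _ r301.
have f2 := ball_gap (hump_orbit x m) r30 cl.
have r320 : 0 < 2 * rho3 by rewrite mulr_gt0.
have f3 := Hball pi bl _ _ hx hx' r320 r3b.
have f4 : c0 / 2 * rho3 `^ (m%:R * sg) <= w / rho3.
  have f5 := le_trans f1 f2.
  move: f3 f5 hr3; move: (rho3 `^ _) (Rintegral pi _ _) (w / rho3) => A C E.
  rewrite (_ : c0 / 2 * A = c0 * A / 2); last by ring.
  by rewrite (_ : Cb * (2 * rho3) = 2 * Cb * rho3); [lra|ring].
by move: f4; rewrite ler_pdivlMr// mulrC.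
Qed.

(** No assumption is made on the law j steps earlier: the induction starts from r = 0, valid for
    every law, and each step multiplies 1-r by 1-s. *)
Lemma smoothness_iter j : exists C L : R, [/\ 0 <= C, 1 <= L &
  forall mu : nat -> probability R R,
  (forall i, (i < j)%N -> logistic_step lam (mu i) (mu i.+1)) ->
  local_smoothness (mu j) C (1 - (1 - s) ^+ j) L].
Proof.
have s0 := kb_s0 kb; have s1 := kb_s1 kb.
elim: j => [|j [C [L [C0 L1 IH]]]].
  exists 1, 1; split => // mu _; rewrite expr0 subrr; exact: local_smoothness0.
have r01 : 0 <= 1 - (1 - s) ^+ j <= 1.
  have u0 : 0 <= 1 - s by lra.
  by rewrite subr_ge0 exprn_ile1//= ?gerBl ?exprn_ge0//; lra.
have [C' [C'0 H]] := smoothness_step kb C0 r01 L1.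
exists C', (20 * L); split => //; first by lra.
move=> mu st; have := H (mu j) (mu j.+1) _ (st j (ltnSn j)).
rewrite subKr -exprSr => h; apply: h; apply: IH => i ij.
by apply: st; exact: ltnW.
Qed.

End separation.

(** * Choice of exponents and conclusion *)

(** One step suffices when s/(1-s) > a, that is s > a/(a+1). This is compatible with s <= a - 1/2
    exactly when (a-1)(a+1/2) > 0, whence the threshold a = 1; the condition on early times is then
    vacuous. *)
Lemma exponents (R : realType) (a : R) : 1 / 2 < a -> exists (s : R) (j : nat),
  [/\ 0 < s < 1, s <= a - 1 / 2, a < (1 - s)^-1 * (1 - (1 - s) ^+ j), (0 < j)%N &
   forall m, (m.+1 < j)%N -> m%:R * (a - 1 / 2) < 1].
Proof.
move=> ha; have [a1|a1] := leP a 1; last first.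
  pose u := Num.min (a - 1 / 2) 1.
  have a10 : 0 < a + 1 by lra.
  have ua : a / (a + 1) < u.
    by rewrite lt_min; apply/andP; split; rewrite ltr_pdivrMr//; nra.
  have u1 : u <= 1 by rewrite ge_min lexx orbT.
  have u2 : u <= a - 1 / 2 by rewrite ge_min lexx.
  have a20 : 0 < a / (a + 1) by rewrite divr_gt0//; lra.
  pose s := (a / (a + 1) + u) / 2.
  have s1 : a / (a + 1) < s by rewrite /s; lra.
  have s2 : s < u by rewrite /s; lra.
  exists s, 1%N; split => //; [lra|lra|].
  have v0 : 0 < 1 - s by lra.
  rewrite expr1 subKr mulrC ltr_pdivlMr//.
  by move: s1; rewrite ltr_pdivrMr//; lra.
pose s := a - 1 / 2; have s0 : 0 < s by rewrite /s; lra.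
have s1 : s < 1 by rewrite /s; lra.
have ex : exists j, 1 <= j%:R * s.
  exists (Num.Def.trunc s^-1).+1; rewrite -ler_pdivrMr// div1r ltW//.
  exact: truncnS_gt.
case: (ex_minnP ex) => k hk kmin.
exists s, k.+1; split => //; first by rewrite s0.
  have v0 : 0 < 1 - s by rewrite subr_gt0.
  (* Bernoulli gives (1-s)^k <= 1/2 once k s >= 1; as a = s + 1/2, it remains that (1-s)(s+1/2) +
     (1-s)/2 = 1 - s^2 < 1. *)
  rewrite mulrC ltr_pdivlMr// exprS.
  have s01 : 0 <= s <= 1 by rewrite !ltW.
  have b := bernoulli_upper k s01.
  have e0 : 0 <= (1 - s) ^+ k by rewrite exprn_ge0// ltW.
  have b2 : (1 - s) ^+ k * 2 <= 1.
    by apply: le_trans b; apply: ler_wpM2l => //; lra.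
  have b3 : (1 - s) * (1 - s) ^+ k <= (1 - s) * (1 / 2).
    by apply: ler_wpM2l; [exact: ltW|lra].
  have aE : a = s + 1 / 2 by rewrite /s; lra.
  by rewrite aE; nra.
move=> m; rewrite ltnS => mk; rewrite ltNge; apply/negP => /kmin.
by rewrite leqNgt mk.
Qed.

Lemma min_over_range (R : realType) (P : nat -> R -> Prop) j :
  (forall m c c', P m c -> 0 < c' -> c' <= c -> P m c') ->
  (forall m, (m < j)%N -> exists2 c : R, 0 < c & P m c) ->
  exists2 c : R, 0 < c & forall m, (m < j)%N -> P m c.
Proof.
move=> mono; elim: j => [|j IH] h; first by exists 1.
have [c c0 H] := IH (fun m mj => h m (ltnW mj)).
have [c' c'0 H'] := h j (ltnSn j).
have m0 : 0 < Num.min c c' by rewrite lt_min c0.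
exists (Num.min c c') => // m; rewrite ltnS leq_eqVlt => /orP[/eqP ->|mj].
  by apply: mono H' m0 _; rewrite ge_min lexx orbT.
by apply: mono (H m mj) m0 _; rewrite ge_min lexx.
Qed.

Lemma chain_tv_bound (R : realType) (a : R) (lam : probability R R) : 1 / 2 < a ->
  beta_law (a + 1 / 2) (a - 1 / 2) lam -> exists C : R, 0 <= C /\
  forall (mu : nat -> probability R R) (x : R) (pi : probability R R) n w,
  0 <= x <= 1 -> chain_from lam mu x -> beta_law a a pi -> (0 < n)%N ->
  0 <= w -> lip01_close (mu n.-1) pi w ->
  forall A, measurable A ->
  `|fine (mu n A) - fine (pi A)| <= C * w `^ (a / (a + 1)).
Proof.
move=> ha bl; have a0 : 0 < a by lra.
have a10 : 0 < a + 1 by lra.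
have [s [j [/andP[s0 s1] sq ar j0 early]]] := exponents ha.
have p1 : 1 <= a + 1 / 2 by lra.
have [K HK] := beta_kernel_bounds p1 s0 s1 sq.
have kb := HK lam bl.
have [Cs [L [Cs0 L1 Hs]]] := smoothness_iter kb j.
have [Cp [Cp0 Hp]] := beta_edge_mass a0.
have [C [C0 HC]] := tv_estimate kb a0 Cs0 L1 Cp0 ar.
have sg0 : 0 < a - 1 / 2 by lra.
have aE : a = a - 1 / 2 + 1 / 2 by lra.
have [c c0 Hc] : exists2 c : R, 0 < c & forall m, (m < j.-1)%N ->
    forall (mu : nat -> probability R R) (x : R) pi w, 0 <= x <= 1 -> chain_from lam mu x ->
    beta_law a a pi -> lip01_close (mu m) pi w -> c <= w.
  apply: (@min_over_range R (fun m c => forall (mu : nat -> probability R R) (x : R) pi w,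
    0 <= x <= 1 -> chain_from lam mu x ->
    beta_law a a pi -> lip01_close (mu m) pi w -> c <= w)).
    move=> m c c' h _ cc mu x pi w h1 h2 h3 h4; apply: (le_trans cc).
    exact: h h1 h2 h3 h4.
  move=> m mj; have mj' : (m.+1 < j)%N by rewrite -(prednK j0) ltnS.
  have [c [c0 H]] := early_separation kb sg0 aE (early m mj').
  by exists c.
pose e := a / (a + 1); have e0 : 0 < e by rewrite divr_gt0.
(* The second summand serves times n < j: there w >= c, so c^(-e) w^e >= 1 and the bound is
   trivial. *)
exists (C + c `^ (- e)); split; first by rewrite addr_ge0// powR_ge0.
move=> mu x pi n w x01 ch bp n0 w0 cl A mA; have [_ st] := ch.
have we0 : 0 <= w `^ e by exact: powR_ge0.
rewrite mulrDl -/e; have [jn|nj] := leqP j n; last first.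
  have cw : c <= w.
    by apply: (Hc n.-1) x01 ch bp cl; rewrite -ltnS !prednK.
  apply: (@le_trans _ _ 1).
    have := prob_fine01 (mu n) mA; have := prob_fine01 pi mA => /andP[? ?] /andP[? ?].
    by rewrite ler_norml; lra.
  apply: (@le_trans _ _ (c `^ (- e) * w `^ e)); last by rewrite lerDr mulr_ge0.
  rewrite powRN mulrC ler_pdivlMr ?powR_gt0// mul1r.
  by apply: ge0_ler_powR; rewrite ?nnegrE ?(ltW e0) ?(ltW c0).
apply: (@le_trans _ _ (C * w `^ e)); last by rewrite lerDl mulr_ge0 ?powR_ge0.
(* The scale of the estimate: dl^(a+1) = w and dl^a = w^e. *)
pose dl := w `^ (a + 1)^-1; have dl0 : 0 <= dl by exact: powR_ge0.
have -> : w `^ e = dl `^ a by rewrite /dl -powRrM mulrC.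
have inv := beta_invariant ha bl bp.
have lsm : local_smoothness (mu n) Cs (1 - (1 - s) ^+ j) L.
  (* The chain is restarted at time n - j from whatever law it then has, so the constants depend on
     neither n nor x. *)
  have := Hs (fun i => mu (i + (n - j))%N); rewrite subnKC//; apply => i _.
  exact: st.
have lsp : local_smoothness pi Cs (1 - (1 - s) ^+ j) L by apply: (Hs (fun=> pi)).
have stn : logistic_step lam (mu n.-1) (mu n) by have := st n.-1; rewrite prednK.
have cl' : lip01_close (mu n.-1) pi (dl `^ (a + 1)).
  by rewrite /dl -powRrM mulVf ?gt_eqF// powRr1.
exact: (HC _ _ _ dl dl0 lsm lsp stn inv (Hp pi bp) cl').
Qed.

Theorem theorem1 (R : realType) (a : R) (ha : 1 / 2 < a) :
  exists C : R,
    forall (d : measure_display) (T : measurableType d) (P : probability T R)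
      (B : nat -> {RV P >-> R}),
    mutually_independent B ->
    (forall i, has_Beta_distribution (B i) (a + 1 / 2) (a - 1 / 2)) ->
    forall (d' : measure_display) (T' : measurableType d')
      (P' : probability T' R) (beta_aa : {RV P' >-> R}),
    has_Beta_distribution beta_aa a a ->
    forall x : R, 0 < x < 1 ->
    forall n : nat, (1 <= n)%N ->
      (d_TV (distribution P (forward_RV B x n)) (distribution P' beta_aa)
       <= C%:E *
          d_W (distribution P (forward_RV B x n.-1)) (distribution P' beta_aa)
            `^ (a / (a + 1)))%E.

Proof.
(* The constant precedes the probability space, so a law of the variables is fixed here, from a
   alone. If there were none, the hypotheses on B could not be met and any constant would do. *)
pose law_exists := exists lam : probability R R, beta_law (a + 1 / 2) (a - 1 / 2) lam.
have [[lam bl]|nolaw] := pselect law_exists; last first.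
  exists 0 => d T P B _ hB; exfalso; apply: nolaw.
  by exists (distribution P (B 0)); exact: hB.
have [C [C0 HC]] := chain_tv_bound ha bl.
(* Adding 1 makes the constant positive, so that the right-hand side is infinite if the Wasserstein
   distance is. *)
exists (C + 1) => d T P B indB hB d' T' P' Y hY x /andP[x0 x1] n n0.
set pi := distribution P' Y; pose mu i := distribution P (forward_RV B x i).
have x01 : 0 <= x <= 1 by rewrite !ltW.
have C10 : 0 < C + 1 by lra.
have ch : chain_from lam mu x.
  split => [f bf|i].
    rewrite /mu /Rintegral.
    have -> : (\int[distribution P (forward_RV B x 0)]_t (f t)%:E = \int[P]_w (f x)%:E)%E.
      rewrite [LHS](@integral_pushforward _ _ _ _ R (forward_RV B x 0) _ P setT (EFin \o f))//.
        by apply/measurable_EFinP; case: bf.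
      rewrite preimage_setT.
      exact: (bm_integrable P measurableT (bm_comp bf (measurable_forward_iterate B x 0))).
    exact: (prob_intc P (f x)).
  apply: forward_logistic_step => // A mA.
  by rewrite (bl A mA); exact: hB.
have bp : beta_law a a pi by exact: hY.
have a0 : 0 < a by lra.
have e0 : a / (a + 1) != 0 by rewrite gt_eqF// divr_gt0//; lra.
have mu1 : mu n.-1 `[0, 1]%classic = 1%E.
  have p1 : 1 <= a + 1 / 2 by lra.
  have [s [j [/andP[s0 s1] sq _ _ _]]] := exponents ha.
  have [K HK] := beta_kernel_bounds p1 s0 s1 sq.
  have kb := HK lam bl; have h := chain_supp01 kb n.-1 x01 ch; exact: h.
have pi1 := beta_law_itv01 bp.
have W0 := d_W_ge0 (mu n.-1) pi.
rewrite -/(mu n) -/(mu n.-1); set W := d_W _ _ in W0 *.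
have [fW|] := boolP (W \is a fin_num); last first.
  rewrite ge0_fin_numE// -leNgt leye_eq => /eqP ->.
  by rewrite poweRyr// gt0_muley ?lte_fin// leey.
have cl := d_W_close mu1 pi1 fW.
rewrite -/W in cl; rewrite -(fineK fW) poweR_EFin -EFinM.
have w0 : 0 <= fine W by rewrite fine_ge0.
apply: ge_ereal_sup => _ [A mA <-].
have m1 : mu n A \is a fin_num by exact: fin_num_measure.
have m2 : pi A \is a fin_num by exact: fin_num_measure.
have -> : (`|mu n A - pi A| = `|fine (mu n A) - fine (pi A)|%:E)%E.
  by rewrite -abse_EFin EFinB !fineK.
rewrite lee_fin; apply: (le_trans (HC mu x pi n (fine W) x01 ch bp n0 w0 cl A mA)).
by apply: ler_wpM2r; [exact: powR_ge0|rewrite lerDl].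
Qed.
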